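(* Let $i_1=-2.3381\ldots$ be the largest (first negative) zero of the Airy function $\mathrm{Ai}$, and set $$a_0=-\frac{i_1}{2^{1/3}}=1.8557\ldots,\quad C_0=4^{1/3}\sqrt{\pi/e}\,|\mathrm{Ai}'(i_1)|=1.1966\ldots,\quad a_1=|i_1|=2.3381\ldots,\quad C_1=\sqrt{2\pi/e}\,|\mathrm{Ai}'(i_1)|=1.0660\ldots.$$ Then the limits below exist and, as $k\to\infty$ and $m\to\infty$ respectively, $$\tau_k^*:=\lim_{n\to\infty}\tau_{n,k}=C_0\Big(\frac2e\Big)^k e^{-a_0k^{1/3}}k^{-1/6}\big(1+O(k^{-1/3})\big),$$ $$\tau_m^{**}:=\lim_{n\to\infty}n^{m/2}\tau_{n,n-m}=C_1\Big(\frac{em}{2}\Big)^{m/2}e^{-a_1m^{1/3}}m^{-1/6}\big(1+O(m^{-1/3})\big).$$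
   Context: $T_n$ denotes the Chebyshev polynomial of the first kind of degree $n$, $T_n(\cos\theta)=\cos n\theta$. For integers $n\ge k+2$, $k\ge 1$, let $\omega_{n,k}$ be the rightmost (largest) zero of $T_n^{(k+1)}$ and define $\tau_{n,k}:=|T_n^{(k)}(\omega_{n,k})|/T_n^{(k)}(1)$. *)

(* Defs.v *)
From Stdlib Require Import Reals.
From Coquelicot Require Import Coquelicot.
Open Scope R_scope.

Fixpoint cheb (n : nat) (x : R) : R :=
  match n with
  | O => 1
  | S n' =>
    match n' with
    | O => x
    | S n'' => 2 * x * cheb n' x - cheb n'' x
    end
  end.

Definition chebD (n k : nat) (x : R) : R := Derive_n (cheb n) k x.

Definition omega (n k : nat) : R :=
  real (Lub_Rbar (fun x => chebD n (S k) x = 0)).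

Definition tau (n k : nat) : R :=
  Rabs (chebD n k (omega n k)) / chebD n k 1.

Definition Ai (x : R) : R :=
  / PI * real (Lim (fun T => RInt (fun t => cos (t ^ 3 / 3 + x * t)) 0 T) p_infty).

(* Main.v *)
Require Import Defs.
From Stdlib Require Import Reals Lra Lia Factorial.
From Coquelicot Require Import Coquelicot.
Open Scope R_scope.

(* Writing D_k for the k-th derivative of T_n, the Chebyshev equation (1 - x^2) D_(k+2) - (2k+1) x D_(k+1)
   + (n^2 - k^2) D_k = 0 has two scaling limits. For fixed k, D_k (1 - 2y/n^2) / D_k 1 tends to the Bessel
   type series 0F1(; k+1/2; -y); for fixed m, D_(n-m) (t / sqrt n) tends, suitably normalised, to a Hermite
   polynomial of degree m. So tau* and tau** are the values of such functions at the extreme zero of the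
   derivative.

   Both limit functions become, after a change of variable s, solutions of f'' = q f with
   q s = s + O(eps s^2) that tend to 0 at +oo. As f and Ai are both recessive, their Wronskian at 0 is O(eps),
   hence f / f 0 is O(eps)-close to Ai / Ai 0 on compact intervals; this locates the extreme zero and gives the
   slope there. Only the value f 0 remains: it is a contour integral along a circular arc passing
   at distance 1/r from a degenerate saddle point, where r^3 is half the large parameter, and differs by O(1/r)
   from the absolutely convergent integral for Ai 0 obtained by shifting the Airy contour to Im t = 1. *)

(** * Calculus preliminaries *)

(** The quantity to estimate contains e^(r s0), where s0 is the extreme zero in the variable s. A
    relative error O(1/r) therefore requires s0 up to O(1/r^2). Both substitutions are chosen so
    that the potential q vanishes at s = 0, has slope 1 there and satisfies |q - s| <= s^2 / r^2;
    this dictates the shifted parameters k + 1/2 and 2p + 1 with p = m - 1. Then e^(r (s0 - i1)) = 1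
    + O(1/r), and 1/r has the order of k^(-1/3) or m^(-1/3). The value f 0 is only needed to
    relative accuracy 1/r. Through a double saddle point the natural contour gives, to leading
    order, an integrand of modulus 1 that merely oscillates, like the Airy integral itself. The
    offset 1/r turns the modulus into e^(-t^2), so integrands can be compared pointwise under a
    Gaussian bound. Everything is done with real integrals. A contour identity is proved either by
    differentiating in a deformation parameter, where the Cauchy-Riemann equations produce an exact
    derivative, or by checking that both sides obey the same three-term recurrence. The limit in n
    is taken for fixed k or m, so no uniformity in k or m is required of it. *)

Ltac pos := solve [repeat first
  [ assumption | lra | apply exp_pos | apply Rabs_pos | apply pow2_ge_0 | apply pos_INR
  | apply Rmult_lt_0_compat | apply Rdiv_lt_0_compat | apply Rinv_0_lt_compat | apply pow_lt | apply sqrt_lt_R0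
  | apply Rmult_le_pos | apply pow_le | left ]].

Lemma is_derive_cont (f : R -> R) (x l : R) : is_derive f x l -> continuous f x.
Proof. intros H. apply (ex_derive_continuous (V := R_NormedModule)). now exists l. Qed.

Lemma is_derive_Rconst (c x : R) : is_derive (fun _ : R => c) x 0.
Proof. apply (is_derive_const (K := R_AbsRing) (V := R_NormedModule)). Qed.

Lemma is_derive_Rplus (f g : R -> R) (x a b : R) :
  is_derive f x a -> is_derive g x b -> is_derive (fun t => f t + g t) x (a + b).
Proof. apply (is_derive_plus (K := R_AbsRing) (V := R_NormedModule)). Qed.

Lemma is_derive_Rminus (f g : R -> R) (x a b : R) :
  is_derive f x a -> is_derive g x b -> is_derive (fun t => f t - g t) x (a - b).
Proof. apply (is_derive_minus (K := R_AbsRing) (V := R_NormedModule)). Qed.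

Lemma is_derive_Ropp (f : R -> R) (x a : R) : is_derive f x a -> is_derive (fun t => - f t) x (- a).
Proof. apply (is_derive_opp (K := R_AbsRing) (V := R_NormedModule)). Qed.

Lemma is_derive_Rmult (f g : R -> R) (x a b : R) :
  is_derive f x a -> is_derive g x b -> is_derive (fun t => f t * g t) x (a * g x + f x * b).
Proof. intros Hf Hg. apply (is_derive_mult (K := R_AbsRing)); auto. apply Rmult_comm. Qed.

Lemma is_derive_Rcomp (f g : R -> R) (x a b : R) :
  is_derive f (g x) a -> is_derive g x b -> is_derive (fun t => f (g t)) x (b * a).
Proof. apply (is_derive_comp (K := R_AbsRing) (V := R_NormedModule)). Qed.

Lemma continuous_lin (f g : R -> R) (u v x : R) :
  continuous f x -> continuous g x -> continuous (fun t => u * f t + v * g t) x.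
Proof.
  intros Hf Hg. apply (continuous_plus (V := R_NormedModule) (fun t => u * f t) (fun t => v * g t));
    now apply (continuous_mult (K := R_AbsRing) (fun _ => _)); [apply continuous_const |].
Qed.

Lemma inv_le_half (r : R) : 2 <= r -> 0 < / r <= 1 / 2.
Proof.
  intros Hr. split. apply Rinv_0_lt_compat; lra.
  replace (1 / 2) with (/ 2) by field. apply Rinv_le_contravar; lra.
Qed.

Lemma le_of_derive_nonneg (f df : R -> R) (a b : R) : a <= b ->
  (forall x, a <= x <= b -> is_derive f x (df x)) ->
  (forall x, a <= x <= b -> 0 <= df x) -> f a <= f b.
Proof.
  intros Hab Hd Hp.
  destruct (MVT_gen f a b df) as [c [Hc E]].
  - intros x Hx. rewrite Rmin_left, Rmax_right in Hx by lra. apply Hd; lra.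
  - intros x Hx. rewrite Rmin_left, Rmax_right in Hx by lra.
    apply continuity_pt_filterlim. apply is_derive_cont with (df x). apply Hd; lra.
  - rewrite Rmin_left, Rmax_right in Hc by lra.
    assert (0 <= df c) by (apply Hp; lra). nra.
Qed.

Lemma le_of_derive_le (f df g dg : R -> R) (a b : R) : a <= b ->
  (forall x, a <= x <= b -> is_derive f x (df x)) ->
  (forall x, a <= x <= b -> is_derive g x (dg x)) ->
  (forall x, a <= x <= b -> df x <= dg x) -> f a <= g a -> f b <= g b.
Proof.
  intros Hab Hf Hg Hle H0.
  assert (H : g a - f a <= g b - f b).
  { apply (le_of_derive_nonneg (fun x => g x - f x) (fun x => dg x - df x)); auto.
    - intros x Hx. apply is_derive_Rminus; auto.
    - intros x Hx. specialize (Hle x Hx). lra. }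
  lra.
Qed.

Lemma sin_le_id (x : R) : 0 <= x -> sin x <= x.
Proof.
  intros Hx.
  apply (le_of_derive_le sin cos (fun x => x) (fun _ => 1) 0 x Hx).
  - intros y _. apply is_derive_sin.
  - intros y _. apply (is_derive_id (K := R_AbsRing)).
  - intros y _. apply COS_bound.
  - rewrite sin_0. lra.
Qed.

Lemma cos_ge_2 (x : R) : 0 <= x -> 1 - x ^ 2 / 2 <= cos x.
Proof.
  intros Hx.
  apply (le_of_derive_le (fun x => 1 - x ^ 2 / 2) (fun x => - x) cos (fun x => - sin x) 0 x Hx).
  - intros y _. auto_derive; auto; field.
  - intros y _. apply is_derive_cos.
  - intros y Hy. pose proof (sin_le_id y). lra.
  - rewrite cos_0. lra.
Qed.

Lemma sin_ge_3 (x : R) : 0 <= x -> x - x ^ 3 / 6 <= sin x.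
Proof.
  intros Hx.
  apply (le_of_derive_le (fun x => x - x ^ 3 / 6) (fun x => 1 - x ^ 2 / 2) sin cos 0 x Hx).
  - intros y _. auto_derive; auto; field.
  - intros y _. apply is_derive_sin.
  - intros y Hy. apply cos_ge_2; lra.
  - rewrite sin_0. lra.
Qed.

Lemma cos_le_4 (x : R) : 0 <= x -> cos x <= 1 - x ^ 2 / 2 + x ^ 4 / 24.
Proof.
  intros Hx.
  apply (le_of_derive_le cos (fun x => - sin x) (fun x => 1 - x ^ 2 / 2 + x ^ 4 / 24) (fun x => - (x - x ^ 3 / 6)) 0 x Hx).
  - intros y _. apply is_derive_cos.
  - intros y _. auto_derive; auto; field.
  - intros y Hy. pose proof (sin_ge_3 y). lra.
  - rewrite cos_0. lra.
Qed.

Lemma sin_le_5 (x : R) : 0 <= x -> sin x <= x - x ^ 3 / 6 + x ^ 5 / 120.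
Proof.
  intros Hx.
  apply (le_of_derive_le sin cos (fun x => x - x ^ 3 / 6 + x ^ 5 / 120) (fun x => 1 - x ^ 2 / 2 + x ^ 4 / 24) 0 x Hx).
  - intros y _. apply is_derive_sin.
  - intros y _. auto_derive; auto; field.
  - intros y Hy. apply cos_le_4; lra.
  - rewrite sin_0. lra.
Qed.

(** 1 - cos x = 2 sin^2(x/2), and the cubic minorant of sin gives sin(x/2) >= x/6 for 0 <= x <= 4,
    hence on all of [0, pi]. The crude constant 18 buys one Gaussian bound e^(-t^2/18) along a whole
    arc. *)
Lemma one_minus_cos_ge (x : R) : 0 <= x <= PI -> x ^ 2 / 18 <= 1 - cos x.
Proof.
  intros Hx. pose proof PI_4.
  replace x with (2 * (x / 2)) at 2 by field.
  rewrite cos_2a_sin.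
  pose proof (sin_ge_3 (x / 2) ltac:(lra)).
  assert (x / 6 <= sin (x / 2)).
  { apply Rle_trans with (2 := H0). assert (0 <= x * (4 - x) * (4 + x)) by (repeat apply Rmult_le_pos; lra).
    nra. }
  nra.
Qed.

Lemma lipschitz_of_derive (f df : R -> R) (M x y : R) :
  (forall z, is_derive f z (df z)) -> (forall z, Rabs (df z) <= M) ->
  Rabs (f y - f x) <= M * Rabs (y - x).
Proof.
  intros Hd HM.
  destruct (MVT_gen f x y df) as [c [_ E]].
  - auto.
  - intros z _. apply continuity_pt_filterlim. now apply is_derive_cont with (df z).
  - rewrite E, Rabs_mult. apply Rmult_le_compat_r; auto. apply Rabs_pos.
Qed.

Lemma Rabs_cos_sub_le (x y : R) : Rabs (cos x - cos y) <= Rabs (x - y).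
Proof.
  rewrite <- (Rmult_1_l (Rabs (x - y))).
  apply (lipschitz_of_derive cos (fun z => - sin z)).
  - apply is_derive_cos.
  - intros z. rewrite Rabs_Ropp. apply Rabs_le. pose proof (SIN_bound z). lra.
Qed.

Lemma exp_le (x y : R) : x <= y -> exp x <= exp y.
Proof. intros [H | ->]; [left; now apply exp_increasing | right; auto]. Qed.

Lemma exp_ge_1_plus (x : R) : 1 + x <= exp x.
Proof. apply exp_ineq1_le. Qed.

Lemma Rabs_exp_sub_le (x y z : R) : x <= z -> y <= z ->
  Rabs (exp x - exp y) <= Rabs (x - y) * exp z.
Proof.
  assert (H : forall x y, x <= y -> y <= z -> Rabs (exp x - exp y) <= Rabs (x - y) * exp z).
  { intros a b Hab Hb. rewrite (Rabs_left1 (a - b)) by lra.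
    pose proof (exp_le _ _ Hab). rewrite Rabs_left1 by lra.
    pose proof (exp_ge_1_plus (a - b)). pose proof (exp_pos b). pose proof (exp_le _ _ Hb).
    assert (exp a = exp b * exp (a - b)) by (rewrite <- exp_plus; f_equal; ring).
    nra. }
  intros Hx Hy. destruct (Rle_dec x y).
  - now apply H.
  - rewrite Rabs_minus_sym, (Rabs_minus_sym x). apply H; lra.
Qed.

(** A Lipschitz bound for Re e^(p + i q) below the level e^M: integrands given by log-modulus and
    phase are compared through these two real functions. *)
Lemma Rabs_exp_cos_sub_le (p q p0 q0 M : R) : p <= M -> p0 <= M ->
  Rabs (exp p * cos q - exp p0 * cos q0) <= (Rabs (p - p0) + Rabs (q - q0)) * exp M.
Proof.
  intros H H0.
  replace (exp p * cos q - exp p0 * cos q0) with ((exp p - exp p0) * cos q + exp p0 * (cos q - cos q0)) by ring.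
  eapply Rle_trans. apply Rabs_triang. rewrite !Rabs_mult, Rmult_plus_distr_r.
  pose proof (exp_pos p0). pose proof (exp_le _ _ H0).
  apply Rplus_le_compat.
  - rewrite <- (Rmult_1_r (_ * exp M)). apply Rmult_le_compat; try apply Rabs_pos.
    + now apply Rabs_exp_sub_le.
    + apply Rabs_le. pose proof (COS_bound q). lra.
  - rewrite (Rabs_pos_eq (exp p0)) by lra. rewrite Rmult_comm. apply Rmult_le_compat; try apply Rabs_pos; try lra.
    apply Rabs_cos_sub_le.
Qed.

Lemma exp_ge_pow4 (t : R) : 0 <= t -> 1 + t + t ^ 2 / 2 + t ^ 3 / 6 + t ^ 4 / 24 <= exp t.
Proof.
  (* Integrating [dP <= exp] from 0 raises the degree of a Taylor minorant by one. *)
  assert (step : forall P dP : R -> R, (forall x, is_derive P x (dP x)) -> P 0 <= 1 ->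
    (forall x, 0 <= x -> dP x <= exp x) -> forall x, 0 <= x -> P x <= exp x).
  { intros P dP HP H0 Hd x Hx.
    apply (le_of_derive_le P dP exp exp 0 x Hx); auto.
    - intros y _. apply is_derive_exp.
    - intros y Hy. apply Hd; lra.
    - rewrite exp_0; auto. }
  assert (H1 : forall x, 0 <= x -> 1 + x <= exp x) by (intros; apply exp_ge_1_plus).
  assert (H2 : forall x, 0 <= x -> 1 + x + x ^ 2 / 2 <= exp x).
  { apply (step _ (fun x => 1 + x)); auto; [intros; auto_derive; auto; field | lra]. }
  assert (H3 : forall x, 0 <= x -> 1 + x + x ^ 2 / 2 + x ^ 3 / 6 <= exp x).
  { apply (step _ (fun x => 1 + x + x ^ 2 / 2)); auto; [intros; auto_derive; auto; field | lra]. }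
  intros H. revert H. revert t.
  apply (step _ (fun x => 1 + x + x ^ 2 / 2 + x ^ 3 / 6)); auto; [intros; auto_derive; auto; field | lra].
Qed.

(** Completing the square: (c t - 1)^2 / c >= 0. *)
Lemma gauss_le_exp (c t : R) : 0 < c -> exp (- (c * t ^ 2)) <= exp (/ c) * exp (- (2 * t)).
Proof.
  intros Hc. rewrite <- exp_plus. apply exp_le.
  assert (0 <= (c * t - 1) ^ 2 / c).
  { apply Rmult_le_pos. apply pow2_ge_0. left; now apply Rinv_0_lt_compat. }
  replace ((c * t - 1) ^ 2 / c) with (c * t ^ 2 - 2 * t + / c) in H by (field; lra). lra.
Qed.

(** One half of the e^(-2t) from [gauss_le_exp] absorbs the polynomial, because 24 times the quartic
    Taylor polynomial of e^t dominates it. Degree 4 is what the phase estimates on the arcs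
    produce. *)
Lemma poly_gauss_le (c t : R) : 0 < c -> 0 <= t ->
  (1 + t + t ^ 2 + t ^ 3 + t ^ 4) * exp (- (c * t ^ 2)) <= 24 * exp (/ c) * exp (- t).
Proof.
  intros Hc Ht.
  pose proof (gauss_le_exp c t Hc). pose proof (exp_ge_pow4 t Ht).
  assert (0 <= t ^ 2 /\ 0 <= t ^ 3 /\ 0 <= t ^ 4) as (? & ? & ?) by (repeat split; now apply pow_le).
  replace (24 * exp (/ c) * exp (- t)) with (24 * exp t * (exp (/ c) * exp (- (2 * t)))).
  2:{ replace (- t) with (t + - (2 * t)) by ring. rewrite exp_plus. ring. }
  apply Rmult_le_compat; try lra. left; apply exp_pos.
Qed.

(** * Integrals of continuous functions, on segments and on [0, oo) *)

Lemma ex_RInt_cont (f : R -> R) (a b : R) : (forall x, continuous f x) -> ex_RInt f a b.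
Proof. intros H. apply (ex_RInt_continuous (V := R_CompleteNormedModule)). auto. Qed.

Lemma RInt_FTC (F f : R -> R) (a b : R) :
  (forall x, is_derive F x (f x)) -> (forall x, continuous f x) -> RInt f a b = F b - F a :> R.
Proof.
  intros HF Hf. apply is_RInt_unique. apply (is_RInt_derive (V := R_CompleteNormedModule) F f); auto.
Qed.

Lemma RInt_abs_le (f g : R -> R) (a b : R) : a <= b ->
  (forall x, continuous f x) -> (forall x, continuous g x) ->
  (forall x, a <= x <= b -> Rabs (f x) <= g x) -> Rabs (RInt f a b) <= RInt g a b.
Proof.
  intros Hab Hf Hg H.
  apply (norm_RInt_le (V := R_NormedModule) f g a b); auto; apply (RInt_correct (V := R_CompleteNormedModule)); now apply ex_RInt_cont.
Qed.

Lemma RInt_Chasles_cont (f : R -> R) (a b c : R) : (forall x, continuous f x) ->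
  RInt f a b + RInt f b c = RInt f a c :> R.
Proof. intros H. apply (RInt_Chasles (V := R_CompleteNormedModule)); now apply ex_RInt_cont. Qed.

Lemma RInt_exp_neg (a b C : R) : RInt (fun t => C * exp (- t)) a b = C * exp (- a) - C * exp (- b) :> R.
Proof.
  rewrite (RInt_FTC (fun t => - C * exp (- t))). ring.
  - intros x. auto_derive; auto; ring.
  - intros x. apply (ex_derive_continuous (V := R_NormedModule)). auto_derive; auto.
Qed.

(** The improper integral, taken along integer endpoints and total; under exponential domination
    [RInt_oo_tail] controls its distance to the integral up to any real endpoint. *)
Definition RInt_oo (g : R -> R) : R := real (Lim_seq (fun n => RInt g 0 (INR n))).

Lemma RInt_oo_tail (g : R -> R) (C T : R) : (forall x, continuous g x) ->
  (forall t, 0 <= t -> Rabs (g t) <= C * exp (- t)) -> 0 <= T ->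
  Rabs (RInt_oo g - RInt g 0 T) <= C * exp (- T).
Proof.
  intros Hg HC HT.
  assert (HC0 : 0 <= C).
  { specialize (HC 0 ltac:(lra)). rewrite Ropp_0, exp_0 in HC. pose proof (Rabs_pos (g 0)). lra. }
  assert (HE : forall a, continuous (fun t => C * exp (- t)) a).
  { intros x. apply (ex_derive_continuous (V := R_NormedModule)). auto_derive; auto. }
  assert (H : forall a b, 0 <= a <= b -> Rabs (RInt g 0 b - RInt g 0 a) <= C * exp (- a) - C * exp (- b)).
  { intros a b Hab.
    rewrite <- (RInt_Chasles_cont g 0 a b) by auto.
    replace (RInt g 0 a + RInt g a b - RInt g 0 a) with (RInt g a b) by lra.
    rewrite <- RInt_exp_neg. apply RInt_abs_le; auto; try lra.
    intros x Hx. apply HC. lra. }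
  assert (Hex : ex_finite_lim_seq (fun n => RInt g 0 (INR n))).
  { apply ex_lim_seq_cauchy_corr. intros eps.
    assert (Hlim : is_lim_seq (fun n => C * exp (- INR n)) (C * 0)).
    { apply is_lim_seq_mult with C 0; [apply is_lim_seq_const | | reflexivity].
      apply (is_lim_comp_seq exp _ m_infty).
      - apply is_lim_exp_m.
      - exists O. intros; discriminate.
      - apply (is_lim_seq_opp _ p_infty), is_lim_seq_INR. }
    rewrite Rmult_0_r in Hlim.
    apply is_lim_seq_spec in Hlim. destruct (Hlim eps) as [N HN].
    assert (Hle : forall n m, (N <= n <= m)%nat -> Rabs (RInt g 0 (INR n) - RInt g 0 (INR m)) < eps).
    { intros n m Hnm. rewrite Rabs_minus_sym.
      eapply Rle_lt_trans. apply H. split. apply pos_INR. apply le_INR; lia.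
      specialize (HN n ltac:(lia)). rewrite Rminus_0_r in HN.
      pose proof (Rle_abs (C * exp (- INR n))). pose proof (exp_pos (- INR m)). nra. }
    exists N. intros n m Hn Hm. destruct (Nat.le_ge_cases n m).
    - apply Hle; lia.
    - rewrite Rabs_minus_sym. apply Hle; lia. }
  apply Lim_seq_correct' in Hex. fold (RInt_oo g) in Hex.
  assert (Hl : is_lim_seq (fun n => Rabs (RInt g 0 (INR n) - RInt g 0 T)) (Rabs (RInt_oo g - RInt g 0 T))).
  { apply (is_lim_seq_abs _ (Finite _)). apply is_lim_seq_minus'; auto. apply is_lim_seq_const. }
  refine (is_lim_seq_le_loc _ (fun _ => C * exp (- T)) (Rabs (RInt_oo g - RInt g 0 T)) (C * exp (- T)) _ Hl _).
  2: apply is_lim_seq_const.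
  destruct (nfloor_ex T HT) as [N HN]. exists (S N). intros n Hn.
  eapply Rle_trans. apply H. split; auto. apply le_INR in Hn. rewrite S_INR in Hn. lra.
  pose proof (exp_pos (- INR n)). nra.
Qed.

(** The tool for moving contours: for the real part of an analytic integrand, the integral of [df u]
    on the right can then be evaluated exactly, since the parameter derivative is also a derivative
    in the integration variable. *)
Lemma is_derive_RInt_param_cont (f df : R -> R -> R) (a b u : R) :
  (forall u t, is_derive (fun v => f v t) u (df u t)) ->
  (forall u t, continuous (fun z : R * R => df (fst z) (snd z)) (u, t)) ->
  (forall u t, continuous (f u) t) ->
  is_derive (fun v => RInt (f v) a b) u (RInt (df u) a b).
Proof.
  intros H1 H2 H3.
  rewrite (RInt_ext (df u) (fun t => Derive (fun v => f v t) u)).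
  2:{ intros t _. symmetry. now apply is_derive_unique. }
  apply (is_derive_RInt_param f a b u).
  - apply filter_forall. intros v t _. now exists (df v t).
  - intros t _. apply continuity_2d_pt_filterlim.
    cbv beta. replace (Derive (fun z : R => f z t) u) with (df u t)
      by (symmetry; now apply is_derive_unique).
    apply filterlim_ext with (2 := H2 u t).
    intros z. symmetry. now apply is_derive_unique.
  - apply filter_forall. intros v. now apply ex_RInt_cont.
Qed.

Ltac cont2 :=
  match goal with
  | |- continuous (fun _ => ?c) _ => apply continuous_const
  | |- continuous (fun z => fst z) _ => apply continuous_fst
  | |- continuous (fun z => snd z) _ => apply continuous_snd
  | |- continuous (fun z => @?f z + @?g z) _ => apply (continuous_plus (V := R_NormedModule) f g); cont2
  | |- continuous (fun z => @?f z - @?g z) _ => apply (continuous_minus (V := R_NormedModule) f g); cont2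
  | |- continuous (fun z => - @?f z) _ => apply (continuous_opp (V := R_NormedModule) f); cont2
  | |- continuous (fun z => @?f z * @?g z) _ => apply (continuous_mult (K := R_AbsRing) f g); cont2
  | |- continuous (fun z => @?f z / ?c) _ => apply (continuous_mult (K := R_AbsRing) f (fun _ => / c)); cont2
  | |- continuous (fun z => (@?f z) ^ ?n) _ =>
      apply (continuous_comp f (fun y => y ^ n)); [cont2 | apply (ex_derive_continuous (V := R_NormedModule)); auto_derive; auto]
  | |- continuous (fun z => exp (@?f z)) _ => apply (continuous_comp f exp); [cont2 | apply continuous_exp]
  | |- continuous (fun z => cos (@?f z)) _ => apply (continuous_comp f cos); [cont2 | apply continuous_cos]
  | |- continuous (fun z => sin (@?f z)) _ => apply (continuous_comp f sin); [cont2 | apply continuous_sin]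
  end.

Ltac cont1 := apply (ex_derive_continuous (V := R_NormedModule)); auto_derive; auto.

(* [auto_derive] rewrites the arguments of transcendental functions; identify them again before calling [field]. *)
Ltac merge_args f :=
  repeat match goal with
  | |- context [f ?a] =>
    match goal with
    | |- context [f ?b] =>
      tryif constr_eq a b then fail else (replace (f b) with (f a) by (f_equal; try field; auto; lra))
    end
  end.

Ltac field_trig := merge_args exp; merge_args sin; merge_args cos; try field; auto; try lra.

Ltac eq_in_R := match goal with |- @eq _ ?a ?b => change (@eq R a b) end.

(** * The Airy function *)

(** A quadratic remainder bound survives integration over [0, oo), so differentiation under the
    improper integral reduces to integrating a pointwise Taylor estimate. *)
Lemma is_derive_of_quadratic (f : R -> R) (x l B : R) :
  (forall h, Rabs (f (x + h) - f x - h * l) <= B * h ^ 2) -> is_derive f x l.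
Proof.
  intros H. apply is_derive_Reals. intros eps Heps.
  assert (HB : 0 <= B).
  { specialize (H 1). pose proof (Rabs_pos (f (x + 1) - f x - 1 * l)). lra. }
  assert (Hd : 0 < eps / (B + 1)) by (apply Rdiv_lt_0_compat; lra).
  exists (mkposreal _ Hd). intros h Hh0 Hh. simpl in Hh.
  replace ((f (x + h) - f x) / h - l) with ((f (x + h) - f x - h * l) / h) by (field; auto).
  unfold Rdiv. rewrite Rabs_mult, Rabs_inv.
  assert (Hp : 0 < Rabs h) by now apply Rabs_pos_lt.
  apply Rle_lt_trans with (B * h ^ 2 * / Rabs h).
  - apply Rmult_le_compat_r; auto. left. now apply Rinv_0_lt_compat.
  - rewrite <- (pow2_abs h). replace (B * Rabs h ^ 2 * / Rabs h) with (B * Rabs h) by (field; lra).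
    apply Rle_lt_trans with ((B + 1) * Rabs h); [nra |].
    replace eps with ((B + 1) * (eps / (B + 1))) by (field; lra).
    apply Rmult_lt_compat_l; lra.
Qed.

Lemma taylor_1_lipschitz (f df : R -> R) (a b : R) :
  (forall x, is_derive f x (df x)) -> (forall x y, Rabs (df x - df y) <= Rabs (x - y)) ->
  Rabs (f (a + b) - f a - b * df a) <= b ^ 2.
Proof.
  intros Hd HL.
  destruct (MVT_gen f a (a + b) df) as [c [Hc E]]; auto.
  { intros z _. apply continuity_pt_filterlim. now apply is_derive_cont with (df z). }
  rewrite E. replace (df c * (a + b - a) - b * df a) with (b * (df c - df a)) by ring.
  rewrite Rabs_mult, <- (pow2_abs b). replace (Rabs b ^ 2) with (Rabs b * Rabs b) by ring.
  apply Rmult_le_compat_l. apply Rabs_pos.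
  eapply Rle_trans. apply HL.
  unfold Rmin, Rmax in Hc. unfold Rabs. destruct (Rle_dec a (a + b)), (Rcase_abs (c - a)), (Rcase_abs b); lra.
Qed.

Lemma Rabs_sin_sub_le (x y : R) : Rabs (sin x - sin y) <= Rabs (x - y).
Proof.
  rewrite <- (Rmult_1_l (Rabs (x - y))).
  apply (lipschitz_of_derive sin cos).
  - apply is_derive_sin.
  - intros z. apply Rabs_le. pose proof (COS_bound z). lra.
Qed.

Lemma cos_taylor_1 (a b : R) : Rabs (cos (a + b) - cos a + b * sin a) <= b ^ 2.
Proof.
  replace (cos (a + b) - cos a + b * sin a) with (cos (a + b) - cos a - b * - sin a) by ring.
  apply (taylor_1_lipschitz cos (fun x => - sin x)). apply is_derive_cos.
  intros x y. replace (- sin x - - sin y) with (- (sin x - sin y)) by ring.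
  rewrite Rabs_Ropp. apply Rabs_sin_sub_le.
Qed.

Lemma sin_taylor_1 (a b : R) : Rabs (sin (a + b) - sin a - b * cos a) <= b ^ 2.
Proof. apply (taylor_1_lipschitz sin cos). apply is_derive_sin. apply Rabs_cos_sub_le. Qed.

(** On this class [RInt_oo] is linear, and since e^(-t) has mass 1 the same [C] bounds the
    integral. *)
Definition exp_dominated (g : R -> R) (C : R) : Prop :=
  (forall x, continuous g x) /\ forall t, 0 <= t -> Rabs (g t) <= C * exp (- t).

Lemma RInt_oo_lim (g : R -> R) (C : R) : exp_dominated g C ->
  is_lim_seq (fun n => RInt g 0 (INR n)) (RInt_oo g).
Proof.
  intros [Hc HC].
  apply is_lim_seq_spec. intros eps.
  assert (Hlim : is_lim_seq (fun n => C * exp (- INR n)) (C * 0)).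
  { apply is_lim_seq_mult with C 0; [apply is_lim_seq_const | | reflexivity].
    apply (is_lim_comp_seq exp _ m_infty).
    - apply is_lim_exp_m.
    - exists O. intros; discriminate.
    - apply (is_lim_seq_opp _ p_infty), is_lim_seq_INR. }
  rewrite Rmult_0_r in Hlim.
  apply is_lim_seq_spec in Hlim. destruct (Hlim eps) as [N HN]. exists N. intros n Hn.
  specialize (HN n Hn). rewrite Rminus_0_r in HN.
  rewrite Rabs_minus_sym.
  eapply Rle_lt_trans. apply (RInt_oo_tail g C (INR n)); auto. apply pos_INR.
  eapply Rle_lt_trans. apply Rle_abs. exact HN.
Qed.

Lemma RInt_oo_bound (g : R -> R) (C : R) : exp_dominated g C -> Rabs (RInt_oo g) <= C.
Proof.
  intros [Hc HC]. pose proof (RInt_oo_tail g C 0 Hc HC ltac:(lra)) as H.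
  rewrite (RInt_point (V := R_CompleteNormedModule)) in H.
  change (zero (G := R_CompleteNormedModule)) with 0 in H.
  rewrite Rminus_0_r, Ropp_0, exp_0, Rmult_1_r in H. exact H.
Qed.

Lemma RInt_lin (f g : R -> R) (a b u v : R) :
  (forall x, continuous f x) -> (forall x, continuous g x) ->
  RInt (fun t => u * f t + v * g t) a b = u * RInt f a b + v * RInt g a b :> R.
Proof.
  intros Hf Hg. apply is_RInt_unique.
  apply (is_RInt_plus (V := R_NormedModule)).
  - apply (is_RInt_scal (V := R_NormedModule) f). apply (RInt_correct (V := R_CompleteNormedModule)). now apply ex_RInt_cont.
  - apply (is_RInt_scal (V := R_NormedModule) g). apply (RInt_correct (V := R_CompleteNormedModule)). now apply ex_RInt_cont.
Qed.

Lemma RInt_oo_lin (f g : R -> R) (Cf Cg u v : R) :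
  exp_dominated f Cf -> exp_dominated g Cg ->
  RInt_oo (fun t => u * f t + v * g t) = u * RInt_oo f + v * RInt_oo g.
Proof.
  intros Hf Hg. unfold RInt_oo at 1.
  rewrite (is_lim_seq_unique _ (u * RInt_oo f + v * RInt_oo g)); auto.
  apply is_lim_seq_ext with (fun n => u * RInt f 0 (INR n) + v * RInt g 0 (INR n)).
  - intros n. symmetry. apply RInt_lin. apply Hf. apply Hg.
  - apply is_lim_seq_plus'; apply (is_lim_seq_scal_l _ _ (Finite _)); eapply RInt_oo_lim; eauto.
Qed.

Lemma exp_dominated_lin (f g : R -> R) (Cf Cg u v : R) :
  exp_dominated f Cf -> exp_dominated g Cg ->
  exp_dominated (fun t => u * f t + v * g t) (Rabs u * Cf + Rabs v * Cg).
Proof.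
  intros [Hf HCf] [Hg HCg]. split.
  - intros x. apply (continuous_plus (V := R_NormedModule) (fun t => u * f t) (fun t => v * g t)).
    + apply (continuous_mult (K := R_AbsRing) (fun _ => u) f). apply continuous_const. apply Hf.
    + apply (continuous_mult (K := R_AbsRing) (fun _ => v) g). apply continuous_const. apply Hg.
  - intros t Ht. eapply Rle_trans. apply Rabs_triang. rewrite !Rabs_mult, Rmult_plus_distr_r, !Rmult_assoc.
    apply Rplus_le_compat; apply Rmult_le_compat_l; auto; apply Rabs_pos.
Qed.

Lemma is_derive_RInt_oo (g dg : R -> R -> R) (C B x : R) :
  (forall x, exp_dominated (g x) C) -> (forall x, exp_dominated (dg x) C) ->
  (forall h t, 0 <= t -> Rabs (g (x + h) t - g x t - h * dg x t) <= h ^ 2 * (B * exp (- t))) ->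
  is_derive (fun x => RInt_oo (g x)) x (RInt_oo (dg x)).
Proof.
  intros Hg Hdg HB. apply is_derive_of_quadratic with B. intros h.
  replace (RInt_oo (g (x + h)) - RInt_oo (g x) - h * RInt_oo (dg x)) with
    (1 * RInt_oo (fun t => 1 * g (x + h) t + (-1) * g x t) + (- h) * RInt_oo (dg x)).
  2:{ rewrite (RInt_oo_lin _ _ C C) by auto. ring. }
  assert (D := exp_dominated_lin _ _ _ _ 1 (-1) (Hg (x + h)) (Hg x)).
  erewrite <- RInt_oo_lin by eauto.
  apply RInt_oo_bound. split.
  - eapply exp_dominated_lin; eauto.
  - intros t Ht.
    replace (1 * (1 * g (x + h) t + -1 * g x t) + - h * dg x t) with (g (x + h) t - g x t - h * dg x t) by ring.
    replace (B * h ^ 2 * exp (- t)) with (h ^ 2 * (B * exp (- t))) by ring. auto.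
Qed.

(* Shifting the contour of the Airy integral to Im = 1 gives pi e^(x-1/3) Ai(x) = int_0^oo airy_g0 x. *)
Definition airy_g0 (x t : R) : R := exp (- (1 * t ^ 2)) * cos (t ^ 3 / 3 + (x - 1) * t).
Definition airy_g1 (x t : R) : R := - (t * exp (- (1 * t ^ 2)) * sin (t ^ 3 / 3 + (x - 1) * t)).
Definition airy_g2 (x t : R) : R := - (t ^ 2 * exp (- (1 * t ^ 2)) * cos (t ^ 3 / 3 + (x - 1) * t)).

(** The constant of [poly_gauss_le] at [c = 1]; the unreduced [/ 1] here and [1 * t ^ 2] above let
    that lemma apply verbatim. *)
Definition airy_C : R := 24 * exp (/ 1).

Lemma airy_dom_pow (p t u : R) : 0 <= t -> Rabs u <= 1 -> Rabs p <= 1 + t + t ^ 2 ->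
  Rabs (p * exp (- (1 * t ^ 2)) * u) <= airy_C * exp (- t).
Proof.
  intros Ht Hu Hp.
  eapply Rle_trans. 2: apply (poly_gauss_le 1 t); lra.
  rewrite !Rabs_mult, (Rabs_pos_eq (exp _)) by (left; apply exp_pos).
  pose proof (exp_pos (- (1 * t ^ 2))).
  assert (0 <= t ^ 3 /\ 0 <= t ^ 4) as [? ?] by (split; now apply pow_le).
  pose proof (Rabs_pos p). pose proof (Rabs_pos u).
  assert (Rabs p * exp (- (1 * t ^ 2)) <= (1 + t + t ^ 2 + t ^ 3 + t ^ 4) * exp (- (1 * t ^ 2)))
    by (apply Rmult_le_compat_r; lra).
  assert (0 <= Rabs p * exp (- (1 * t ^ 2))) by (apply Rmult_le_pos; lra).
  nra.
Qed.

Lemma Rabs_sin_le_1 (x : R) : Rabs (sin x) <= 1.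
Proof. apply Rabs_le. pose proof (SIN_bound x). lra. Qed.

Lemma Rabs_cos_le_1 (x : R) : Rabs (cos x) <= 1.
Proof. apply Rabs_le. pose proof (COS_bound x). lra. Qed.

Lemma airy_g0_dom (x : R) : exp_dominated (airy_g0 x) airy_C.
Proof.
  split.
  - intros t. unfold airy_g0. cont1.
  - intros t Ht. unfold airy_g0. rewrite <- (Rmult_1_l (exp (- (1 * t ^ 2)))). apply airy_dom_pow; auto.
    apply Rabs_cos_le_1. rewrite Rabs_R1. nra.
Qed.

Lemma airy_g1_dom (x : R) : exp_dominated (airy_g1 x) airy_C.
Proof.
  split.
  - intros t. unfold airy_g1. cont1.
  - intros t Ht. unfold airy_g1. rewrite Rabs_Ropp. apply airy_dom_pow; auto.
    apply Rabs_sin_le_1. rewrite Rabs_pos_eq; nra.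
Qed.

Lemma airy_g2_dom (x : R) : exp_dominated (airy_g2 x) airy_C.
Proof.
  split.
  - intros t. unfold airy_g2. cont1.
  - intros t Ht. unfold airy_g2. rewrite Rabs_Ropp. apply airy_dom_pow; auto.
    apply Rabs_cos_le_1. rewrite Rabs_pos_eq; nra.
Qed.

Definition airy_K0 (x : R) : R := RInt_oo (airy_g0 x).
Definition airy_K1 (x : R) : R := RInt_oo (airy_g1 x).
Definition airy_K2 (x : R) : R := RInt_oo (airy_g2 x).

Lemma is_derive_airy_K0 (x : R) : is_derive airy_K0 x (airy_K1 x).
Proof.
  apply (is_derive_RInt_oo airy_g0 airy_g1 airy_C airy_C).
  apply airy_g0_dom. apply airy_g1_dom.
  intros h t Ht. unfold airy_g0, airy_g1.
  replace (t ^ 3 / 3 + (x + h - 1) * t) with (t ^ 3 / 3 + (x - 1) * t + h * t) by ring.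
  set (a := t ^ 3 / 3 + (x - 1) * t).
  replace (_ - _ - _) with (exp (- (1 * t ^ 2)) * (cos (a + h * t) - cos a + h * t * sin a)) by ring.
  rewrite Rabs_mult, Rabs_pos_eq by (left; apply exp_pos).
  pose proof (cos_taylor_1 a (h * t)).
  pose proof (poly_gauss_le 1 t ltac:(lra) Ht). fold airy_C in H0.
  pose proof (exp_pos (- (1 * t ^ 2))).
  assert (0 <= t ^ 3 /\ 0 <= t ^ 4) as [? ?] by (split; now apply pow_le).
  apply Rle_trans with (h ^ 2 * (t ^ 2 * exp (- (1 * t ^ 2)))).
  - replace (h ^ 2 * (t ^ 2 * exp (- (1 * t ^ 2)))) with (exp (- (1 * t ^ 2)) * (h * t) ^ 2) by ring.
    apply Rmult_le_compat_l; lra.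
  - apply Rmult_le_compat_l. apply pow2_ge_0. eapply Rle_trans. 2: exact H0.
    apply Rmult_le_compat_r; lra.
Qed.

Lemma is_derive_airy_K1 (x : R) : is_derive airy_K1 x (airy_K2 x).
Proof.
  apply (is_derive_RInt_oo airy_g1 airy_g2 airy_C airy_C).
  apply airy_g1_dom. apply airy_g2_dom.
  intros h t Ht. unfold airy_g1, airy_g2.
  replace (t ^ 3 / 3 + (x + h - 1) * t) with (t ^ 3 / 3 + (x - 1) * t + h * t) by ring.
  set (a := t ^ 3 / 3 + (x - 1) * t).
  replace (_ - _ - _) with (- (t * exp (- (1 * t ^ 2)) * (sin (a + h * t) - sin a - h * t * cos a))) by ring.
  pose proof (exp_pos (- (1 * t ^ 2))).
  rewrite Rabs_Ropp, Rabs_mult, Rabs_pos_eq by nra.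
  pose proof (sin_taylor_1 a (h * t)).
  pose proof (poly_gauss_le 1 t ltac:(lra) Ht) as H1. fold airy_C in H1.
  assert (0 <= t ^ 3 /\ 0 <= t ^ 4) as [? ?] by (split; now apply pow_le).
  apply Rle_trans with (h ^ 2 * (t ^ 3 * exp (- (1 * t ^ 2)))).
  - replace (h ^ 2 * (t ^ 3 * exp (- (1 * t ^ 2)))) with (t * exp (- (1 * t ^ 2)) * (h * t) ^ 2) by ring.
    apply Rmult_le_compat_l; nra.
  - apply Rmult_le_compat_l. apply pow2_ge_0. eapply Rle_trans. 2: exact H1.
    apply Rmult_le_compat_r; nra.
Qed.

(* The integral over [0, oo) of the derivative of e^(-t^2) sin(t^3/3 + (x-1)t) vanishes. *)
Lemma airy_K_relation (x : R) : airy_K2 x - 2 * airy_K1 x + airy_K0 x = x * airy_K0 x.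
Proof.
  pose (g := fun t => 1 * (2 * airy_g1 x t + (-1) * airy_g2 x t) + (x - 1) * airy_g0 x t).
  assert (D1 := exp_dominated_lin _ _ _ _ 2 (-1) (airy_g1_dom x) (airy_g2_dom x)).
  assert (D2 := exp_dominated_lin _ _ _ _ 1 (x - 1) D1 (airy_g0_dom x)).
  assert (E : RInt_oo g = 0).
  { assert (L0 : is_lim_seq (fun n => RInt g 0 (INR n)) 0).
    { apply is_lim_seq_ext with (fun n => exp (- (1 * INR n ^ 2)) * sin (INR n ^ 3 / 3 + (x - 1) * INR n)).
      - intros n. rewrite (RInt_FTC (fun t => exp (- (1 * t ^ 2)) * sin (t ^ 3 / 3 + (x - 1) * t)) g).
        + replace (0 ^ 3 / 3 + (x - 1) * 0) with 0 by field. rewrite sin_0. ring.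
        + intros t. unfold g, airy_g0, airy_g1, airy_g2. auto_derive; auto. field_trig.
        + intros t. apply D2.
      - apply is_lim_seq_abs_0.
        apply is_lim_seq_le_le with (fun _ => 0) (fun n => airy_C * exp (- INR n)).
        + intros n. split. apply Rabs_pos.
          rewrite <- (Rmult_1_l (exp (- (1 * INR n ^ 2)))). pose proof (pos_INR n).
          apply airy_dom_pow; auto. apply Rabs_sin_le_1. rewrite Rabs_R1. nra.
        + apply is_lim_seq_const.
        + replace 0 with (airy_C * 0) by ring.
          apply is_lim_seq_mult with airy_C 0; [apply is_lim_seq_const | | reflexivity].
          apply (is_lim_comp_seq exp _ m_infty).
          * apply is_lim_exp_m.
          * exists O. intros; discriminate.
          * apply (is_lim_seq_opp _ p_infty), is_lim_seq_INR. }
    unfold RInt_oo. now rewrite (is_lim_seq_unique _ _ L0). }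
  unfold g in E. rewrite (RInt_oo_lin _ _ _ _ _ _ D1 (airy_g0_dom x)) in E.
  rewrite (RInt_oo_lin _ _ _ _ _ _ (airy_g1_dom x) (airy_g2_dom x)) in E.
  fold (airy_K0 x) (airy_K1 x) (airy_K2 x) in E. lra.
Qed.

(** [f y t] is the real part of e^(i (w^3/3 + x w)) at w = t + i y. Its y-derivative is exact in t,
    so raising the segment from Im w = 0 to Im w = 1 costs only the vertical side at Re w = T; at Re
    w = 0 the phase vanishes and with it the boundary term. *)
Lemma airy_contour_shift (x T : R) : 1 <= T ->
  Rabs (RInt (fun t => exp (1 / 3 - x) * airy_g0 x t) 0 T - RInt (fun t => cos (t ^ 3 / 3 + x * t)) 0 T)
    <= exp (1 / 3 + Rabs x) / T ^ 2.
Proof.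
  intros HT.
  pose (f := fun y t => exp (- (y * t ^ 2) + y ^ 3 / 3 - x * y) * cos (t ^ 3 / 3 - y ^ 2 * t + x * t)).
  pose (df := fun y t => exp (- (y * t ^ 2) + y ^ 3 / 3 - x * y) *
     ((- t ^ 2 + y ^ 2 - x) * cos (t ^ 3 / 3 - y ^ 2 * t + x * t) + 2 * y * t * sin (t ^ 3 / 3 - y ^ 2 * t + x * t))).
  pose (m := fun y => - exp (- (y * T ^ 2) + y ^ 3 / 3 - x * y) * sin (T ^ 3 / 3 - y ^ 2 * T + x * T)).
  assert (HM : forall y, is_derive (fun y => RInt (f y) 0 T) y (m y)).
  { intros y.
    assert (E : RInt (df y) 0 T = m y :> R).
    { rewrite (RInt_FTC (fun t => - exp (- (y * t ^ 2) + y ^ 3 / 3 - x * y) * sin (t ^ 3 / 3 - y ^ 2 * t + x * t))).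
      - unfold m. replace (0 ^ 3 / 3 - y ^ 2 * 0 + x * 0) with 0 by field. rewrite sin_0. ring.
      - intros t. unfold df. auto_derive; auto. field_trig.
      - intros t. unfold df. cont1. }
    rewrite <- E. apply is_derive_RInt_param_cont.
    - intros u t. unfold f, df. auto_derive; auto. field_trig.
    - intros u t. unfold df. cbv beta. cont2.
    - intros u t. unfold f. cont1. }
  rewrite (RInt_ext (fun t => exp (1 / 3 - x) * airy_g0 x t) (f 1)).
  2:{ intros t _. unfold f, airy_g0. rewrite <- Rmult_assoc, <- exp_plus. f_equal; f_equal; field. }
  rewrite (RInt_ext (fun t => cos (t ^ 3 / 3 + x * t)) (f 0)).
  2:{ intros t _. unfold f. replace (_ + 0 ^ 3 / 3 - _) with 0 by field. rewrite exp_0, Rmult_1_l. f_equal; field. }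
  set (E := exp (1 / 3 + Rabs x)).
  assert (HT2 : 0 < T ^ 2) by (apply pow_lt; lra).
  (* The side at T decays like e^(-y T^2), which integrates over y to at most 1 / T^2. The
     integration is done below by monotonicity, subtracting and then adding a primitive of this
     bound. *)
  assert (Hm : forall y, 0 <= y <= 1 -> Rabs (m y) <= E * exp (- (y * T ^ 2))).
  { intros y Hy. unfold m. rewrite Rabs_mult, Rabs_Ropp, Rabs_pos_eq by (left; apply exp_pos).
    rewrite <- (Rmult_1_r (E * _)). apply Rmult_le_compat; try apply Rabs_pos; try apply Rabs_sin_le_1.
    left; apply exp_pos. unfold E. rewrite <- exp_plus. apply exp_le.
    assert (y ^ 3 <= 1) by (rewrite <- (pow1 3); apply pow_incr; lra).
    assert (- (x * y) <= Rabs x).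
    { pose proof (Rle_abs (- x)). pose proof (Rabs_pos x). rewrite Rabs_Ropp in H0. nra. }
    lra. }
  assert (HG : forall c y, is_derive (fun y => c * - (E * exp (- (y * T ^ 2)) / T ^ 2)) y (c * (E * exp (- (y * T ^ 2))))).
  { intros c y. auto_derive; auto. field_trig. }
  assert (Hup : RInt (f 1) 0 T - 1 * - (E * exp (- (1 * T ^ 2)) / T ^ 2) <= RInt (f 0) 0 T - 1 * - (E * exp (- (0 * T ^ 2)) / T ^ 2)).
  { apply Ropp_le_cancel.
    apply (le_of_derive_nonneg (fun y => - (RInt (f y) 0 T - 1 * - (E * exp (- (y * T ^ 2)) / T ^ 2)))
      (fun y => - (m y - 1 * (E * exp (- (y * T ^ 2)))))). lra.
    - intros y _. apply is_derive_Ropp.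
      apply is_derive_Rminus; auto.
    - intros y Hy. specialize (Hm y Hy). pose proof (Rle_abs (m y)). lra. }
  assert (Hdn : RInt (f 0) 0 T + 1 * - (E * exp (- (0 * T ^ 2)) / T ^ 2) <= RInt (f 1) 0 T + 1 * - (E * exp (- (1 * T ^ 2)) / T ^ 2)).
  { apply (le_of_derive_nonneg (fun y => (RInt (f y) 0 T + 1 * - (E * exp (- (y * T ^ 2)) / T ^ 2)))
      (fun y => (m y + 1 * (E * exp (- (y * T ^ 2)))))). lra.
    - intros y _.
      apply is_derive_Rplus; auto.
    - intros y Hy. specialize (Hm y Hy). pose proof (Rle_abs (- m y)). rewrite Rabs_Ropp in H. lra. }
  replace (exp (- (0 * T ^ 2))) with 1 in * by (rewrite Rmult_0_l, Ropp_0, exp_0; auto).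
  assert (0 <= E * exp (- (1 * T ^ 2)) / T ^ 2).
  { apply Rmult_le_pos. apply Rmult_le_pos; left; apply exp_pos. left; now apply Rinv_0_lt_compat. }
  apply Rabs_le. lra.
Qed.

(** [Lim] at [p_infty] is evaluated along [INR n], so it is enough to compare with the shifted
    integral at integer endpoints. *)
Lemma Ai_eq_shifted (x : R) : Ai x = exp (1 / 3 - x) / PI * airy_K0 x.
Proof.
  unfold Ai, Lim, Rbar_loc_seq.
  rewrite (is_lim_seq_unique _ (exp (1 / 3 - x) * airy_K0 x)).
  { simpl. unfold Rdiv. ring. }
  apply is_lim_seq_ext with (fun n => RInt (fun t => exp (1 / 3 - x) * airy_g0 x t) 0 (INR n) -
    (RInt (fun t => exp (1 / 3 - x) * airy_g0 x t) 0 (INR n) - RInt (fun t => cos (t ^ 3 / 3 + x * t)) 0 (INR n))).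
  { intros n. ring. }
  replace (exp (1 / 3 - x) * airy_K0 x) with (exp (1 / 3 - x) * airy_K0 x - 0) by ring.
  apply is_lim_seq_minus'.
  - apply is_lim_seq_ext with (fun n => exp (1 / 3 - x) * RInt (airy_g0 x) 0 (INR n)).
    + intros n. symmetry. apply (RInt_scal (V := R_CompleteNormedModule)).
      apply ex_RInt_cont. apply airy_g0_dom.
    + apply (is_lim_seq_scal_l _ _ (Finite _)). eapply RInt_oo_lim, airy_g0_dom.
  - apply is_lim_seq_abs_0.
    apply is_lim_seq_le_le_loc with (fun _ => 0) (fun n => exp (1 / 3 + Rabs x) / INR n ^ 2).
    + exists 1%nat. intros n Hn. split. apply Rabs_pos. apply airy_contour_shift.
      apply (le_INR 1). auto.
    + apply is_lim_seq_const.
    + replace 0 with (exp (1 / 3 + Rabs x) * 0) by ring.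
      apply (is_lim_seq_scal_l _ _ (Finite 0)).
      apply (is_lim_seq_inv _ p_infty); [| discriminate].
      apply is_lim_seq_ext with (fun n => INR n * INR n). intros; ring.
      apply (is_lim_seq_mult _ _ p_infty p_infty p_infty); try apply is_lim_seq_INR. reflexivity.
Qed.

Definition dAi (x : R) : R := exp (1 / 3 - x) / PI * (airy_K1 x - airy_K0 x).

Lemma is_derive_Ai (x : R) : is_derive Ai x (dAi x).
Proof.
  apply is_derive_ext with (fun x => exp (1 / 3 - x) / PI * airy_K0 x).
  { intros t. symmetry. apply Ai_eq_shifted. }
  unfold dAi. pose proof PI_RGT_0.
  auto_derive.
  - exists (airy_K1 x). apply is_derive_airy_K0.
  - change (Derive (fun x0 : R => airy_K0 x0) x) with (Derive airy_K0 x).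
    rewrite (is_derive_unique _ _ _ (is_derive_airy_K0 x)). field_trig.
Qed.

Lemma is_derive_dAi (x : R) : is_derive dAi x (x * Ai x).
Proof.
  unfold dAi. pose proof PI_RGT_0. rewrite Ai_eq_shifted.
  auto_derive.
  - split; [exists (airy_K2 x); apply is_derive_airy_K1 | split; auto; exists (airy_K1 x); apply is_derive_airy_K0].
  - change (Derive (fun x0 : R => airy_K0 x0) x) with (Derive airy_K0 x).
    change (Derive (fun x0 : R => airy_K1 x0) x) with (Derive airy_K1 x).
    rewrite (is_derive_unique _ _ _ (is_derive_airy_K0 x)), (is_derive_unique _ _ _ (is_derive_airy_K1 x)).
    pose proof (airy_K_relation x).
    replace (x * (exp (1 / 3 - x) / PI * airy_K0 x)) with (exp (1 / 3 - x) / PI * (x * airy_K0 x)) by ring.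
    rewrite <- H0. field_trig.
Qed.

(** The prefactor e^(1/3 - x) carries the decay, and the integrals [airy_K0], [airy_K1] are bounded
    uniformly in x. The rate only has to be integrable against s^2 in the Wronskian estimate. *)
Lemma Ai_decay : exists C, 0 < C /\ forall x, Rabs (Ai x) <= C * exp (- x) /\ Rabs (dAi x) <= C * exp (- x).
Proof.
  pose proof PI_RGT_0. assert (HC : 0 < airy_C) by (unfold airy_C; pose proof (exp_pos (/ 1)); lra).
  assert (He : forall x, exp (1 / 3 - x) = exp (1 / 3) * exp (- x)) by (intros; rewrite <- exp_plus; auto).
  pose proof (exp_pos (1 / 3)). pose proof (Rinv_0_lt_compat _ H).
  exists (exp (1 / 3) / PI * (2 * airy_C)). split.
  { apply Rmult_lt_0_compat; [apply Rmult_lt_0_compat |]; lra. }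
  intros x. rewrite Ai_eq_shifted. unfold dAi.
  pose proof (RInt_oo_bound _ _ (airy_g0_dom x)). pose proof (RInt_oo_bound _ _ (airy_g1_dom x)).
  fold (airy_K0 x) in H2. fold (airy_K1 x) in H3. rewrite He.
  assert (P : 0 <= exp (1 / 3) * exp (- x) / PI).
  { repeat apply Rmult_le_pos; try lra; left; apply exp_pos. }
  assert (Hg : forall u, Rabs u <= 2 * airy_C -> Rabs (exp (1 / 3) * exp (- x) / PI * u) <= exp (1 / 3) / PI * (2 * airy_C) * exp (- x)).
  { intros u Hu. rewrite Rabs_mult, (Rabs_pos_eq _ P).
    replace (exp (1 / 3) / PI * (2 * airy_C) * exp (- x)) with (exp (1 / 3) * exp (- x) / PI * (2 * airy_C)) by (unfold Rdiv; ring).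
    now apply Rmult_le_compat_l. }
  split; apply Hg.
  - lra.
  - eapply Rle_trans. apply Rabs_triang. rewrite Rabs_Ropp. lra.
Qed.

(** * Linear equations near a simple turning point *)

Definition vanishes_oo (f : R -> R) : Prop :=
  forall eps, 0 < eps -> exists A, forall s, A <= s -> Rabs (f s) <= eps.

Lemma exp_neg_vanishes (C : R) : vanishes_oo (fun s => C * exp (- s)).
Proof.
  intros eps Heps. exists (Rabs C / eps). intros s Hs.
  rewrite Rabs_mult, (Rabs_pos_eq (exp _)) by (left; apply exp_pos).
  assert (H0 : 0 <= Rabs C / eps) by (apply Rmult_le_pos; [apply Rabs_pos | left; now apply Rinv_0_lt_compat]).
  pose proof (exp_ge_1_plus s).
  rewrite exp_Ropp. apply Rmult_le_reg_r with (exp s). apply exp_pos.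
  rewrite Rmult_assoc, Rinv_l, Rmult_1_r by apply Rgt_not_eq, exp_pos.
  apply Rle_trans with (eps * s).
  - apply Rmult_le_compat_l with (r := eps) in Hs; [| lra].
    replace (eps * (Rabs C / eps)) with (Rabs C) in Hs by (field; lra). lra.
  - apply Rmult_le_compat_l; lra.
Qed.

(* f^2 is convex, so if it tends to 0 without being eventually 0, it is positive and decreasing. *)
Lemma recessive_solution (q f f1 : R -> R) :
  (forall s, 0 <= s -> is_derive f s (f1 s)) ->
  (forall s, 0 <= s -> is_derive f1 s (q s * f s)) ->
  (forall s, 0 <= s -> 0 <= q s) ->
  vanishes_oo f -> (forall A, exists s, A < s /\ f s <> 0) ->
  forall s, 0 <= s -> f s <> 0 /\ f s ^ 2 <= f 0 ^ 2 /\ f1 s ^ 2 <= f1 0 ^ 2.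
Proof.
  intros Hf Hf1 Hq Hv Hnz.
  assert (Hd1 : forall s, 0 <= s -> is_derive (fun s => f s ^ 2) s (2 * f s * f1 s)).
  { intros s Hs. replace (2 * f s * f1 s) with (INR 2 * f1 s * f s ^ pred 2) by (simpl; ring).
    apply is_derive_pow; auto. }
  assert (Hd2 : forall s, 0 <= s -> is_derive (fun s => f s * f1 s) s (f1 s * f1 s + f s * (q s * f s))).
  { intros s Hs. apply (is_derive_Rmult f f1); auto. }
  (* [f * f1] is nondecreasing. A positive value at one point would make f^2 grow at least linearly
     from there, against the decay of f. *)
  assert (Hneg : forall s, 0 <= s -> f s * f1 s <= 0).
  { intros a Ha. destruct (Rle_dec (f a * f1 a) 0) as [H | H]; auto. exfalso. apply Rnot_le_lt in H.
    set (c := f a * f1 a) in *.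
    assert (Hc : forall s, a <= s -> c <= f s * f1 s).
    { intros s Hs. unfold c.
      apply (le_of_derive_nonneg (fun s => f s * f1 s) (fun s => f1 s * f1 s + f s * (q s * f s))); auto.
      - intros x Hx. apply Hd2; lra.
      - intros x Hx. specialize (Hq x ltac:(lra)). pose proof (Rle_0_sqr (f1 x)). pose proof (Rle_0_sqr (f x)).
        unfold Rsqr in *. nra. }
    assert (Hg : forall s, a <= s -> 2 * c * (s - a) <= f s ^ 2).
    { intros s Hs.
      apply (le_of_derive_le (fun s => 2 * c * (s - a)) (fun _ => 2 * c) (fun s => f s ^ 2) (fun s => 2 * f s * f1 s) a s Hs).
      - intros x _. auto_derive; auto; ring.
      - intros x Hx. apply Hd1; lra.
      - intros x Hx. specialize (Hc x ltac:(lra)). lra.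
      - rewrite Rminus_diag, Rmult_0_r. apply pow2_ge_0. }
    destruct (Hv 1 ltac:(lra)) as [A HA].
    set (s := Rmax A (a + / c)).
    assert (a + / c <= s) by apply Rmax_r. assert (A <= s) by apply Rmax_l.
    assert (0 < / c) by now apply Rinv_0_lt_compat.
    specialize (HA s ltac:(lra)). specialize (Hg s ltac:(lra)).
    assert (c * / c = 1) by (field; lra).
    assert (f s ^ 2 <= 1) by (rewrite <- pow2_abs; pose proof (Rabs_pos (f s)); nra).
    nra. }
  assert (Hdec : forall a s, 0 <= a <= s -> f s ^ 2 <= f a ^ 2).
  { intros a s Has.
    apply Ropp_le_cancel.
    apply (le_of_derive_nonneg (fun s => - f s ^ 2) (fun s => - (2 * f s * f1 s))); [lra | |].
    - intros x Hx. apply (is_derive_Ropp (fun s => f s ^ 2)). apply Hd1; lra.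
    - intros x Hx. specialize (Hneg x ltac:(lra)). lra. }
  intros s Hs. repeat split.
  - intros H0. destruct (Hnz s) as [t [Ht Hft]]. apply Hft.
    specialize (Hdec s t ltac:(lra)). rewrite H0 in Hdec. pose proof (pow2_ge_0 (f t)). nra.
  - apply Hdec; lra.
  - apply Ropp_le_cancel.
    apply (le_of_derive_nonneg (fun s => - f1 s ^ 2) (fun s => - (2 * f1 s * (q s * f s)))); [lra | |].
    + intros x Hx. apply (is_derive_Ropp (fun s => f1 s ^ 2)).
      replace (2 * f1 x * (q x * f x)) with (INR 2 * (q x * f x) * f1 x ^ pred 2) by (simpl; ring).
      apply is_derive_pow, Hf1; lra.
    + intros x Hx. specialize (Hneg x ltac:(lra)). specialize (Hq x ltac:(lra)). nra.
Qed.

Lemma Ai_vanishes (f : R -> R) (C a : R) : (forall x, Rabs (f x) <= C * exp (- x)) -> vanishes_oo (fun s => f (a + s)).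
Proof.
  intros H eps Heps. destruct (exp_neg_vanishes (C * exp (- a)) eps Heps) as [A HA].
  exists A. intros s Hs. eapply Rle_trans. apply H. eapply Rle_trans. 2: apply (HA s Hs).
  eapply Rle_trans. 2: apply Rle_abs. rewrite Ropp_plus_distr, exp_plus. lra.
Qed.

Lemma is_derive_shift (f : R -> R) (a s l : R) : is_derive f (a + s) l -> is_derive (fun s => f (a + s)) s l.
Proof.
  intros H. replace l with (1 * l) by ring.
  apply (is_derive_Rcomp f (fun s => a + s)); auto.
  auto_derive; auto; ring.
Qed.

(** If i1 >= 0, the translate s -> Ai (i1 + s) would be recessive with potential i1 + s >= 0 on [0,
    oo), and such a solution cannot vanish at 0. *)
Lemma Ai_zero_neg (i1 : R) : Ai i1 = 0 -> (forall x, i1 < x -> Ai x <> 0) -> i1 < 0.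
Proof.
  intros Hz Hnz. destruct (Rlt_dec i1 0) as [H | H]; auto. exfalso. apply Rnot_lt_le in H.
  destruct Ai_decay as [C [HC Hdec]].
  destruct (recessive_solution (fun s => i1 + s) (fun s => Ai (i1 + s)) (fun s => dAi (i1 + s))) with 0 as [H0 _].
  - intros s _. apply is_derive_shift, is_derive_Ai.
  - intros s _. apply (is_derive_shift dAi), is_derive_dAi.
  - intros s Hs. lra.
  - apply (Ai_vanishes Ai C). apply Hdec.
  - intros A. exists (Rmax A 0 + 1). split. pose proof (Rmax_l A 0); lra. apply Hnz. pose proof (Rmax_r A 0); lra.
  - lra.
  - apply H0. now rewrite Rplus_0_r.
Qed.

(** The weighted energy (e^2 + d^2 + G^2) e^((L + 2) s) is nondecreasing, so data at b control
    everything to the left; the summand G^2 absorbs the inhomogeneity. *)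
Lemma gronwall_backward (e d q g : R -> R) (L G a b : R) : 0 <= L ->
  (forall s, a <= s <= b -> is_derive e s (d s)) ->
  (forall s, a <= s <= b -> is_derive d s (q s * e s + g s)) ->
  (forall s, a <= s <= b -> Rabs (q s) <= L) ->
  (forall s, a <= s <= b -> Rabs (g s) <= G) ->
  forall s, a <= s <= b ->
    e s ^ 2 + d s ^ 2 <= (e b ^ 2 + d b ^ 2 + G ^ 2) * exp ((L + 2) * (b - s)).
Proof.
  intros HL He Hd Hq Hg s Hs.
  set (phi := fun s => (e s ^ 2 + d s ^ 2 + G ^ 2) * exp ((L + 2) * s)).
  set (dphi := fun s => (2 * e s * d s + 2 * d s * (q s * e s + g s)) * exp ((L + 2) * s)
     + (e s ^ 2 + d s ^ 2 + G ^ 2) * ((L + 2) * exp ((L + 2) * s))).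
  assert (H : phi s <= phi b).
  { apply (le_of_derive_nonneg phi dphi); [lra | |].
    - intros x Hx. unfold phi, dphi.
      assert (De : ex_derive e x) by (eexists; apply He; lra).
      assert (Dd : ex_derive d x) by (eexists; apply Hd; lra).
      auto_derive. { tauto. }
      change (Derive (fun x0 : R => e x0) x) with (Derive e x).
      change (Derive (fun x0 : R => d x0) x) with (Derive d x).
      rewrite (is_derive_unique e x _ (He x ltac:(lra))), (is_derive_unique d x _ (Hd x ltac:(lra))).
      ring.
    - intros x Hx. unfold dphi.
      specialize (Hq x ltac:(lra)). specialize (Hg x ltac:(lra)).
      apply Rabs_le_between in Hq. apply Rabs_le_between in Hg.
      replace (_ + _) with ((2 * e x * d x + 2 * d x * (q x * e x + g x) + (L + 2) * (e x ^ 2 + d x ^ 2 + G ^ 2)) * exp ((L + 2) * x)) by ring.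
      apply Rmult_le_pos. 2: left; apply exp_pos.
      set (u := e x) in *. set (v := d x) in *. set (p := q x) in *. set (w := g x) in *.
      pose proof (pow2_ge_0 (u + v)). pose proof (pow2_ge_0 (u - v)).
      (* This and the next line add up to 2 p u v >= - L (u^2 + v^2). *)
      assert (0 <= (L + p) * (u + v) ^ 2) by (apply Rmult_le_pos; lra).
      assert (0 <= (L - p) * (u - v) ^ 2) by (apply Rmult_le_pos; lra).
      pose proof (pow2_ge_0 (v + w)). assert (w ^ 2 <= G ^ 2) by nra.
      pose proof (pow2_ge_0 G). assert (0 <= L * G ^ 2) by (apply Rmult_le_pos; lra).
      pose proof (pow2_ge_0 u). nra. }
  unfold phi in H.
  apply Rmult_le_reg_r with (exp ((L + 2) * s)). apply exp_pos.
  rewrite Rmult_assoc, <- exp_plus. replace ((L + 2) * (b - s) + (L + 2) * s) with ((L + 2) * b) by ring.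
  pose proof (exp_pos ((L + 2) * s)). pose proof (pow2_ge_0 G). nra.
Qed.

(** Uniqueness for the initial value problem: zero data at i1 would force Ai (i1 + 1) = 0. The
    reflection x -> -x makes the backward estimate act to the right of i1. *)
Lemma dAi_zero_neq (i1 : R) : Ai i1 = 0 -> (forall x, i1 < x -> Ai x <> 0) -> dAi i1 <> 0.
Proof.
  intros Hz Hnz H0.
  assert (Hc : forall f df, (forall x, is_derive f x (df x)) -> forall x, is_derive (fun x => f (- x)) x (- df (- x))).
  { intros f df Hf x. replace (- df (- x)) with (-1 * df (- x)) by ring.
    apply (is_derive_Rcomp f (fun s => - s)); auto.
    auto_derive; auto; ring. }
  pose proof (gronwall_backward (fun x => Ai (- x)) (fun x => - dAi (- x)) (fun x => - x) (fun _ => 0)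
     (Rabs i1 + 1) 0 (- i1 - 1) (- i1)) as G.
  pose proof (Rabs_pos i1).
  specialize (G ltac:(lra)).
  assert (E : Ai (- (- i1 - 1)) ^ 2 + (- dAi (- (- i1 - 1))) ^ 2 <= 0).
  { eapply Rle_trans. apply G; try lra.
    - intros s _. apply (Hc Ai dAi). apply is_derive_Ai.
    - intros s _. replace (- s * Ai (- s) + 0) with (- - (- s * Ai (- s))) by ring.
      apply is_derive_Ropp.
      apply (Hc dAi (fun x => x * Ai x)). apply is_derive_dAi.
    - intros s Hs. rewrite Rabs_Ropp. pose proof (Rle_abs i1). pose proof (Rle_abs (- i1)). rewrite Rabs_Ropp in H2.
      apply Rabs_le. lra.
    - intros s _. rewrite Rabs_R0. lra.
    - rewrite Ropp_involutive, Hz, H0. right; ring. }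
  apply (Hnz (- (- i1 - 1))). lra.
  pose proof (pow2_ge_0 (Ai (- (- i1 - 1)))). pose proof (pow2_ge_0 (- dAi (- (- i1 - 1)))). nra.
Qed.

(** The Wronskian W has W' = (s - q) f Ai and tends to 0 at infinity. Since |f| <= |f 0|, its value
    at 0 is at most eps |f 0| times the integral of C s^2 e^(-s), which is 2 C. *)
Lemma wronskian_bound : exists C, 0 < C /\ forall eps q f f1, 0 <= eps ->
  (forall s, 0 <= s -> is_derive f s (f1 s)) ->
  (forall s, 0 <= s -> is_derive f1 s (q s * f s)) ->
  (forall s, 0 <= s -> 0 <= q s) ->
  (forall s, 0 <= s -> Rabs (q s - s) <= eps * s ^ 2) ->
  vanishes_oo f -> (forall A, exists s, A < s /\ f s <> 0) ->
  Rabs (f 0 * dAi 0 - f1 0 * Ai 0) <= C * eps * Rabs (f 0).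
Proof.
  destruct Ai_decay as [C [HC Hdec]]. exists (2 * C). split; [lra |].
  intros eps q f f1 Heps Hf Hf1 Hq Hqe Hv Hnz.
  pose proof (recessive_solution q f f1 Hf Hf1 Hq Hv Hnz) as Hrec.
  assert (Hf0 : forall s, 0 <= s -> Rabs (f s) <= Rabs (f 0)).
  { intros s Hs. apply Rsqr_le_abs_0. rewrite !Rsqr_pow2. now apply Hrec. }
  assert (Hf10 : forall s, 0 <= s -> Rabs (f1 s) <= Rabs (f1 0)).
  { intros s Hs. apply Rsqr_le_abs_0. rewrite !Rsqr_pow2. now apply Hrec. }
  set (W := fun s => f s * dAi s - f1 s * Ai s).
  set (M := eps * Rabs (f 0) * C).
  assert (HM : 0 <= M) by (unfold M; repeat apply Rmult_le_pos; try lra; apply Rabs_pos).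
  (* A primitive of - M s^2 e^(-s) with G 0 = 2 M. *)
  set (G := fun s => M * ((s ^ 2 + 2 * s + 2) * exp (- s))).
  assert (HG : forall s, is_derive G s (- (M * (s ^ 2 * exp (- s))))).
  { intros s. unfold G. auto_derive; auto. field_trig. }
  assert (HW : forall s, 0 <= s -> is_derive W s ((s - q s) * f s * Ai s)).
  { intros s Hs. unfold W.
    replace ((s - q s) * f s * Ai s) with ((f1 s * dAi s + f s * (s * Ai s)) - (q s * f s * Ai s + f1 s * dAi s)) by ring.
    apply is_derive_Rminus.
    - apply (is_derive_Rmult f dAi); auto. apply is_derive_dAi.
    - apply (is_derive_Rmult f1 Ai); auto. apply is_derive_Ai. }
  assert (HWb : forall s, 0 <= s -> Rabs ((s - q s) * f s * Ai s) <= M * (s ^ 2 * exp (- s))).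
  { intros s Hs. rewrite !Rabs_mult. unfold M.
    replace (eps * Rabs (f 0) * C * (s ^ 2 * exp (- s))) with ((eps * s ^ 2) * Rabs (f 0) * (C * exp (- s))) by ring.
    apply Rmult_le_compat; [apply Rmult_le_pos; apply Rabs_pos | apply Rabs_pos | | apply Hdec].
    apply Rmult_le_compat; [apply Rabs_pos | apply Rabs_pos | | now apply Hf0].
    rewrite Rabs_minus_sym. now apply Hqe. }
  assert (HWG : forall s, 0 <= s -> Rabs (W 0) <= Rabs (W s) + 2 * M).
  { intros s Hs.
    assert (HGs : 0 <= G s) by (unfold G; apply Rmult_le_pos; [exact HM | apply Rmult_le_pos; [nra | left; apply exp_pos]]).
    assert (HG0 : G 0 = 2 * M) by (unfold G; rewrite Ropp_0, exp_0; ring).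
    assert (A1 : - (W 0 + G 0) <= - (W s + G s)).
    { apply (le_of_derive_nonneg (fun s => - (W s + G s)) (fun s => - ((s - q s) * f s * Ai s + - (M * (s ^ 2 * exp (- s)))))); auto.
      - intros x Hx. apply is_derive_Ropp.
        apply is_derive_Rplus; auto. apply HW; lra.
      - intros x Hx. specialize (HWb x ltac:(lra)). apply Rabs_le_between in HWb. lra. }
    assert (A2 : W 0 - G 0 <= W s - G s).
    { apply (le_of_derive_nonneg (fun s => W s - G s) (fun s => (s - q s) * f s * Ai s - - (M * (s ^ 2 * exp (- s))))); auto.
      - intros x Hx. 
        apply is_derive_Rminus; auto. apply HW; lra.
      - intros x Hx. specialize (HWb x ltac:(lra)). apply Rabs_le_between in HWb. lra. }
    pose proof (Rle_abs (W s)). pose proof (Rle_abs (- W s)). rewrite Rabs_Ropp in H0.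
    apply Rabs_le. lra. }
  replace (2 * C * eps * Rabs (f 0)) with (2 * M) by (unfold M; ring).
  fold (W 0). apply Rle_plus_epsilon. intros e He.
  destruct (exp_neg_vanishes ((Rabs (f 0) + Rabs (f1 0)) * C) e He) as [A HA].
  set (s := Rmax A 0). pose proof (Rmax_r A 0). fold s in H. specialize (HA s (Rmax_l A 0)).
  specialize (HWG s H).
  assert (Rabs (W s) <= (Rabs (f 0) + Rabs (f1 0)) * C * exp (- s)).
  { unfold W. replace (f s * dAi s - f1 s * Ai s) with (f s * dAi s + - f1 s * Ai s) by ring.
    eapply Rle_trans. apply Rabs_triang. rewrite !Rabs_mult, Rabs_Ropp.
    rewrite Rmult_assoc, Rmult_plus_distr_r.
    apply Rplus_le_compat; apply Rmult_le_compat; try apply Rabs_pos; auto; apply Hdec. }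
  pose proof (Rle_abs ((Rabs (f 0) + Rabs (f1 0)) * C * exp (- s))). lra.
Qed.

Lemma last_zero (g : R -> R) (a b : R) : a < b -> (forall x, a <= x <= b -> continuous g x) ->
  g a <= 0 -> 0 < g b -> exists z, a <= z < b /\ g z = 0 /\ forall x, z < x <= b -> 0 < g x.
Proof.
  intros Hab Hc Ha Hb.
  destruct (completeness (fun x => a <= x <= b /\ g x <= 0)) as [z [Hub Hlub]].
  { exists b. intros x [Hx _]. lra. }
  { exists a. split; lra. }
  assert (Haz : a <= z) by (apply Hub; split; lra).
  assert (Hzb : z <= b) by (apply Hlub; intros x [Hx _]; lra).
  assert (Hpos : forall x, z < x <= b -> 0 < g x).
  { intros x Hx. destruct (Rlt_dec 0 (g x)); auto. exfalso.
    assert (x <= z) by (apply Hub; split; lra). lra. }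
  assert (Hloc : forall e, 0 < e -> exists d, 0 < d /\ forall x, Rabs (x - z) < d -> Rabs (g x - g z) < e).
  { intros e He. specialize (Hc z ltac:(lra)).
    apply continuity_pt_filterlim in Hc.
    destruct (proj1 (continuity_pt_locally g z) Hc (mkposreal e He)) as [d Hd].
    exists d. split. apply cond_pos. intros x Hx. apply Hd. exact Hx. }
  assert (Hz : g z = 0).
  { destruct (Rtotal_order (g z) 0) as [H | [H | H]]; auto; exfalso.
    - assert (z < b). { destruct Hzb as [|E]; auto. rewrite E in H. lra. }
      destruct (Hloc (- g z) ltac:(lra)) as [d [Hd Hg]].
      set (x := z + Rmin (d / 2) (b - z)).
      assert (0 < Rmin (d / 2) (b - z)) by (apply Rmin_glb_lt; lra).
      pose proof (Rmin_l (d / 2) (b - z)). pose proof (Rmin_r (d / 2) (b - z)).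
      specialize (Hg x). unfold x in Hg. replace (z + Rmin (d / 2) (b - z) - z) with (Rmin (d / 2) (b - z)) in Hg by ring.
      rewrite Rabs_pos_eq in Hg by lra. specialize (Hg ltac:(lra)). apply Rabs_def2 in Hg.
      specialize (Hpos (z + Rmin (d / 2) (b - z)) ltac:(lra)). lra.
    - destruct (Hloc (g z) H) as [d [Hd Hg]].
      assert (z <= z - d / 2); [| lra].
      apply Hlub. intros x [Hx Hgx]. assert (x <= z) by (apply Hub; split; lra).
      destruct (Rle_dec x (z - d / 2)); auto. exfalso.
      specialize (Hg x). rewrite Rabs_left1 in Hg by lra. specialize (Hg ltac:(lra)). apply Rabs_def2 in Hg. lra. }
  exists z. repeat split; auto.
  - destruct Hzb as [|E]; auto. rewrite E in Hz. lra.
Qed.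

(** [C] and [e0] depend on [i1] alone, so they serve a whole family of equations. The zero is
    trapped by simplicity: near i1, |Ai| is at least |Ai'(i1)| |s - i1| / 2, which beats a
    perturbation C1 eps once |s - i1| > C2 eps. *)
Theorem turning_point (i1 : R) : Ai i1 = 0 -> (forall x, i1 < x -> Ai x <> 0) ->
  exists C e0, 0 < C /\ 0 < e0 /\ forall eps q f f1, 0 < eps <= e0 ->
    (forall s, i1 - 1 <= s -> is_derive f s (f1 s)) ->
    (forall s, i1 - 1 <= s -> is_derive f1 s (q s * f s)) ->
    (forall s, i1 - 1 <= s -> Rabs (q s - s) <= eps * s ^ 2) ->
    (forall s, 0 <= s -> 0 <= q s) ->
    vanishes_oo f -> (forall A, exists s, A < s /\ f s <> 0) ->
    f 0 <> 0 /\ exists s0, i1 - 1 < s0 /\ f s0 = 0 /\ (forall s, s0 < s -> f s <> 0) /\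
      Rabs (s0 - i1) <= C * eps /\ Rabs (f1 s0 / f 0 - dAi i1 / Ai 0) <= C * eps.
Proof.
  intros Hz Hnz.
  pose proof (Ai_zero_neg i1 Hz Hnz) as Hi1.
  pose proof (dAi_zero_neq i1 Hz Hnz) as HD.
  pose proof (Hnz 0 Hi1) as HA0.
  destruct Ai_decay as [CA [HCA Hdec]].
  destruct wronskian_bound as [CW [HCW HW]].
  set (S := 1 - i1). assert (HS : 1 < S) by (unfold S; lra).
  set (L := S + S ^ 2).
  set (D := dAi i1) in *.
  assert (HDp : 0 < Rabs D) by now apply Rabs_pos_lt.
  assert (HAp : 0 < Rabs (Ai 0)) by now apply Rabs_pos_lt.
  set (B := S ^ 2 * CA * exp S).
  set (C1 := sqrt ((CW ^ 2 + B ^ 2) * exp ((L + 2) * S)) + 1).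
  assert (HC1 : 1 <= C1) by (unfold C1; pose proof (sqrt_pos ((CW ^ 2 + B ^ 2) * exp ((L + 2) * S))); lra).
  assert (HC1sq : (CW ^ 2 + B ^ 2) * exp ((L + 2) * S) <= C1 ^ 2).
  { assert (P : 0 <= (CW ^ 2 + B ^ 2) * exp ((L + 2) * S)).
    { apply Rmult_le_pos. pose proof (pow2_ge_0 CW). pose proof (pow2_ge_0 B). lra. left; apply exp_pos. }
    rewrite <- (pow2_sqrt _ P) at 1. unfold C1. pose proof (sqrt_pos ((CW ^ 2 + B ^ 2) * exp ((L + 2) * S))). nra. }
  (* Multiplication by D = Ai'(i1) treats both signs of D at once: near i1 the function D Ai has
     slope at least D^2 / 2. *)
  assert (Hloc : exists d0, 0 < d0 <= 1 /\ d0 < - i1 /\ forall s, Rabs (s - i1) <= d0 -> D ^ 2 / 2 <= dAi s * D).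
  { assert (Hc : continuity_pt dAi i1) by (apply continuity_pt_filterlim, (is_derive_cont _ _ _ (is_derive_dAi i1))).
    destruct (proj1 (continuity_pt_locally dAi i1) Hc (mkposreal (Rabs D / 2) ltac:(lra))) as [d Hd]. simpl in Hd.
    pose proof (cond_pos d).
    exists (Rmin (d / 2) (Rmin 1 (- i1 / 2))).
    pose proof (Rmin_l (d / 2) (Rmin 1 (- i1 / 2))). pose proof (Rmin_r (d / 2) (Rmin 1 (- i1 / 2))).
    pose proof (Rmin_l 1 (- i1 / 2)). pose proof (Rmin_r 1 (- i1 / 2)).
    repeat split; try lra. { apply Rmin_glb_lt; [lra | apply Rmin_glb_lt; lra]. }
    intros s Hs.
    assert (Hsd : Rabs (s - i1) < d) by lra.
    specialize (Hd s Hsd).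
    fold D in Hd.
    assert (Rabs ((dAi s - D) * D) <= D ^ 2 / 2).
    { rewrite Rabs_mult, <- (pow2_abs D). nra. }
    apply Rabs_le_between in H4. nra. }
  destruct Hloc as [d0 [Hd0 [Hd0i Hloc]]].
  assert (Hlow : forall s, i1 <= s <= i1 + d0 -> D ^ 2 / 2 * (s - i1) <= Ai s * D).
  { intros s Hs.
    apply (le_of_derive_le (fun s => D ^ 2 / 2 * (s - i1)) (fun _ => D ^ 2 / 2) (fun s => Ai s * D) (fun s => dAi s * D) i1 s ltac:(lra)).
    - intros x _. auto_derive; auto; field.
    - intros x _. apply (is_derive_scal_l (K := R_AbsRing) (V := R_NormedModule)). apply is_derive_Ai.
    - intros x Hx. apply Hloc. apply Rabs_le. lra.
    - rewrite Hz. lra. }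
  assert (Hlow' : forall s, i1 - d0 <= s <= i1 -> Ai s * D <= D ^ 2 / 2 * (s - i1)).
  { intros s Hs.
    assert (D ^ 2 / 2 * (i1 - i1) - Ai i1 * D <= - (Ai s * D - D ^ 2 / 2 * (s - i1))); [| rewrite Hz in H; lra].
    replace (D ^ 2 / 2 * (i1 - i1) - Ai i1 * D) with (- (Ai i1 * D - D ^ 2 / 2 * (i1 - i1))) by ring.
    apply Ropp_le_contravar.
    apply (le_of_derive_nonneg (fun s => Ai s * D - D ^ 2 / 2 * (s - i1)) (fun s => dAi s * D - D ^ 2 / 2) s i1 ltac:(lra)).
    - intros x _. apply is_derive_Rminus.
      apply (is_derive_scal_l (K := R_AbsRing) (V := R_NormedModule)). apply is_derive_Ai.
      auto_derive; auto; field.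
    - intros x Hx. specialize (Hloc x). assert (D ^ 2 / 2 <= dAi x * D) by (apply Hloc, Rabs_le; lra). lra. }
  assert (Hmin : exists m, 0 < m /\ forall s, i1 + d0 <= s <= 0 -> m <= Rabs (Ai s)).
  { destruct (continuity_ab_min (fun s => Rabs (Ai s)) (i1 + d0) 0 ltac:(lra)) as [mx [Hm1 Hm2]].
    - intros c _. apply continuity_pt_filterlim. apply (continuous_comp Ai Rabs).
      apply (is_derive_cont _ _ _ (is_derive_Ai c)). apply continuous_Rabs.
    - exists (Rabs (Ai mx)). split; auto. apply Rabs_pos_lt, Hnz; lra. }
  destruct Hmin as [m [Hm Hmin]].
  (* D^2 / 2 * C2 = C1 |D|: at distance C2 eps the linear bound meets the perturbation. Twice this
     distance is used to get strict signs. *)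
  set (C2 := 2 * C1 / Rabs D).
  assert (HC2 : 0 < C2) by (unfold C2; apply Rdiv_lt_0_compat; lra).
  (* Slope error at the zero: C1 eps from closeness to Ai', plus the variation of Ai' over a
     distance 2 C2 eps, where |s Ai s| <= S CA e^S. *)
  set (C3 := (C1 + S * CA * exp S * (2 * C2)) / Rabs (Ai 0)).
  assert (HC3 : 0 < C3).
  { unfold C3. apply Rdiv_lt_0_compat; auto. pose proof (exp_pos S).
    assert (0 < S * CA * exp S * (2 * C2)) by (apply Rmult_lt_0_compat; [apply Rmult_lt_0_compat; [apply Rmult_lt_0_compat |] |]; lra). lra. }
  (* Bounds on eps: 1 keeps |q| below L, the second keeps the radius 2 C2 eps within half the window
     d0, the third keeps C1 eps below half the minimum m of |Ai| on [i1 + d0, 0]. *)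
  exists (2 * C2 + C3), (Rmin 1 (Rmin (d0 / (4 * C2)) (m / (2 * C1)))).
  split; [lra |]. split.
  { repeat apply Rmin_glb_lt; [lra | |]; apply Rdiv_lt_0_compat; lra. }
  intros eps q f f1 Heps Hf Hf1 Hqe Hq Hv Hfnz.
  pose proof (Rmin_l 1 (Rmin (d0 / (4 * C2)) (m / (2 * C1)))) as He1.
  pose proof (Rmin_r 1 (Rmin (d0 / (4 * C2)) (m / (2 * C1)))) as He2.
  pose proof (Rmin_l (d0 / (4 * C2)) (m / (2 * C1))) as He3.
  pose proof (Rmin_r (d0 / (4 * C2)) (m / (2 * C1))) as He4.
  assert (Hed : 4 * C2 * eps <= d0).
  { apply Rle_trans with (4 * C2 * (d0 / (4 * C2))). apply Rmult_le_compat_l; lra. right; field; lra. }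
  assert (Hem : 2 * C1 * eps <= m).
  { apply Rle_trans with (2 * C1 * (m / (2 * C1))). apply Rmult_le_compat_l; lra. right; field; lra. }
  clear He2 He3 He4.
  pose proof (recessive_solution q f f1 (fun s Hs => Hf s ltac:(lra)) (fun s Hs => Hf1 s ltac:(lra)) Hq Hv Hfnz) as Hrec.
  assert (Hf0 : f 0 <> 0) by (apply Hrec; lra).
  split; auto.
  specialize (HW eps q f f1 ltac:(lra) (fun s Hs => Hf s ltac:(lra)) (fun s Hs => Hf1 s ltac:(lra)) Hq (fun s Hs => Hqe s ltac:(lra)) Hv Hfnz).
  (* After this rescaling F 0 = Ai 0 exactly, and the slopes at 0 differ by the Wronskian divided by
     f 0. *)
  set (k := Ai 0 / f 0).
  assert (Hk : k <> 0).
  { unfold k, Rdiv. apply Rmult_integral_contrapositive_currified; auto. now apply Rinv_neq_0_compat. }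
  set (F := fun s => k * f s). set (F1 := fun s => k * f1 s).
  assert (HF : forall s, i1 - 1 <= s -> is_derive F s (F1 s)).
  { intros s Hs. apply (is_derive_scal f s k (f1 s)). auto. }
  assert (HF1 : forall s, i1 - 1 <= s -> is_derive F1 s (q s * F s)).
  { intros s Hs. replace (q s * F s) with (k * (q s * f s)) by (unfold F; ring).
    apply (is_derive_scal f1 s k). auto. }
  assert (Hclose : forall s, i1 - 1 <= s <= 0 -> Rabs (F s - Ai s) <= C1 * eps /\ Rabs (F1 s - dAi s) <= C1 * eps).
  { intros s Hs.
    assert (HG : (F s - Ai s) ^ 2 + (F1 s - dAi s) ^ 2 <= (C1 * eps) ^ 2).
    { eapply Rle_trans.
      { apply (gronwall_backward (fun s => F s - Ai s) (fun s => F1 s - dAi s) q (fun s => (q s - s) * Ai s) L (eps * B) (i1 - 1) 0).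
        - unfold L. nra.
        - intros x Hx. apply is_derive_Rminus. apply HF; lra. apply is_derive_Ai.
        - intros x Hx. replace (q x * (F x - Ai x) + (q x - x) * Ai x) with (q x * F x - x * Ai x) by ring.
          apply is_derive_Rminus. apply HF1; lra. apply is_derive_dAi.
        - intros x Hx. replace (q x) with ((q x - x) + x) by ring.
          eapply Rle_trans. apply Rabs_triang. specialize (Hqe x ltac:(lra)).
          rewrite (Rabs_left1 x) by lra. unfold L.
          assert (x ^ 2 <= S ^ 2) by (unfold S; nra).
          pose proof (pow2_ge_0 x). assert (eps * x ^ 2 <= S ^ 2) by nra. unfold S in *; lra.
        - intros x Hx. rewrite Rabs_mult. unfold B.
          replace (eps * (S ^ 2 * CA * exp S)) with ((eps * S ^ 2) * (CA * exp S)) by ring.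
          apply Rmult_le_compat; try apply Rabs_pos.
          + eapply Rle_trans. apply Hqe; lra. apply Rmult_le_compat_l; [lra |]. unfold S; nra.
          + eapply Rle_trans. apply Hdec. apply Rmult_le_compat_l; [lra |]. apply exp_le. unfold S; lra.
        - exact Hs. }
      cbv beta.
      assert (E0 : F 0 - Ai 0 = 0) by (unfold F, k; field; auto).
      rewrite E0.
      assert (E1 : Rabs (F1 0 - dAi 0) <= eps * CW).
      { replace (F1 0 - dAi 0) with (- (f 0 * dAi 0 - f1 0 * Ai 0) / f 0) by (unfold F1, k; field; auto).
        unfold Rdiv. rewrite Rabs_mult, Rabs_Ropp, Rabs_inv.
        assert (0 < Rabs (f 0)) by now apply Rabs_pos_lt.
        apply Rmult_le_reg_r with (Rabs (f 0)); auto. rewrite Rmult_assoc, Rinv_l by lra. lra. }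
      apply Rle_trans with (((eps * CW) ^ 2 + (eps * B) ^ 2) * exp ((L + 2) * S)).
      - apply Rmult_le_compat.
        + pose proof (pow2_ge_0 (F1 0 - dAi 0)). pose proof (pow2_ge_0 (eps * B)). nra.
        + left; apply exp_pos.
        + rewrite <- (pow2_abs (F1 0 - dAi 0)). pose proof (Rabs_pos (F1 0 - dAi 0)). nra.
        + apply exp_le. apply Rmult_le_compat_l. unfold L; nra. unfold S; lra.
      - apply Rle_trans with (eps ^ 2 * ((CW ^ 2 + B ^ 2) * exp ((L + 2) * S))). right; ring.
        replace ((C1 * eps) ^ 2) with (eps ^ 2 * C1 ^ 2) by ring.
        apply Rmult_le_compat_l; auto. apply pow2_ge_0. }
    pose proof (pow2_ge_0 (F s - Ai s)). pose proof (pow2_ge_0 (F1 s - dAi s)).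
    assert (0 <= C1 * eps) by nra.
    split; rewrite <- (Rabs_pos_eq (C1 * eps)) by lra; apply Rsqr_le_abs_0; rewrite !Rsqr_pow2; lra. }
  assert (HFc : forall x, i1 - 1 <= x -> continuous F x) by (intros; eapply is_derive_cont, HF; auto).
  assert (Hnear : forall s, Rabs (s - i1) <= d0 -> Rabs (F s * D - Ai s * D) <= C1 * eps * Rabs D).
  { intros s Hs. apply Rabs_le_between in Hs.
    replace (F s * D - Ai s * D) with ((F s - Ai s) * D) by ring. rewrite Rabs_mult.
    apply Rmult_le_compat_r. apply Rabs_pos. apply Hclose. lra. }
  assert (HC2D : D ^ 2 / 2 * C2 = C1 * Rabs D) by (rewrite <- (pow2_abs D); unfold C2; field; lra).
  assert (HC1D : 0 < C1 * eps * Rabs D) by (apply Rmult_lt_0_compat; [apply Rmult_lt_0_compat |]; lra).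
  destruct (last_zero (fun s => F s * D) (i1 - 2 * C2 * eps) (i1 + 2 * C2 * eps)) as [z [Hz1 [Hz2 Hz3]]].
  - nra.
  - intros x Hx. apply (continuous_mult (K := R_AbsRing) F (fun _ => D)). apply HFc; nra. apply continuous_const.
  - specialize (Hnear (i1 - 2 * C2 * eps) ltac:(apply Rabs_le; nra)).
    specialize (Hlow' (i1 - 2 * C2 * eps) ltac:(nra)).
    apply Rabs_le_between in Hnear.
    replace (D ^ 2 / 2 * (i1 - 2 * C2 * eps - i1)) with (- 2 * (D ^ 2 / 2 * C2) * eps) in Hlow' by ring.
    rewrite HC2D in Hlow'. lra.
  - specialize (Hnear (i1 + 2 * C2 * eps) ltac:(apply Rabs_le; nra)).
    specialize (Hlow (i1 + 2 * C2 * eps) ltac:(nra)).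
    apply Rabs_le_between in Hnear.
    replace (D ^ 2 / 2 * (i1 + 2 * C2 * eps - i1)) with (2 * (D ^ 2 / 2 * C2) * eps) in Hlow by ring.
    rewrite HC2D in Hlow. lra.
  - exists z.
    assert (HFf : forall s, F s = 0 <-> f s = 0).
    { intros s. unfold F. split; intros H. apply Rmult_integral in H. tauto. rewrite H; ring. }
    assert (Hzi : Rabs (z - i1) <= 2 * C2 * eps) by (apply Rabs_le; lra).
    assert (Hzd : i1 - 1 <= z <= 0) by nra.
    assert (0 < C3 * eps) by nra. assert (0 < C2 * eps) by nra.
    split; [nra |]. split; [| split; [| split]].
    + apply HFf. apply Rmult_integral in Hz2. tauto.
    (* Four ranges: up to i1 + 2 C2 eps by choice of the last zero, up to i1 + d0 by the linear
       bound, up to 0 by the minimum m, and beyond 0 by recessiveness. *)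
    + intros s Hs. rewrite <- HFf.
      destruct (Rle_dec s (i1 + 2 * C2 * eps)).
      { specialize (Hz3 s ltac:(lra)). intros H1. rewrite H1 in Hz3. lra. }
      destruct (Rle_dec s (i1 + d0)).
      { specialize (Hnear s ltac:(apply Rabs_le; nra)). specialize (Hlow s ltac:(nra)).
        apply Rabs_le_between in Hnear. intros H1. rewrite H1 in Hnear.
        assert (D ^ 2 / 2 * (2 * C2 * eps) <= D ^ 2 / 2 * (s - i1)).
        { apply Rmult_le_compat_l. pose proof (pow2_ge_0 D). lra. lra. }
        replace (D ^ 2 / 2 * (2 * C2 * eps)) with (2 * (D ^ 2 / 2 * C2) * eps) in H2 by ring.
        rewrite HC2D in H2. lra. }
      destruct (Rle_dec s 0).
      { destruct (Hclose s ltac:(lra)) as [Hcl _]. specialize (Hmin s ltac:(lra)).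
        intros H1. rewrite H1 in Hcl. replace (0 - Ai s) with (- Ai s) in Hcl by ring. rewrite Rabs_Ropp in Hcl. lra. }
      rewrite HFf. apply Hrec. lra.
    + lra.
    + replace (f1 z / f 0 - D / Ai 0) with ((F1 z - D) / Ai 0) by (unfold F1, k; field; auto).
      unfold Rdiv. rewrite Rabs_mult, Rabs_inv.
      apply Rle_trans with (C3 * eps); [| lra].
      unfold C3, Rdiv. rewrite (Rmult_assoc _ (/ _)), (Rmult_comm (/ _) eps), <- Rmult_assoc.
      apply Rmult_le_compat_r. left; now apply Rinv_0_lt_compat.
      replace (F1 z - D) with ((F1 z - dAi z) + (dAi z - D)) by ring.
      eapply Rle_trans. apply Rabs_triang. rewrite Rmult_plus_distr_r.
      apply Rplus_le_compat. apply Hclose; lra.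
      destruct (MVT_gen dAi i1 z (fun x => x * Ai x)) as [c [Hc E]].
      { intros; apply is_derive_dAi. }
      { intros x _. apply continuity_pt_filterlim. apply (is_derive_cont _ _ _ (is_derive_dAi x)). }
      fold D in E. rewrite E, Rabs_mult.
      rewrite Rmult_assoc.
      apply Rmult_le_compat; try apply Rabs_pos; auto.
      rewrite Rabs_mult, Rmult_assoc.
      assert (i1 - 1 <= c <= 0) by (revert Hc; unfold Rmin, Rmax; destruct (Rle_dec i1 z); lra).
      apply Rmult_le_compat; try apply Rabs_pos.
      { apply Rabs_le. unfold S; lra. }
      eapply Rle_trans. apply Hdec. apply Rmult_le_compat_l; [lra |]. apply exp_le. unfold S; lra.
Qed.

(** * Derivatives of Chebyshev polynomials *)

(** The recurrence T_(n+2) = 2 x T_(n+1) - T_n differentiated k times by Leibniz, giving all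
    derivatives as explicit functions; at k = 0 the junk value of [pred k] is multiplied by
    [INR 0]. *)
Fixpoint chebF (n k : nat) (x : R) : R :=
  match n with
  | O => match k with O => 1 | _ => 0 end
  | S n' =>
    match n' with
    | O => match k with O => x | 1 => 1 | _ => 0 end
    | S n'' => 2 * x * chebF n' k x + 2 * INR k * chebF n' (pred k) x - chebF n'' k x
    end
  end.

Lemma chebF_SS (n k : nat) (x : R) :
  chebF (S (S n)) k x = 2 * x * chebF (S n) k x + 2 * INR k * chebF (S n) (pred k) x - chebF n k x.
Proof. reflexivity. Qed.

Lemma nat_ind2 (P : nat -> Prop) : P 0%nat -> P 1%nat -> (forall n, P n -> P (S n) -> P (S (S n))) -> forall n, P n.
Proof.
  intros H0 H1 H n. assert (P n /\ P (S n)) as [? _]; auto.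
  induction n as [| n [IH1 IH2]]; auto.
Qed.

Lemma is_derive_chebF (n : nat) : forall k x, is_derive (chebF n k) x (chebF n (S k) x).
Proof.
  induction n as [| | n IH1 IH2] using nat_ind2; intros k x.
  - destruct k; simpl; auto_derive; auto.
  - destruct k as [| [|]]; simpl; auto_derive; auto.
  - apply is_derive_ext with (fun x => 2 * x * chebF (S n) k x + 2 * INR k * chebF (S n) (pred k) x - chebF n k x).
    { intros t. now rewrite chebF_SS. }
    rewrite chebF_SS.
    replace (2 * x * chebF (S n) (S k) x + 2 * INR (S k) * chebF (S n) (pred (S k)) x - chebF n (S k) x) with
      ((2 * chebF (S n) k x + 2 * x * chebF (S n) (S k) x) + 2 * INR k * chebF (S n) (S (pred k)) x - chebF n (S k) x).
    2:{ destruct k. simpl INR. simpl pred. ring. change (pred (S (S k))) with (S k). simpl pred. rewrite (S_INR (S k)). ring. }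
    apply is_derive_Rminus; auto.
    apply is_derive_Rplus.
    + apply (is_derive_Rmult (fun x => 2 * x)); auto. auto_derive; auto; ring.
    + apply (is_derive_scal (chebF (S n) (pred k)) x (2 * INR k)). auto.
Qed.

Lemma chebF_0 (n : nat) (x : R) : chebF n 0 x = cheb n x.
Proof.
  induction n as [| | n IH1 IH2] using nat_ind2; auto.
  rewrite chebF_SS. change (cheb (S (S n)) x) with (2 * x * cheb (S n) x - cheb n x).
  simpl INR. rewrite IH1, IH2. ring.
Qed.

Lemma chebD_chebF (n k : nat) (x : R) : chebD n k x = chebF n k x.
Proof.
  unfold chebD. revert x. induction k; intros x; simpl.
  - symmetry; apply chebF_0.
  - rewrite (Derive_ext _ (chebF n k)) by auto. apply is_derive_unique, is_derive_chebF.
Qed.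

Lemma chebF_gt (n : nat) : forall k x, (n < k)%nat -> chebF n k x = 0.
Proof.
  induction n as [| | n IH1 IH2] using nat_ind2; intros k x Hk.
  - destruct k; [lia | reflexivity].
  - destruct k as [| [|]]; [lia | lia | reflexivity].
  - rewrite chebF_SS, IH1, !IH2 by lia. ring.
Qed.

Lemma chebF_diag (n : nat) : 0 < chebF n n 0 /\ forall x, chebF n n x = chebF n n 0.
Proof.
  induction n as [| | n IH1 IH2] using nat_ind2; try (simpl; split; intros; lra).
  assert (E : forall x, chebF (S (S n)) (S (S n)) x = 2 * INR (S (S n)) * chebF (S n) (S n) x).
  { intros x. rewrite chebF_SS, (chebF_gt (S n)), (chebF_gt n) by lia. simpl pred. ring. }
  split; intros; rewrite !E.
  - pose proof (lt_0_INR (S (S n)) ltac:(lia)). destruct IH2. nra.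
  - f_equal. apply IH2.
Qed.

(* The Chebyshev polynomials of the second kind, shifted: chebV n = U_(n-1). *)
Fixpoint chebV (n : nat) (x : R) : R :=
  match n with O => 0 | S n => x * chebV n x + cheb n x end.

Lemma cheb_S_V (n : nat) (x : R) : cheb (S n) x = x * cheb n x - (1 - x ^ 2) * chebV n x.
Proof.
  induction n.
  - simpl. ring.
  - change (cheb (S (S n)) x) with (2 * x * cheb (S n) x - cheb n x).
    change (chebV (S n) x) with (x * chebV n x + cheb n x). rewrite IHn. ring.
Qed.

(** The derivative of U_(n-1) stays an unnamed [v], since its equation cannot be divided by 1 - x^2
    at x = 1 or -1. Both statements are needed together for the induction. *)
Lemma cheb_derivatives (n : nat) (x : R) :
  is_derive (cheb n) x (INR n * chebV n x) /\
  exists v, is_derive (chebV n) x v /\ (1 - x ^ 2) * v = x * chebV n x - INR n * cheb n x.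
Proof.
  induction n as [| n [IH1 [v [IH2 E]]]].
  - split.
    + simpl. auto_derive; auto. ring.
    + exists 0. split; [simpl; auto_derive; auto | simpl; ring].
  - assert (D : is_derive (cheb (S n)) x (INR (S n) * chebV (S n) x)).
    { apply is_derive_ext with (fun x => x * cheb n x - (1 - x ^ 2) * chebV n x).
      { intros t. symmetry. apply cheb_S_V. }
      replace (INR (S n) * chebV (S n) x) with
       ((1 * cheb n x + x * (INR n * chebV n x)) - (- (2 * x) * chebV n x + (1 - x ^ 2) * v)).
      2:{ rewrite E, S_INR. simpl chebV. ring. }
      apply is_derive_Rminus.
      - apply (is_derive_Rmult (fun x => x)); auto. apply (is_derive_id (K := R_AbsRing)).
      - apply (is_derive_Rmult (fun x => 1 - x ^ 2)); auto. auto_derive; auto; ring. }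
    split; auto.
    exists (1 * chebV n x + x * v + INR n * chebV n x). split.
    + apply is_derive_Rplus; auto.
      apply (is_derive_Rmult (fun x => x)); auto. apply (is_derive_id (K := R_AbsRing)).
    + replace ((1 - x ^ 2) * (1 * chebV n x + x * v + INR n * chebV n x)) with
        ((1 - x ^ 2) * (1 + INR n) * chebV n x + x * ((1 - x ^ 2) * v)) by ring.
      rewrite E, cheb_S_V, S_INR. simpl chebV. ring.
Qed.

(** The case k = 0 is Chebyshev's equation; differentiating the identity at order k gives order k +
    1. *)
Lemma chebF_ode (n k : nat) : forall x,
  (1 - x ^ 2) * chebF n (S (S k)) x - (2 * INR k + 1) * x * chebF n (S k) x + (INR n ^ 2 - INR k ^ 2) * chebF n k x = 0.
Proof.
  induction k; intros x.
  - assert (E1 : forall x, chebF n 1 x = INR n * chebV n x).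
    { intros y. rewrite <- (is_derive_unique _ _ _ (is_derive_chebF n 0 y)).
      rewrite (Derive_ext _ (cheb n)) by apply chebF_0. apply is_derive_unique, cheb_derivatives. }
    destruct (cheb_derivatives n x) as [_ [v [Hv E]]].
    assert (E2 : chebF n 2 x = INR n * v).
    { rewrite <- (is_derive_unique _ _ _ (is_derive_chebF n 1 x)).
      rewrite (Derive_ext _ _ _ E1). apply is_derive_unique. now apply (is_derive_scal (chebV n)). }
    rewrite E2, E1, chebF_0. simpl INR.
    replace ((1 - x ^ 2) * (INR n * v)) with (INR n * ((1 - x ^ 2) * v)) by ring. rewrite E. ring.
  - assert (D : is_derive (fun x => (1 - x ^ 2) * chebF n (S (S k)) x - (2 * INR k + 1) * x * chebF n (S k) x + (INR n ^ 2 - INR k ^ 2) * chebF n k x) x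
      ((- (2 * x) * chebF n (S (S k)) x + (1 - x ^ 2) * chebF n (S (S (S k))) x)
       - ((2 * INR k + 1) * chebF n (S k) x + (2 * INR k + 1) * x * chebF n (S (S k)) x)
       + (INR n ^ 2 - INR k ^ 2) * chebF n (S k) x)).
    { apply is_derive_Rplus.
      2: apply (is_derive_scal (chebF n k)), is_derive_chebF.
      apply is_derive_Rminus.
      - apply (is_derive_Rmult (fun x => 1 - x ^ 2)). auto_derive; auto; ring. apply is_derive_chebF.
      - apply (is_derive_Rmult (fun x => (2 * INR k + 1) * x)). auto_derive; auto; ring. apply is_derive_chebF. }
    apply is_derive_unique in D. rewrite (Derive_ext _ (fun _ => 0)) in D by auto.
    rewrite Derive_const in D. rewrite S_INR. lra.
Qed.

(** At x = 1 the second-order term disappears, leaving a two-term relation that determines all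
    derivatives at 1 up to a common factor. *)
Lemma chebF_1_S (n k : nat) :
  (INR n ^ 2 - INR k ^ 2) * chebF n k 1 = (2 * INR k + 1) * chebF n (S k) 1.
Proof. pose proof (chebF_ode n k 1). lra. Qed.

(** Descending induction from the positive constant of order n; [m] counts the distance n - k. *)
Lemma chebF_1_pos (n k : nat) : (k <= n)%nat -> 0 < chebF n k 1.
Proof.
  intros H. replace k with (n - (n - k))%nat by lia. assert (H1 : (n - k <= n)%nat) by lia. revert H1.
  generalize (n - k)%nat as m. clear H k. intros m. induction m; intros Hm.
  - rewrite Nat.sub_0_r. destruct (chebF_diag n) as [H ->]. auto.
  - specialize (IHm ltac:(lia)).
    pose proof (chebF_1_S n (n - S m)) as E. replace (S (n - S m)) with (n - m)%nat in E by lia.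
    pose proof (pos_INR (n - S m)).
    assert (0 < INR n ^ 2 - INR (n - S m) ^ 2).
    { assert (INR (n - S m) < INR n) by (apply lt_INR; lia). nra. }
    assert (0 < (INR n ^ 2 - INR (n - S m) ^ 2) * chebF n (n - S m) 1) by (rewrite E; apply Rmult_lt_0_compat; lra).
    nra.
Qed.

(** Positive derivatives of all orders from k to n at x0 make each one increasing to the right, by
    descending induction. This bounds the zeros of the k-th derivative from above by finitely many
    inequalities at a single point. *)
Lemma chebF_pos_above (n k : nat) (x0 : R) : (k <= n)%nat -> (forall j, (k <= j <= n)%nat -> 0 < chebF n j x0) ->
  forall x, x0 <= x -> 0 < chebF n k x.
Proof.
  intros H. replace k with (n - (n - k))%nat by lia. assert (H1 : (n - k <= n)%nat) by lia. revert H1.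
  generalize (n - k)%nat as m. clear H k. intros m. induction m; intros Hm Hpos x Hx.
  - rewrite Nat.sub_0_r. destruct (chebF_diag n) as [H ->]. auto.
  - apply Rlt_le_trans with (chebF n (n - S m) x0). apply Hpos; lia.
    apply (le_of_derive_nonneg _ (chebF n (S (n - S m)))); auto.
    + intros y _. apply is_derive_chebF.
    + intros y Hy. replace (S (n - S m)) with (n - m)%nat by lia. left. apply IHm; try lia; try lra.
      intros j Hj. apply Hpos; lia.
Qed.

Lemma eq_of_derive_0 (f : R -> R) (x y : R) : (forall z, is_derive f z 0) -> f x = f y.
Proof.
  intros H. pose proof (lipschitz_of_derive f (fun _ => 0) 0 y x H ltac:(intros; cbv beta; rewrite Rabs_R0; lra)).
  rewrite Rmult_0_l in H0. pose proof (Rabs_pos (f x - f y)).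
  assert (Rabs (f x - f y) = 0) by lra. apply Rabs_eq_0 in H2. lra.
Qed.

Lemma is_derive_taylor_sum (c : nat -> R) (a : R) (d : nat) (x : R) :
  is_derive (fun x => sum_f_R0 (fun j => c j / INR (fact j) * (x - a) ^ j) (S d)) x
    (sum_f_R0 (fun j => c (S j) / INR (fact j) * (x - a) ^ j) d).
Proof.
  assert (Hj : forall j, is_derive (fun x => c (S j) / INR (fact (S j)) * (x - a) ^ (S j)) x (c (S j) / INR (fact j) * (x - a) ^ j)).
  { intros j.
    replace (c (S j) / INR (fact j)) with (INR (S j) * (c (S j) / INR (fact (S j)))).
    2:{ rewrite fact_simpl, mult_INR. pose proof (INR_fact_neq_0 j). pose proof (not_0_INR (S j) ltac:(lia)). field. auto. }
    generalize (c (S j) / INR (fact (S j))) as B. intros B.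
    replace (INR (S j) * B * (x - a) ^ j) with (B * (INR (S j) * 1 * (x - a) ^ pred (S j))) by (simpl pred; ring).
    apply (is_derive_scal (fun x => (x - a) ^ S j)). apply (is_derive_pow (fun x => x - a)).
    auto_derive; auto; ring. }
  induction d.
  - simpl. auto_derive; auto. field.
  - change (sum_f_R0 (fun j => c (S j) / INR (fact j) * (x - a) ^ j) (S d)) with
      (sum_f_R0 (fun j => c (S j) / INR (fact j) * (x - a) ^ j) d + c (S (S d)) / INR (fact (S d)) * (x - a) ^ (S d)).
    apply (is_derive_Rplus (fun x => sum_f_R0 (fun j => c j / INR (fact j) * (x - a) ^ j) (S d))). 2: apply Hj.
    apply IHd.
Qed.

(** Induction on the degree: the difference between G 0 and its Taylor sum has derivative 0 and
    vanishes at a. *)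
Lemma taylor_polynomial (d : nat) : forall G : nat -> R -> R,
  (forall i x, is_derive (G i) x (G (S i) x)) -> (forall i x, (d < i)%nat -> G i x = 0) ->
  forall x a, G 0%nat x = sum_f_R0 (fun j => G j a / INR (fact j) * (x - a) ^ j) d.
Proof.
  induction d; intros G HG H0 x a.
  - simpl. replace (G 0%nat a / 1 * 1) with (G 0%nat a) by field. apply eq_of_derive_0.
    intros z. rewrite <- (H0 1%nat z) by lia. apply HG.
  - set (P := fun x => sum_f_R0 (fun j => G j a / INR (fact j) * (x - a) ^ j) (S d)). fold (P x).
    assert (E : G 0%nat x - P x = G 0%nat a - P a).
    { apply (eq_of_derive_0 (fun x => G 0%nat x - P x)). intros z.
      replace 0 with (G 1%nat z - sum_f_R0 (fun j => G (S j) a / INR (fact j) * (z - a) ^ j) d).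
      - apply is_derive_Rminus. apply HG.
        apply (is_derive_taylor_sum (fun j => G j a)).
      - rewrite (IHd (fun i => G (S i))) with (a := a); auto. ring. intros i y Hi. apply H0; lia. }
    assert (Pa : P a = G 0%nat a).
    { unfold P. rewrite tech2 with (m := 0%nat) by lia. simpl sum_f_R0 at 1.
      rewrite (sum_eq _ (fun _ => 0)).
      - rewrite sum_cte. simpl. field.
      - intros i _. rewrite Rminus_diag, pow_i by lia. ring. }
    lra.
Qed.

(** * The Bessel limit *)

(* [phi_c k j = 1 / (j! (k+1/2)_j)], so that [Phi k] is the hypergeometric series 0F1(; k+1/2; -y). *)
Fixpoint phi_c (k j : nat) : R :=
  match j with
  | O => 1
  | S i => phi_c k i / ((INR i + 1) * (INR k + INR i + 1 / 2))
  end.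

Definition Phi (k : nat) : R -> R := PSeries (fun j => (-1) ^ j * phi_c k j).

Lemma phi_c_S (k i : nat) : phi_c k (S i) = phi_c k i / ((INR i + 1) * (INR k + INR i + 1 / 2)).
Proof. reflexivity. Qed.

Lemma phi_c_pos (k j : nat) : 0 < phi_c k j.
Proof.
  induction j; simpl. lra. pose proof (pos_INR j). pose proof (pos_INR k).
  apply Rdiv_lt_0_compat; auto. apply Rmult_lt_0_compat; lra.
Qed.

Lemma phi_c_le_fact (k j : nat) : (1 <= k)%nat -> phi_c k j <= / INR (fact j).
Proof.
  intros Hk. apply (le_INR 1) in Hk. simpl (INR 1) in Hk. induction j.
  - simpl. lra.
  - rewrite fact_simpl, mult_INR, Rinv_mult, S_INR. simpl phi_c.
    pose proof (pos_INR j). pose proof (phi_c_pos k j).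
    unfold Rdiv. rewrite Rinv_mult, Rmult_comm.
    rewrite Rmult_assoc. apply Rmult_le_compat_l. left; apply Rinv_0_lt_compat; lra.
    apply Rle_trans with (1 * phi_c k j); [| lra].
    apply Rmult_le_compat_r; [lra |]. rewrite <- Rinv_1. apply Rinv_le_contravar; lra.
Qed.

(** The Pochhammer identity (k + 1/2)_j (k + j + 1/2) = (k + 1/2) (k + 3/2)_j, to which both the
    derivative and the recurrence of [Phi] reduce. *)
Lemma phi_c_shift (k j : nat) : (INR k + 1 / 2) * phi_c k j = (INR k + INR j + 1 / 2) * phi_c (S k) j.
Proof.
  pose proof (pos_INR k).
  induction j.
  - simpl INR. simpl phi_c. ring.
  - pose proof (pos_INR j). rewrite !phi_c_S, !S_INR.
    replace ((INR k + 1 / 2) * (phi_c k j / ((INR j + 1) * (INR k + INR j + 1 / 2)))) with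
      (((INR k + 1 / 2) * phi_c k j) / ((INR j + 1) * (INR k + INR j + 1 / 2))) by (field; lra).
    rewrite IHj. field. lra.
Qed.

Lemma Phi_CV (k : nat) : CV_radius (fun j => (-1) ^ j * phi_c k j) = p_infty.
Proof.
  apply CV_radius_infinite_DAlembert.
  - intros j. apply Rmult_integral_contrapositive_currified. apply pow_nonzero; lra.
    apply Rgt_not_eq, phi_c_pos.
  - apply is_lim_seq_le_le with (fun _ => 0) (fun j => 2 * / (INR j + 1)).
    + intros j. split. apply Rabs_pos. pose proof (pos_INR j). pose proof (pos_INR k). pose proof (phi_c_pos k j).
      assert (E : (-1) ^ S j * phi_c k (S j) / ((-1) ^ j * phi_c k j) = - (/ (INR j + 1) * / (INR k + INR j + 1 / 2))).
      { simpl phi_c. simpl pow. field. repeat split; try lra. apply pow_nonzero; lra. }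
      rewrite E, Rabs_Ropp, Rabs_pos_eq.
      2:{ apply Rmult_le_pos; left; apply Rinv_0_lt_compat; lra. }
      rewrite Rmult_comm. apply Rmult_le_compat_r. left; apply Rinv_0_lt_compat; lra.
      replace 2 with (/ (1 / 2)) by field. apply Rinv_le_contravar; lra.
    + apply is_lim_seq_const.
    + replace 0 with (2 * 0) by ring. apply (is_lim_seq_scal_l _ 2 (Finite 0)).
      apply (is_lim_seq_inv _ p_infty); [| discriminate].
      apply is_lim_seq_ext with (fun n => INR (S n)). { intros; apply S_INR. }
      apply (is_lim_seq_incr_1 INR). apply is_lim_seq_INR.
Qed.

Lemma Phi_ex (k : nat) (y : R) : ex_pseries (fun j => (-1) ^ j * phi_c k j) y.
Proof. apply CV_radius_inside. now rewrite Phi_CV. Qed.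

Lemma Phi_lim (k : nat) (y : R) :
  is_lim_seq (fun N => sum_f_R0 (fun j => phi_c k j * (- y) ^ j) N) (Phi k y).
Proof.
  pose proof (PSeries_correct _ _ (Phi_ex k y)) as H. apply is_pseries_R in H.
  apply is_lim_seq_ext with (2 := H). intros N. rewrite sum_n_Reals. apply sum_eq.
  intros i _. replace (- y) with (-1 * y) by ring. rewrite Rpow_mult_distr. ring.
Qed.

Lemma Phi_0 (k : nat) : Phi k 0 = 1.
Proof. unfold Phi. rewrite PSeries_0. simpl. ring. Qed.

Lemma is_derive_Phi (k : nat) (y : R) : is_derive (Phi k) y (- (Phi (S k) y / (INR k + 1 / 2))).
Proof.
  pose proof (pos_INR k).
  replace (- (Phi (S k) y / (INR k + 1 / 2))) with (PSeries (PS_derive (fun j => (-1) ^ j * phi_c k j)) y).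
  - apply is_derive_PSeries. now rewrite Phi_CV.
  - replace (- (Phi (S k) y / (INR k + 1 / 2))) with (- / (INR k + 1 / 2) * Phi (S k) y) by (field; lra).
    unfold Phi. rewrite <- PSeries_scal. apply PSeries_ext. intros j. unfold PS_derive, PS_scal.
    change (scal (- / (INR k + 1 / 2)) ((-1) ^ j * phi_c (S k) j)) with (- / (INR k + 1 / 2) * ((-1) ^ j * phi_c (S k) j)).
    pose proof (pos_INR j). pose proof (phi_c_shift k j) as E.
    rewrite phi_c_S, S_INR. simpl pow.
    replace (phi_c k j) with ((INR k + INR j + 1 / 2) * phi_c (S k) j / (INR k + 1 / 2)) by (rewrite <- E; field; lra).
    field. lra.
Qed.

(** Bessel's recurrence J_(v-1) + J_(v+1) = (2 v / z) J_v in this normalisation: Phi k (z^2 / 4) is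
    a constant multiple of z^(1/2 - k) J_(k - 1/2)(z). *)
Lemma Phi_recurrence (k : nat) (y : R) :
  Phi k y = Phi (S k) y - y * Phi (S (S k)) y / ((INR k + 1 / 2) * (INR k + 3 / 2)).
Proof.
  pose proof (pos_INR k).
  replace (Phi (S k) y - y * Phi (S (S k)) y / ((INR k + 1 / 2) * (INR k + 3 / 2))) with
    (Phi (S k) y + (- / ((INR k + 1 / 2) * (INR k + 3 / 2))) * (y * Phi (S (S k)) y)) by (field; lra).
  unfold Phi. rewrite <- PSeries_incr_1, <- PSeries_scal, <- PSeries_plus.
  - apply PSeries_ext. intros [| i]; unfold PS_plus, PS_scal, PS_incr_1.
    + change (1 * 1 = 1 * 1 + - / ((INR k + 1 / 2) * (INR k + 3 / 2)) * 0). ring.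
    + change ((-1) ^ S i * phi_c k (S i) = (-1) ^ S i * phi_c (S k) (S i) +
        - / ((INR k + 1 / 2) * (INR k + 3 / 2)) * ((-1) ^ i * phi_c (S (S k)) i)).
      pose proof (pos_INR i).
      pose proof (phi_c_shift k i) as E1. pose proof (phi_c_shift (S k) i) as E2.
      rewrite !phi_c_S. simpl pow. rewrite !S_INR in *.
      replace (phi_c k i) with ((INR k + INR i + 1 / 2) * phi_c (S k) i / (INR k + 1 / 2)) by (rewrite <- E1; field; lra).
      replace (phi_c (S (S k)) i) with ((INR k + 1 + 1 / 2) * phi_c (S k) i / (INR k + 1 + INR i + 1 / 2)) by (rewrite E2; field; lra).
      field. lra.
  - apply Phi_ex.
  - apply ex_pseries_scal. { intros; apply Rmult_comm. } apply (ex_pseries_incr_1 (V := R_NormedModule)). apply Phi_ex.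
Qed.

Lemma Phi_bound (k : nat) (y : R) : (1 <= k)%nat -> Rabs (Phi k y) <= exp (Rabs y).
Proof.
  intros Hk.
  refine (is_lim_seq_le (fun N => Rabs (sum_f_R0 (fun j => phi_c k j * (- y) ^ j) N)) (fun _ => exp (Rabs y))
    (Rabs (Phi k y)) (exp (Rabs y)) _ _ _).
  - intros N. eapply Rle_trans. apply Rsum_abs.
    eapply Rle_trans. 2: apply (exp_ge_taylor (Rabs y) N (Rabs_pos y)).
    apply sum_Rle. intros j _. rewrite Rabs_mult, <- RPow_abs, Rabs_Ropp.
    rewrite Rabs_pos_eq by (left; apply phi_c_pos).
    unfold Rdiv. rewrite Rmult_comm. apply Rmult_le_compat_l. apply pow_le, Rabs_pos. now apply phi_c_le_fact.
  - apply (is_lim_seq_abs _ (Finite _)), Phi_lim.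
  - apply is_lim_seq_const.
Qed.

Lemma nat_le_pow2 (j : nat) : INR j <= 2 ^ j.
Proof.
  induction j. simpl; lra. rewrite S_INR. simpl.
  assert (1 <= 2 ^ j) by (apply pow_R1_Rle; lra). lra.
Qed.

(** The Taylor coefficients at 1 are [phi_c k j] times the product over i < j of 1 - (k + i)^2 /
    n^2, by [chebF_1_S]. Each coefficient therefore loses at most the fraction j (k + j)^2 / n^2. *)
Lemma cheb_to_Phi (n k : nat) (y : R) : (1 <= k <= n)%nat ->
  Rabs (chebF n k (1 - 2 * y / INR n ^ 2) / chebF n k 1 - Phi k y) <=
    (INR k + 1) ^ 2 * exp (8 * Rabs y) / INR n ^ 2.
Proof.
  intros [Hk Hkn].
  assert (Hn : 1 <= INR n) by (apply (le_INR 1); lia).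
  assert (Hk1 : 1 <= INR k) by (apply (le_INR 1); lia).
  pose proof (chebF_1_pos n k Hkn) as Hpos.
  set (r := fun j => chebF n (k + j) 1 / chebF n k 1 * (2 / INR n ^ 2) ^ j / INR (fact j)).
  assert (Hr0 : r 0%nat = 1). { unfold r. rewrite Nat.add_0_r. simpl. field. lra. }
  assert (HrS : forall j, r (S j) = r j * (1 - (INR k + INR j) ^ 2 / INR n ^ 2) / ((INR j + 1) * (INR k + INR j + 1 / 2))).
  { intros j. unfold r. pose proof (chebF_1_S n (k + j)) as E. rewrite plus_INR in E.
    pose proof (pos_INR j). replace (k + S j)%nat with (S (k + j)) by lia.
    replace (chebF n (S (k + j)) 1) with ((INR n ^ 2 - (INR k + INR j) ^ 2) * chebF n (k + j) 1 / (2 * (INR k + INR j) + 1)).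
    2:{ rewrite E. field. lra. }
    rewrite fact_simpl, mult_INR, S_INR. change ((2 / INR n ^ 2) ^ S j) with (2 / INR n ^ 2 * (2 / INR n ^ 2) ^ j). pose proof (INR_fact_neq_0 j).
    generalize ((2 / INR n ^ 2) ^ j) as P. intros P. field. repeat split; auto; lra. }
  assert (Hr : forall j, 0 <= r j <= phi_c k j /\ phi_c k j - r j <= phi_c k j * (INR j * (INR k + INR j) ^ 2) / INR n ^ 2).
  { assert (Hn2 : 0 < INR n ^ 2) by nra.
    induction j as [| j [[IH1 IH2] IH3]].
    - rewrite Hr0. simpl phi_c. simpl INR. split. lra. right. field. lra.
    - pose proof (pos_INR j). pose proof (phi_c_pos k j) as Hc.
      set (w := / ((INR j + 1) * (INR k + INR j + 1 / 2))).
      assert (Hw : 0 < w) by (apply Rinv_0_lt_compat, Rmult_lt_0_compat; lra).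
      set (q := (INR k + INR j) ^ 2 / INR n ^ 2) in *.
      assert (Hq : 0 <= q) by (apply Rmult_le_pos; [apply pow2_ge_0 | left; now apply Rinv_0_lt_compat]).
      assert (EC : phi_c k (S j) = phi_c k j * w) by reflexivity.
      assert (ER : r (S j) = r j * (1 - q) * w) by (rewrite HrS; reflexivity).
      (* A factor 1 - q could be negative only for k + j > n, but then the coefficient is already
         0. *)
      assert (Hq1 : r j = 0 \/ q <= 1).
      { destruct (Nat.le_gt_cases (k + j) n) as [H1 | H1].
        - right. unfold q. apply Rmult_le_reg_r with (INR n ^ 2); auto.
          unfold Rdiv. rewrite Rmult_assoc, Rinv_l, Rmult_1_r, Rmult_1_l by lra.
          apply pow_incr. split. lra. rewrite <- plus_INR. now apply le_INR.
        - left. unfold r. rewrite chebF_gt by lia. unfold Rdiv. ring. }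
      assert (Hrq : 0 <= r j * (1 - q) <= phi_c k j).
      { destruct Hq1 as [-> | Hq1]. lra. nra. }
      rewrite EC, ER. repeat split.
      + apply Rmult_le_pos; lra.
      + apply Rmult_le_compat_r; lra.
      + rewrite <- Rmult_minus_distr_r. rewrite S_INR.
        apply Rle_trans with ((phi_c k j * (INR j * (INR k + INR j) ^ 2) / INR n ^ 2 + phi_c k j * q) * w).
        * apply Rmult_le_compat_r; [lra |]. nra.
        * apply Rle_trans with ((phi_c k j * ((INR j + 1) * (INR k + INR j) ^ 2) / INR n ^ 2) * w).
          { right. unfold q. field. lra. }
          apply Rle_trans with ((phi_c k j * ((INR j + 1) * (INR k + (INR j + 1)) ^ 2) / INR n ^ 2) * w).
          2:{ right. field. lra. }
          apply Rmult_le_compat_r; [lra |]. apply Rmult_le_compat_r; [left; now apply Rinv_0_lt_compat |].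
          apply Rmult_le_compat_l; [lra |]. apply Rmult_le_compat_l; [lra |]. apply pow_incr; lra. }
  assert (HT : forall N, (n <= N)%nat -> chebF n k (1 - 2 * y / INR n ^ 2) / chebF n k 1 = sum_f_R0 (fun j => r j * (- y) ^ j) N).
  { intros N HN.
    pose proof (taylor_polynomial N (fun i => chebF n (k + i))) as T. cbv beta in T. rewrite Nat.add_0_r in T.
    rewrite T with (a := 1).
    - unfold Rdiv at 1. rewrite Rmult_comm, scal_sum. apply sum_eq. intros j _. unfold r.
      replace (1 - 2 * y / INR n ^ 2 - 1) with (2 / INR n ^ 2 * - y) by (field; lra).
      rewrite Rpow_mult_distr. field. split; [lra | apply INR_fact_neq_0].
    - intros i x. rewrite Nat.add_succ_r. apply is_derive_chebF.
    - intros i x Hi. apply chebF_gt. lia. }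
  refine (is_lim_seq_le_loc (fun N => Rabs (chebF n k (1 - 2 * y / INR n ^ 2) / chebF n k 1 - sum_f_R0 (fun j => phi_c k j * (- y) ^ j) N)) 
    (fun _ => (INR k + 1) ^ 2 * exp (8 * Rabs y) / INR n ^ 2) (Rabs (_ - _)) ((INR k + 1) ^ 2 * exp (8 * Rabs y) / INR n ^ 2) _ _ _).
  - exists n. intros N HN. rewrite (HT N HN), <- minus_sum.
    eapply Rle_trans. apply Rsum_abs.
    apply Rle_trans with (sum_f_R0 (fun j => (8 * Rabs y) ^ j / INR (fact j) * ((INR k + 1) ^ 2 / INR n ^ 2)) N).
    + apply sum_Rle. intros j _. destruct (Hr j) as [[H1 H2] H3].
      replace (r j * (- y) ^ j - phi_c k j * (- y) ^ j) with (- ((phi_c k j - r j) * (- y) ^ j)) by ring.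
      rewrite Rabs_Ropp, Rabs_mult, <- RPow_abs, Rabs_Ropp, (Rabs_pos_eq (phi_c k j - r j)) by lra.
      rewrite Rpow_mult_distr.
      replace (8 ^ j * Rabs y ^ j / INR (fact j) * ((INR k + 1) ^ 2 / INR n ^ 2)) with
        ((/ INR (fact j) * ((INR k + 1) ^ 2 * 8 ^ j) / INR n ^ 2) * Rabs y ^ j).
      2:{ field. split. lra. apply INR_fact_neq_0. }
      apply Rmult_le_compat_r. apply pow_le, Rabs_pos.
      eapply Rle_trans. exact H3. apply Rmult_le_compat_r.
      { left; apply Rinv_0_lt_compat; nra. }
      (* From j <= 2^j and k + j <= (k + 1) 2^j follows j (k + j)^2 <= (k + 1)^2 8^j: this is the
         origin of e^(8 |y|). *)
      pose proof (pos_INR j). pose proof (nat_le_pow2 j). assert (1 <= 2 ^ j) by (apply pow_R1_Rle; lra).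
      apply Rmult_le_compat. left; apply phi_c_pos. apply Rmult_le_pos; [lra | apply pow2_ge_0]. now apply phi_c_le_fact.
      replace (8 ^ j) with (2 ^ j * (2 ^ j) ^ 2).
      2:{ rewrite <- Rpow_mult_distr with (x := 2) (y := 2 * 1) || idtac. simpl pow at 2. rewrite Rmult_1_r, <- !Rpow_mult_distr. f_equal; lra. }
      replace ((INR k + 1) ^ 2 * (2 ^ j * (2 ^ j) ^ 2)) with (2 ^ j * ((INR k + 1) * 2 ^ j) ^ 2) by ring.
      apply Rmult_le_compat; auto. apply pow2_ge_0. apply pow_incr. split; nra.
    + rewrite <- scal_sum. unfold Rdiv at 1. 
      replace ((INR k + 1) ^ 2 * exp (8 * Rabs y) / INR n ^ 2) with ((INR k + 1) ^ 2 / INR n ^ 2 * exp (8 * Rabs y)) by (field; lra).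
      apply Rmult_le_compat_l. { apply Rmult_le_pos; [apply pow2_ge_0 | left; apply Rinv_0_lt_compat; nra]. }
      apply exp_ge_taylor. pose proof (Rabs_pos y). lra.
  - apply (is_lim_seq_abs _ (Finite (_ - _))). apply is_lim_seq_minus'. apply is_lim_seq_const. apply Phi_lim.
  - apply is_lim_seq_const.
Qed.

(** The Bessel orders -1/2 and 1/2 are elementary. The cosine supplies arbitrarily large zeros, and
    cosine and sine together start the recursion of the arc integrals. *)
Lemma Phi_0_cos (z : R) : Phi 0 (z ^ 2 / 4) = cos z.
Proof.
  assert (Hc : forall j, phi_c 0 j = 4 ^ j / INR (fact (2 * j))).
  { induction j. simpl; field. rewrite phi_c_S, IHj.
    replace (2 * S j)%nat with (S (S (2 * j))) by lia. rewrite 2!fact_simpl, !mult_INR.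
    replace (INR (S (S (2 * j)))) with (2 * INR j + 2) by (rewrite 2!S_INR, mult_INR; simpl INR; ring).
    replace (INR (S (2 * j))) with (2 * INR j + 1) by (rewrite S_INR, mult_INR; simpl INR; ring).
    pose proof (pos_INR j). pose proof (INR_fact_neq_0 (2 * j)).
    change (INR 0) with 0. change (4 ^ S j) with (4 * 4 ^ j). field. repeat split; auto; lra. }
  unfold Phi, cos. destruct (exist_cos (Rsqr z)) as [l Hl]. unfold cos_in in Hl. apply is_series_Reals in Hl.
  apply is_pseries_unique. apply is_pseries_R.
  apply is_series_ext with (2 := Hl). intros j. unfold cos_n. rewrite Hc, Rsqr_pow2.
  replace ((z ^ 2 / 4) ^ j) with ((z ^ 2) ^ j / 4 ^ j).
  2:{ unfold Rdiv. rewrite Rpow_mult_distr, pow_inv. reflexivity. }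
  match goal with |- @eq _ ?a ?b => change (@eq R a b) end.
  pose proof (pow_nonzero 4 j ltac:(lra)). field. split; auto. apply INR_fact_neq_0.
Qed.

Lemma Phi_1_sin (z : R) : z * Phi 1 (z ^ 2 / 4) = sin z.
Proof.
  assert (Hc : forall j, phi_c 1 j = 4 ^ j / INR (fact (2 * j + 1))).
  { induction j. simpl; field. rewrite phi_c_S, IHj.
    replace (2 * S j + 1)%nat with (S (S (2 * j + 1))) by lia. rewrite 2!fact_simpl, !mult_INR.
    replace (INR (S (S (2 * j + 1)))) with (2 * INR j + 3) by (rewrite 2!S_INR, plus_INR, mult_INR; simpl INR; ring).
    replace (INR (S (2 * j + 1))) with (2 * INR j + 2) by (rewrite S_INR, plus_INR, mult_INR; simpl INR; ring).
    pose proof (pos_INR j). pose proof (INR_fact_neq_0 (2 * j + 1)).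
    change (INR 1) with 1. change (4 ^ S j) with (4 * 4 ^ j). field. repeat split; auto; lra. }
  unfold Phi, sin. destruct (exist_sin (Rsqr z)) as [l Hl]. unfold sin_in in Hl. apply is_series_Reals in Hl.
  f_equal. apply is_pseries_unique. apply is_pseries_R.
  apply is_series_ext with (2 := Hl). intros j. unfold sin_n. rewrite Hc, Rsqr_pow2.
  replace ((z ^ 2 / 4) ^ j) with ((z ^ 2) ^ j / 4 ^ j).
  2:{ unfold Rdiv. rewrite Rpow_mult_distr, pow_inv. reflexivity. }
  match goal with |- @eq _ ?a ?b => change (@eq R a b) end.
  pose proof (pow_nonzero 4 j ltac:(lra)). field. split; auto. apply INR_fact_neq_0.
Qed.

(** * Zeros of the Bessel-type functions and the limit of tau for fixed k *)

Lemma first_zero (g : R -> R) (b : R) : 0 < b -> (forall x, 0 <= x <= b -> continuous g x) ->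
  0 < g 0 -> g b <= 0 -> exists z, 0 < z <= b /\ g z = 0 /\ forall x, 0 <= x < z -> 0 < g x.
Proof.
  intros Hb Hc H0 Hgb.
  destruct (last_zero (fun x => g (- x)) (- b) 0) as [z [Hz1 [Hz2 Hz3]]]; try (rewrite ?Ropp_involutive, ?Ropp_0; lra).
  - intros x Hx. apply (continuous_comp Ropp g). cont1. apply Hc; lra.
  - exists (- z). split; [lra |]. split; auto. intros x Hx. rewrite <- (Ropp_involutive x). apply Hz3. lra.
Qed.

(** A zero at x0 and the bound v rule out infinite values of [Lub_Rbar], so [real] returns the
    actual supremum. *)
Lemma omega_between (n k : nat) (u v x0 : R) : u <= x0 -> chebF n (S k) x0 = 0 ->
  (forall x, v < x -> chebF n (S k) x <> 0) -> u <= omega n k <= v.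
Proof.
  intros Hu Hx0 Hv. unfold omega.
  set (E := fun x => chebD n (S k) x = 0).
  destruct (Lub_Rbar_correct E) as [H1 H2].
  assert (Hx : Rbar_le x0 (Lub_Rbar E)). { apply H1. unfold E. now rewrite chebD_chebF. }
  assert (Hy : Rbar_le (Lub_Rbar E) v).
  { apply H2. intros x. unfold E. rewrite chebD_chebF. intros Hxz. simpl.
    apply Rnot_lt_le. intros Hl. now apply (Hv x). }
  destruct (Lub_Rbar E); simpl in *; try tauto. lra.
Qed.

Lemma decreasing_sign (g : R -> R) (x l eta : R) : is_derive g x l -> l < 0 -> g x = 0 -> 0 < eta ->
  (exists y, x < y < x + eta /\ g y < 0) /\ (exists y, x - eta < y < x /\ 0 < g y).
Proof.
  intros Hd Hl Hg Heta. apply is_derive_Reals in Hd.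
  destruct (Hd (- l / 2) ltac:(lra)) as [d Hd']. pose proof (cond_pos d).
  set (h := Rmin (d / 2) (eta / 2)).
  assert (0 < h) by (apply Rmin_glb_lt; lra).
  pose proof (Rmin_l (d / 2) (eta / 2)). pose proof (Rmin_r (d / 2) (eta / 2)). fold h in H1, H2.
  assert (Hh : forall e, e <> 0 -> Rabs e = h -> g (x + e) / e < 0).
  { intros e He Hae. specialize (Hd' e He ltac:(rewrite Hae; lra)).
    rewrite Hg, Rminus_0_r in Hd'. apply Rabs_def2 in Hd'. lra. }
  split.
  - exists (x + h). split. lra. specialize (Hh h ltac:(lra) (Rabs_pos_eq h ltac:(lra))).
    replace (g (x + h)) with (g (x + h) / h * h) by (field; lra). nra.
  - exists (x + - h). split. lra. specialize (Hh (- h) ltac:(lra) ltac:(rewrite Rabs_Ropp; apply Rabs_pos_eq; lra)).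
    replace (g (x + - h)) with (g (x + - h) / - h * - h) by (field; lra). nra.
Qed.

(** Rolle: the derivative of Phi k is a multiple of Phi (k + 1), so zeros beyond every A are
    inherited from the cosine. *)
Lemma Phi_zero_beyond (k : nat) : forall A, exists X, A < X /\ Phi k X = 0.
Proof.
  induction k; intros A.
  - destruct (nfloor_ex (Rmax A 0) (Rmax_r A 0)) as [N [_ HN]]. pose proof (Rmax_l A 0). pose proof (pos_INR N).
    exists ((PI / 2 + 2 * INR (S N) * PI) ^ 2 / 4). rewrite Phi_0_cos, cos_period, cos_PI2. split; auto.
    pose proof PI2_3_2. rewrite S_INR in *. set (z := PI / 2 + 2 * (INR N + 1) * PI).
    assert (6 * (INR N + 1) <= 2 * (INR N + 1) * PI) by nra.
    assert (6 * (INR N + 1) <= z) by (unfold z; lra). nra.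
  - destruct (IHk A) as [a [Ha Ha0]]. destruct (IHk a) as [b [Hb Hb0]].
    pose proof (pos_INR k).
    destruct (MVT_gen (Phi k) a b (fun y => - (Phi (S k) y / (INR k + 1 / 2)))) as [c [Hc E]].
    + intros; apply is_derive_Phi.
    + intros x _. apply continuity_pt_filterlim, (is_derive_cont _ _ _ (is_derive_Phi k x)).
    + rewrite Rmin_left, Rmax_right in Hc by lra. exists c. split; [lra |].
      rewrite Ha0, Hb0 in E.
      assert (E' : - (Phi (S k) c / (INR k + 1 / 2)) = 0).
      { apply Rmult_eq_reg_r with (b - a); lra. }
      replace (Phi (S k) c) with (- - (Phi (S k) c / (INR k + 1 / 2)) * (INR k + 1 / 2)) by (field; lra).
      rewrite E'. ring.
Qed.

(** Two consecutive functions vanishing at X would make all later ones vanish there by the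
    recurrence, whereas Phi j X tends to 1. *)
Lemma Phi_simple_zero (k : nat) (X : R) : Phi k X = 0 -> Phi (S k) X <> 0.
Proof.
  intros H0 H1.
  assert (H : forall j, Phi (k + j) X = 0 /\ Phi (S (k + j)) X = 0).
  { assert (HX : X <> 0). { intros ->. rewrite Phi_0 in H0. lra. }
    induction j as [| j [IH1 IH2]]. rewrite Nat.add_0_r; auto.
    rewrite Nat.add_succ_r. split; auto.
    pose proof (Phi_recurrence (k + j) X) as E. rewrite IH1, IH2 in E.
    pose proof (pos_INR (k + j)).
    replace (Phi (S (S (k + j))) X) with ((X * Phi (S (S (k + j))) X / ((INR (k + j) + 1 / 2) * (INR (k + j) + 3 / 2))) *
      ((INR (k + j) + 1 / 2) * (INR (k + j) + 3 / 2)) / X) by (field; repeat split; auto; lra).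
    replace (X * Phi (S (S (k + j))) X / ((INR (k + j) + 1 / 2) * (INR (k + j) + 3 / 2))) with 0 by lra.
    unfold Rdiv; ring. }
  (* By the mean value theorem |Phi j X - 1| <= |X| e^|X| / (j + 1/2), so any j above |X| e^|X|
     gives the contradiction. *)
  destruct (nfloor_ex (Rabs X * exp (Rabs X)) ltac:(apply Rmult_le_pos; [apply Rabs_pos | left; apply exp_pos])) as [N [_ HN]].
  set (j := (k + S N)%nat).
  destruct (H (S N)) as [Hj _]. fold j in Hj.
  assert (Hjb : INR N + 1 <= INR j). { unfold j. rewrite plus_INR, S_INR. pose proof (pos_INR k). lra. }
  pose proof (pos_INR N).
  destruct (MVT_gen (Phi j) 0 X (fun y => - (Phi (S j) y / (INR j + 1 / 2)))) as [c [Hc E]].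
  - intros; apply is_derive_Phi.
  - intros x _. apply continuity_pt_filterlim, (is_derive_cont _ _ _ (is_derive_Phi j x)).
  - rewrite Hj, Phi_0 in E.
    assert (Hcb : Rabs c <= Rabs X).
    { unfold Rmin, Rmax in Hc. unfold Rabs. destruct (Rle_dec 0 X), (Rcase_abs c), (Rcase_abs X); lra. }
    pose proof (Phi_bound (S j) c ltac:(lia)) as Hb.
    assert (Rabs (Phi (S j) c) <= exp (Rabs X)) by (eapply Rle_trans; [apply Hb | now apply exp_le]).
    assert (Rabs (Phi (S j) c * X) <= Rabs X * exp (Rabs X)).
    { rewrite Rabs_mult, Rmult_comm. apply Rmult_le_compat_l; auto. apply Rabs_pos. }
    apply Rabs_le_between in H4.
    assert (Phi (S j) c * X = INR j + 1 / 2).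
    { replace (Phi (S j) c * X) with (- (- (Phi (S j) c / (INR j + 1 / 2)) * (X - 0)) * (INR j + 1 / 2)) by (field; lra).
      rewrite <- E. ring. }
    lra.
Qed.

Definition is_first_zero (g : R -> R) (z : R) : Prop := 0 < z /\ g z = 0 /\ forall x, 0 <= x < z -> 0 < g x.

Lemma Phi_cont (k : nat) (x : R) : continuous (Phi k) x.
Proof. apply (is_derive_cont _ _ _ (is_derive_Phi k x)). Qed.

Lemma Phi_first_zero (k : nat) : exists z, is_first_zero (Phi k) z.
Proof.
  destruct (Phi_zero_beyond k 0) as [b [Hb Hb0]].
  destruct (first_zero (Phi k) b Hb (fun x _ => Phi_cont k x)) as [z [Hz1 [Hz2 Hz3]]].
  - rewrite Phi_0; lra.
  - lra.
  - exists z. repeat split; auto; lra.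
Qed.

(** Simplicity excludes a tangential zero, and positivity before X excludes an increasing
    crossing. *)
Lemma Phi_first_zero_sign (k : nat) (X eta : R) : is_first_zero (Phi k) X -> 0 < eta ->
  exists y, X < y < X + eta /\ Phi k y < 0.
Proof.
  intros [HX [HX0 HXp]] Heta.
  pose proof (is_derive_Phi k X) as Hd. pose proof (Phi_simple_zero k X HX0) as Hs.
  set (l := - (Phi (S k) X / (INR k + 1 / 2))) in *.
  pose proof (pos_INR k).
  destruct (Rtotal_order l 0) as [Hl | [Hl | Hl]].
  - now apply (decreasing_sign (Phi k) X l eta).
  - exfalso. apply Hs.
    replace (Phi (S k) X) with (- l * (INR k + 1 / 2)) by (unfold l; field; lra). rewrite Hl; ring.
  - exfalso. destruct (decreasing_sign (fun x => - Phi k x) X (- l) X) as [_ [y [Hy1 Hy2]]]; try lra.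
    apply is_derive_Ropp; auto.
    specialize (HXp y ltac:(lra)). lra.
Qed.

Lemma min_on_segment (g : R -> R) (a b : R) : a <= b -> (forall x, continuous g x) ->
  (forall x, a <= x <= b -> 0 < g x) -> exists c, 0 < c /\ forall x, a <= x <= b -> c <= g x.
Proof.
  intros Hab Hc Hp.
  destruct (continuity_ab_min g a b Hab) as [mx [H1 H2]].
  - intros c _. apply continuity_pt_filterlim, Hc.
  - exists (g mx). split; auto.
Qed.

Lemma inv_square_lim (C : R) : is_lim_seq (fun n => C / INR n ^ 2) 0.
Proof.
  replace 0 with (C * 0) by ring. apply (is_lim_seq_scal_l _ C (Finite 0)).
  apply (is_lim_seq_inv _ p_infty); [| discriminate].
  apply is_lim_seq_ext with (fun n => INR n * INR n). intros; ring.
  apply (is_lim_seq_mult _ _ p_infty p_infty p_infty); try apply is_lim_seq_INR. reflexivity.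
Qed.

Lemma chebF_pos_above_1 (n k : nat) (x : R) : (k <= n)%nat -> 1 <= x -> 0 < chebF n k x.
Proof.
  intros Hk Hx. apply chebF_pos_above with 1; auto. intros j Hj. apply chebF_1_pos. lia.
Qed.

(** In x = 1 - 2 y / n^2 the largest zero corresponds to the smallest y. A uniform lower bound on
    [0, X - eta] excludes y below X - eta, and a negative value at X1 < X + eta forces a zero before
    X1; continuity of Phi k then gives the limit. *)
Lemma tau_limit_k (k : nat) (X : R) : (1 <= k)%nat -> is_first_zero (Phi (S k)) X ->
  is_lim_seq (fun n => tau n k) (Rabs (Phi k X)).
Proof.
  intros Hk HX. pose proof HX as [HXpos [HX0 HXp]].
  apply is_lim_seq_spec. intros eps. pose proof (cond_pos eps) as He.
  destruct (proj1 (continuity_pt_locally (Phi k) X) (proj2 (continuity_pt_filterlim _ _) (Phi_cont k X))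
     (mkposreal (eps / 2) ltac:(lra))) as [d Hd]. simpl in Hd. pose proof (cond_pos d).
  set (eta := Rmin (d / 2) (Rmin (X / 2) 1)).
  assert (Heta : 0 < eta) by (repeat apply Rmin_glb_lt; lra).
  assert (Heta1 : eta <= d / 2) by apply Rmin_l.
  assert (Heta2 : eta <= X / 2 /\ eta <= 1).
  { unfold eta. pose proof (Rmin_r (d / 2) (Rmin (X / 2) 1)).
    pose proof (Rmin_l (X / 2) 1). pose proof (Rmin_r (X / 2) 1). lra. }
  destruct (min_on_segment (Phi (S k)) 0 (X - eta)) as [c [Hc Hmin]]; try lra.
  { apply Phi_cont. } { intros; apply HXp; lra. }
  destruct (Phi_first_zero_sign (S k) X eta HX Heta) as [X1 [HX1 HX1n]].
  set (C := fun j => (INR j + 1) ^ 2 * exp (8 * (X + 1))).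
  pose proof (inv_square_lim (C k)) as L0. pose proof (inv_square_lim (C (S k))) as L1.
  apply is_lim_seq_spec in L0. apply is_lim_seq_spec in L1.
  destruct (L0 (mkposreal (eps / 2) ltac:(lra))) as [N0 HN0].
  assert (Hc' : 0 < Rmin c (- Phi (S k) X1)) by (apply Rmin_glb_lt; lra).
  destruct (L1 (mkposreal _ Hc')) as [N1 HN1].
  pose proof (Rmin_l c (- Phi (S k) X1)). pose proof (Rmin_r c (- Phi (S k) X1)).
  exists (max (S k) (max N0 N1)). intros n Hn.
  specialize (HN0 n ltac:(lia)). specialize (HN1 n ltac:(lia)). simpl pos in HN0, HN1.
  rewrite Rminus_0_r in HN0, HN1.
  apply Rle_lt_trans with (1 := Rle_abs _) in HN0. apply Rle_lt_trans with (1 := Rle_abs _) in HN1.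
  assert (HN : 1 <= INR n) by (apply (le_INR 1); lia).
  assert (Hn2 : 0 < INR n ^ 2) by nra.
  assert (Herr : forall j y, (1 <= j <= n)%nat -> 0 <= y <= X + 1 ->
    Rabs (chebF n j (1 - 2 * y / INR n ^ 2) / chebF n j 1 - Phi j y) <= C j / INR n ^ 2).
  { intros j y Hj Hy. eapply Rle_trans. apply cheb_to_Phi; auto.
    apply Rmult_le_compat_r. left; now apply Rinv_0_lt_compat.
    apply Rmult_le_compat_l. apply pow2_ge_0. apply exp_le. rewrite Rabs_pos_eq; lra. }
  pose proof (chebF_1_pos n (S k) ltac:(lia)) as HF1.
  assert (Hsgn : forall y, chebF n (S k) (1 - 2 * y / INR n ^ 2) = chebF n (S k) (1 - 2 * y / INR n ^ 2) / chebF n (S k) 1 * chebF n (S k) 1).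
  { intros y. field. lra. }
  assert (Hpos : forall y, 0 <= y <= X - eta -> 0 < chebF n (S k) (1 - 2 * y / INR n ^ 2)).
  { intros y Hy. specialize (Herr (S k) y ltac:(lia) ltac:(lra)). apply Rabs_le_between in Herr.
    specialize (Hmin y Hy). rewrite Hsgn. apply Rmult_lt_0_compat; lra. }
  assert (Hneg : chebF n (S k) (1 - 2 * X1 / INR n ^ 2) < 0).
  { specialize (Herr (S k) X1 ltac:(lia) ltac:(lra)). apply Rabs_le_between in Herr.
    rewrite Hsgn. assert (chebF n (S k) (1 - 2 * X1 / INR n ^ 2) / chebF n (S k) 1 < 0) by lra. nra. }
  destruct (last_zero (chebF n (S k)) (1 - 2 * X1 / INR n ^ 2) 1) as [x0 [Hx0 [Hx0z _]]]; try lra.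
  { assert (0 < 2 * X1 / INR n ^ 2) by (apply Rdiv_lt_0_compat; lra). lra. }
  { intros x _. apply (is_derive_cont _ _ _ (is_derive_chebF n (S k) x)). }
  destruct (omega_between n k (1 - 2 * X1 / INR n ^ 2) (1 - 2 * (X - eta) / INR n ^ 2) x0) as [Ho1 Ho2]; try lra.
  { intros x Hx. apply Rgt_not_eq. destruct (Rle_dec 1 x).
    - apply chebF_pos_above_1; auto; lia.
    - replace x with (1 - 2 * ((1 - x) * INR n ^ 2 / 2) / INR n ^ 2) by (field; lra).
      apply Hpos. split. apply Rmult_le_pos; [apply Rmult_le_pos; lra | lra].
      apply Rmult_le_reg_r with (2 / INR n ^ 2). apply Rdiv_lt_0_compat; lra.
      replace ((1 - x) * INR n ^ 2 / 2 * (2 / INR n ^ 2)) with (1 - x) by (field; lra).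
      replace ((X - eta) * (2 / INR n ^ 2)) with (2 * (X - eta) / INR n ^ 2) by (field; lra). lra. }
  set (y := (1 - omega n k) * INR n ^ 2 / 2).
  assert (Ey : omega n k = 1 - 2 * y / INR n ^ 2) by (unfold y; field; lra).
  assert (Hy : X - eta <= y <= X1).
  { rewrite Ey in Ho1, Ho2.
    split; apply Rmult_le_reg_r with (2 / INR n ^ 2); try (apply Rdiv_lt_0_compat; lra).
    - replace ((X - eta) * (2 / INR n ^ 2)) with (2 * (X - eta) / INR n ^ 2) by (field; lra).
      replace (y * (2 / INR n ^ 2)) with (2 * y / INR n ^ 2) by (field; lra). lra.
    - replace (X1 * (2 / INR n ^ 2)) with (2 * X1 / INR n ^ 2) by (field; lra).
      replace (y * (2 / INR n ^ 2)) with (2 * y / INR n ^ 2) by (field; lra). lra. }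
  specialize (Herr k y ltac:(lia) ltac:(lra)).
  specialize (Hd y). assert (Hyd : Rabs (y - X) < d) by (apply Rabs_def1; lra). specialize (Hd Hyd).
  unfold tau. rewrite !chebD_chebF, Ey.
  pose proof (chebF_1_pos n k ltac:(lia)) as HFk.
  rewrite <- (Rabs_pos_eq (chebF n k 1)) at 1 by lra. rewrite <- Rabs_div by lra.
  eapply Rle_lt_trans. apply Rabs_triang_inv2.
  replace (_ - _) with ((chebF n k (1 - 2 * y / INR n ^ 2) / chebF n k 1 - Phi k y) + (Phi k y - Phi k X)) by ring.
  eapply Rle_lt_trans. apply Rabs_triang. lra.
Qed.

(** * The Hermite limit *)

(* [he m = H_m / (2^m m!)] in terms of the physicists' Hermite polynomials. *)
Fixpoint he (m : nat) (t : R) : R :=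
  match m with
  | O => 1
  | S m' =>
    match m' with
    | O => t
    | S m'' => (2 * t * he m' t - he m'' t) / (2 * (INR m'' + 2))
    end
  end.

Lemma he_SS (m : nat) (t : R) : he (S (S m)) t = (2 * t * he (S m) t - he m t) / (2 * (INR m + 2)).
Proof. reflexivity. Qed.

Lemma is_derive_he (m : nat) (t : R) : is_derive (he (S m)) t (he m t).
Proof.
  induction m as [| | m IH1 IH2] using nat_ind2.
  - simpl. auto_derive; auto.
  - simpl. auto_derive; auto. field.
  - pose proof (pos_INR m).
    apply is_derive_ext with (fun t => / (2 * (INR (S m) + 2)) * (2 * t * he (S (S m)) t - he (S m) t)).
    { intros x. rewrite (he_SS (S m)), S_INR. eq_in_R. field. lra. }
    replace (he (S (S m)) t) with (/ (2 * (INR (S m) + 2)) * ((2 * he (S (S m)) t + 2 * t * he (S m) t) - he m t)).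
    2:{ rewrite S_INR. replace (2 * t * he (S m) t) with (2 * (INR m + 2) * he (S (S m)) t + he m t) by (rewrite he_SS; field; lra).
        field. lra. }
    apply (is_derive_scal (fun t => 2 * t * he (S (S m)) t - he (S m) t)).
    apply is_derive_Rminus; auto.
    apply (is_derive_Rmult (fun t => 2 * t)); auto. auto_derive; auto; ring.
Qed.

Lemma he_cont (m : nat) (t : R) : continuous (he m) t.
Proof. destruct m. apply continuous_const. apply (is_derive_cont _ _ _ (is_derive_he m t)). Qed.

Definition is_largest_zero (g : R -> R) (z : R) : Prop := g z = 0 /\ forall t, z < t -> 0 < g t.

(** The induction carries positivity of all lower degrees from h on. At the largest zero h of
    [he (S p)] the recurrence makes [he (S (S p))] negative; beyond h that function increases, with
    slope at least c after h + 1, so it crosses zero once. *)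
Lemma he_largest_zero (p : nat) : exists h, is_largest_zero (he (S p)) h /\ forall j t, (j <= p)%nat -> h <= t -> 0 < he j t.
Proof.
  induction p as [| p [h [[Hh Hhp] Hj]]].
  - exists 0. split; [split |]; simpl; auto. intros j t H _. replace j with 0%nat by lia. simpl; lra.
  - pose proof (pos_INR p).
    assert (Hneg : he (S (S p)) h < 0).
    { rewrite he_SS, Hh. specialize (Hj p h ltac:(lia) ltac:(lra)).
      unfold Rdiv. assert (0 < / (2 * (INR p + 2))) by (apply Rinv_0_lt_compat; lra). nra. }
    assert (Hinc : forall a b, h <= a <= b -> he (S (S p)) a <= he (S (S p)) b).
    { intros a b Hab. apply (le_of_derive_nonneg _ (he (S p))); try lra.
      - intros; apply is_derive_he.
      - intros x Hx. destruct (Rle_lt_or_eq_dec h x ltac:(lra)) as [Hl | <-]. left; auto. lra. }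
    set (c := he (S p) (h + 1)). assert (Hc : 0 < c) by (apply Hhp; lra).
    set (v := he (S (S p)) (h + 1)) in *.
    set (b := h + 1 + Rabs (1 - v) / c).
    assert (Hbc : c * (b - (h + 1)) = Rabs (1 - v)) by (unfold b; field; lra).
    assert (Hb : h + 1 <= b).
    { assert (0 <= Rabs (1 - v) / c) by (apply Rmult_le_pos; [apply Rabs_pos | left; now apply Rinv_0_lt_compat]).
      unfold b; lra. }
    assert (Hbpos : 0 < he (S (S p)) b).
    { assert (c * (b - (h + 1)) + v <= he (S (S p)) b).
      { apply (le_of_derive_le (fun x => c * (x - (h + 1)) + v) (fun _ => c) (he (S (S p))) (he (S p)) (h + 1) b); auto.
        - intros x _. auto_derive; auto; ring.
        - intros; apply is_derive_he.
        - intros x Hx. unfold c. apply (le_of_derive_nonneg _ (he p)); try lra.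
          + intros; apply is_derive_he.
          + intros y Hy. left; apply Hj; auto; lra.
        - rewrite Rminus_diag. unfold v. lra. }
      pose proof (Rle_abs (1 - v)). lra. }
    destruct (last_zero (he (S (S p))) h b) as [z [Hz1 [Hz2 Hz3]]]; try lra.
    { intros; apply he_cont. }
    assert (Hhz : h < z). { destruct (Rle_lt_or_eq_dec h z ltac:(lra)) as [|E]; auto. rewrite <- E in Hz2. lra. }
    exists z. repeat split; auto.
    + intros t Ht. destruct (Rle_dec t b). apply Hz3; lra.
      apply Rlt_le_trans with (1 := Hbpos). apply Hinc; lra.
    + intros j t Hjp Ht. destruct (Nat.eq_dec j (S p)) as [-> |]. apply Hhp; lra. apply Hj; [lia | lra].
Qed.

(** The scaling makes [cheb_e n 0] equal to 1: [chebF n n] is a constant function, and each further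
    integration in t gains a factor sqrt n. It is used with m <= n, where n - m is a true
    difference. *)
Definition cheb_e (n m : nat) (t : R) : R := chebF n (n - m) (t / sqrt (INR n)) * sqrt (INR n) ^ m / chebF n n 0.

Lemma cheb_e_0 (n : nat) (t : R) : cheb_e n 0 t = 1.
Proof.
  unfold cheb_e. rewrite Nat.sub_0_r. destruct (chebF_diag n) as [H ->]. simpl. field. lra.
Qed.

Lemma cheb_e_1 (n : nat) (t : R) : (1 <= n)%nat -> cheb_e n 1 t = t.
Proof.
  intros Hn. unfold cheb_e. destruct (chebF_diag n) as [H H'].
  pose proof (chebF_ode n (n - 1) (t / sqrt (INR n))) as E.
  replace (S (n - 1)) with n in E by lia. rewrite chebF_gt, H' in E by lia.
  rewrite minus_INR in E by lia. simpl (INR 1) in E.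
  apply (le_INR 1) in Hn. simpl (INR 1) in Hn.
  assert (Hs : 0 < sqrt (INR n)) by (apply sqrt_lt_R0; lra).
  replace (chebF n (n - 1) (t / sqrt (INR n))) with (t / sqrt (INR n) * chebF n n 0).
  - field. lra.
  - apply Rmult_eq_reg_l with (2 * INR n - 1); lra.
Qed.

(** The equation of order k = n - m - 2, where n^2 - k^2 = (m + 2) (2 n - m - 2), read as a
    recurrence in m. After division by n its coefficients visibly tend to those of [he]. *)
Lemma cheb_e_SS (n m : nat) (t : R) : (m + 2 <= n)%nat ->
  cheb_e n (S (S m)) t =
    ((2 - (2 * INR m + 3) * / INR n) * t * cheb_e n (S m) t - (1 - t ^ 2 * / INR n) * cheb_e n m t) /
    ((INR m + 2) * (2 - (INR m + 2) * / INR n)).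
Proof.
  intros Hn. unfold cheb_e. destruct (chebF_diag n) as [H _].
  pose proof (chebF_ode n (n - S (S m)) (t / sqrt (INR n))) as E.
  replace (S (n - S (S m))) with (n - S m)%nat in E by lia.
  replace (S (n - S m)) with (n - m)%nat in E by lia.
  rewrite minus_INR in E by lia. rewrite !S_INR in E.
  pose proof (le_INR _ _ Hn) as Hn'. rewrite plus_INR in Hn'. simpl (INR 2) in Hn'. pose proof (pos_INR m).
  set (r := sqrt (INR n)) in *. assert (Hr : 0 < r) by (apply sqrt_lt_R0; lra).
  assert (En : INR n = r ^ 2) by (unfold r; rewrite pow2_sqrt; lra).
  set (N := INR n) in *.
  set (F2 := chebF n (n - S (S m)) (t / r)) in *. set (F1 := chebF n (n - S m) (t / r)) in *. set (F0 := chebF n (n - m) (t / r)) in *.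
  assert (E' : (INR m + 2) * (2 * N - (INR m + 2)) * F2 = (2 * N - 2 * INR m - 3) * (t / r) * F1 - (1 - (t / r) ^ 2) * F0) by lra.
  replace (F2 * r ^ S (S m) / chebF n n 0) with
    (((INR m + 2) * (2 * N - (INR m + 2)) * F2) * r ^ S (S m) / chebF n n 0 / ((INR m + 2) * (2 * N - (INR m + 2)))) by (field; lra).
  rewrite E'. simpl pow. rewrite En in *. field. repeat split; try lra; nra.
Qed.

Lemma inv_INR_lim : is_lim_seq (fun n => / INR n) 0.
Proof. apply (is_lim_seq_inv _ p_infty); [apply is_lim_seq_INR | discriminate]. Qed.

(** The argument may move with n because it will be the rescaled zero [omega]. *)
Lemma cheb_e_lim (m : nat) : forall (u : nat -> R) (t : R), is_lim_seq u t ->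
  is_lim_seq (fun n => cheb_e n m (u n)) (he m t).
Proof.
  induction m as [| | m IH1 IH2] using nat_ind2; intros u t Hu.
  - apply is_lim_seq_ext with (fun _ => 1). intros; now rewrite cheb_e_0. apply is_lim_seq_const.
  - apply is_lim_seq_ext_loc with u; auto. exists 1%nat. intros; now rewrite cheb_e_1.
  - pose proof inv_INR_lim as L. pose proof (pos_INR m).
    apply is_lim_seq_ext_loc with (fun n => ((2 - (2 * INR m + 3) * / INR n) * u n * cheb_e n (S m) (u n) - (1 - u n ^ 2 * / INR n) * cheb_e n m (u n)) /
    ((INR m + 2) * (2 - (INR m + 2) * / INR n))).
    { exists (m + 2)%nat. intros n Hn. now rewrite cheb_e_SS. }
    rewrite he_SS.
    replace ((2 * t * he (S m) t - he m t) / (2 * (INR m + 2))) with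
      (((2 - (2 * INR m + 3) * 0) * t * he (S m) t - (1 - t ^ 2 * 0) * he m t) / ((INR m + 2) * (2 - (INR m + 2) * 0))) by (field; lra).
    apply is_lim_seq_div'.
    + apply is_lim_seq_minus'; apply is_lim_seq_mult'; auto.
      * apply is_lim_seq_mult'; auto. apply is_lim_seq_minus'. apply is_lim_seq_const. apply is_lim_seq_mult'; auto. apply is_lim_seq_const.
      * apply is_lim_seq_minus'. apply is_lim_seq_const. apply is_lim_seq_mult'; auto.
        apply is_lim_seq_ext with (fun n => u n * u n). intros; ring. replace (t ^ 2) with (t * t) by ring. now apply is_lim_seq_mult'.
    + apply is_lim_seq_mult'. apply is_lim_seq_const. apply is_lim_seq_minus'. apply is_lim_seq_const. apply is_lim_seq_mult'; auto. apply is_lim_seq_const.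
    + rewrite Rmult_0_r. nra.
Qed.

(** In the scaling of [cheb_e] the point x = 1 runs off to infinity, so this limit is taken directly
    from the two-term relation at 1. *)
Lemma cheb_ratio_1_lim (m : nat) : is_lim_seq (fun n => chebF n (n - m) 1 / chebF n n 0) (/ INR (fact m)).
Proof.
  induction m.
  - apply is_lim_seq_ext with (fun _ => / INR (fact 0)). 2: apply is_lim_seq_const.
    intros n. rewrite Nat.sub_0_r. destruct (chebF_diag n) as [H ->]. simpl. field. lra.
  - pose proof inv_INR_lim as L. pose proof (pos_INR m). pose proof (INR_fact_neq_0 m).
    apply is_lim_seq_ext_loc with (fun n => chebF n (n - m) 1 / chebF n n 0 * ((2 - (2 * INR m + 1) * / INR n) / ((INR m + 1) * (2 - (INR m + 1) * / INR n)))).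
    { exists (S m). intros n Hn.
      pose proof (chebF_1_S n (n - S m)) as E. replace (S (n - S m)) with (n - m)%nat in E by lia.
      rewrite minus_INR in E by lia. rewrite S_INR in E.
      pose proof (le_INR _ _ Hn) as Hn'. rewrite S_INR in Hn'. destruct (chebF_diag n) as [Hd _].
      replace (chebF n (n - S m) 1) with ((2 * (INR n - (INR m + 1)) + 1) * chebF n (n - m) 1 / (INR n ^ 2 - (INR n - (INR m + 1)) ^ 2)).
      field. repeat split; try lra; nra.
      rewrite <- E. field. nra. }
    rewrite fact_simpl, mult_INR, S_INR, Rinv_mult, (Rmult_comm (/ (INR m + 1))).
    replace (/ (INR m + 1)) with ((2 - (2 * INR m + 1) * 0) / ((INR m + 1) * (2 - (INR m + 1) * 0))) by (field; lra).
    apply is_lim_seq_mult'; auto.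
    apply is_lim_seq_div'.
    + apply is_lim_seq_minus'. apply is_lim_seq_const. apply is_lim_seq_mult'; auto. apply is_lim_seq_const.
    + apply is_lim_seq_mult'. apply is_lim_seq_const. apply is_lim_seq_minus'. apply is_lim_seq_const. apply is_lim_seq_mult'; auto. apply is_lim_seq_const.
    + rewrite Rmult_0_r. nra.
Qed.

Lemma eventually_pos (u : nat -> R) (l : R) : is_lim_seq u l -> 0 < l -> eventually (fun n => 0 < u n).
Proof.
  intros H Hl. apply is_lim_seq_spec in H. destruct (H (mkposreal l Hl)) as [N HN].
  exists N. intros n Hn. specialize (HN n Hn). simpl in HN. apply Rabs_def2 in HN. lra.
Qed.

Lemma chebF_cheb_e (n m : nat) (x : R) : (1 <= n)%nat ->
  chebF n (n - m) x = cheb_e n m (x * sqrt (INR n)) * chebF n n 0 / sqrt (INR n) ^ m.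
Proof.
  intros Hn. apply (le_INR 1) in Hn. simpl in Hn.
  assert (Hs : 0 < sqrt (INR n)) by (apply sqrt_lt_R0; lra).
  unfold cheb_e. replace (x * sqrt (INR n) / sqrt (INR n)) with x by (field; lra).
  destruct (chebF_diag n) as [H _]. field. split; [lra | apply pow_nonzero; lra].
Qed.

(** Above: at h + eta all [cheb_e n j] with j <= p + 1 are eventually positive, so [chebF_pos_above]
    excludes zeros to the right. Below: [he (S p)] is negative at some t1 in (h - eta, h). *)
Lemma omega_scaled_lim (p : nat) (h : R) : is_largest_zero (he (S p)) h ->
  (forall j t, (j <= p)%nat -> h <= t -> 0 < he j t) ->
  is_lim_seq (fun n => omega n (n - S (S p)) * sqrt (INR n)) h.
Proof.
  intros [Hh Hhp] Hj. apply is_lim_seq_spec. intros eps. pose proof (cond_pos eps).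
  set (eta := eps / 2).
  assert (Hup : eventually (fun n => forall j, (j <= S p)%nat -> 0 < cheb_e n j (h + eta))).
  { assert (H1 : forall q, (q <= S p)%nat -> eventually (fun n => forall j, (j <= q)%nat -> 0 < cheb_e n j (h + eta))).
    { assert (Hq : forall q, (q <= S p)%nat -> eventually (fun n => 0 < cheb_e n q (h + eta))).
      { intros q Hq. apply eventually_pos with (he q (h + eta)).
        - apply cheb_e_lim with (u := fun _ => h + eta). apply is_lim_seq_const.
        - destruct (Nat.eq_dec q (S p)) as [-> |]. apply Hhp; unfold eta; lra. apply Hj. lia. unfold eta; lra. }
      induction q as [| q IHq]; intros Hqp.
      - destruct (Hq 0%nat ltac:(lia)) as [N HN]. exists N. intros n Hn j Hj0. replace j with 0%nat by lia. auto.
      - destruct (Hq (S q) Hqp) as [N HN]. destruct (IHq ltac:(lia)) as [N' HN']. exists (max N N').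
        intros n Hn j Hjq. destruct (Nat.eq_dec j (S q)) as [-> |]. apply HN; lia. apply HN'; lia. }
    apply H1; lia. }
  destruct (decreasing_sign (fun t => - he (S p) t) h (- he p h) eta) as [_ [t1 [Ht1 Ht1n]]].
  { apply is_derive_Ropp. apply is_derive_he. }
  { specialize (Hj p h ltac:(lia) ltac:(lra)). lra. }
  { lra. }
  { unfold eta; lra. }
  assert (Hdn : eventually (fun n => 0 < - cheb_e n (S p) t1)).
  { apply eventually_pos with (- he (S p) t1); auto.
    apply (is_lim_seq_opp (fun n => cheb_e n (S p) t1) (Finite _)).
    apply cheb_e_lim with (u := fun _ => t1). apply is_lim_seq_const. }
  destruct Hup as [N1 H1]. destruct Hdn as [N2 H2].
  exists (max (S (S p)) (max N1 N2)). intros n Hn.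
  specialize (H1 n ltac:(lia)). specialize (H2 n ltac:(lia)).
  assert (Hn1 : (1 <= n)%nat) by lia.
  pose proof (le_INR _ _ Hn1) as HN. simpl in HN.
  assert (Hs : 0 < sqrt (INR n)) by (apply sqrt_lt_R0; lra).
  set (r := sqrt (INR n)) in *.
  destruct (chebF_diag n) as [Hd _].
  assert (Hsg : forall m t, chebF n (n - m) (t / r) = cheb_e n m t * (chebF n n 0 / r ^ m)).
  { intros m t. rewrite (chebF_cheb_e n m) by auto. fold r. replace (t / r * r) with t by (field; lra). unfold Rdiv; ring. }
  assert (Hcp : forall m, 0 < chebF n n 0 / r ^ m) by (intros; apply Rdiv_lt_0_compat; auto; now apply pow_lt).
  assert (Hpos : forall x, (h + eta) / r <= x -> 0 < chebF n (n - S p) x).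
  { apply chebF_pos_above. lia. intros j Hjn. replace j with (n - (n - j))%nat by lia.
    rewrite Hsg. apply Rmult_lt_0_compat; auto. apply H1. lia. }
  assert (Hneg : chebF n (n - S p) (t1 / r) < 0).
  { rewrite Hsg. specialize (Hcp (S p)). nra. }
  destruct (last_zero (chebF n (n - S p)) (t1 / r) ((h + eta) / r)) as [x0 [Hx0 [Hx0z _]]].
  - apply Rmult_lt_compat_r. now apply Rinv_0_lt_compat. unfold eta in *; lra.
  - intros x _. apply (is_derive_cont _ _ _ (is_derive_chebF n (n - S p) x)).
  - lra.
  - apply Hpos; lra.
  - destruct (omega_between n (n - S (S p)) (t1 / r) ((h + eta) / r) x0) as [Ho1 Ho2].
    + lra.
    + replace (S (n - S (S p))) with (n - S p)%nat by lia. auto.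
    + intros x Hx. replace (S (n - S (S p))) with (n - S p)%nat by lia. apply Rgt_not_eq, Hpos. lra.
    + apply Rmult_le_compat_r with (r := r) in Ho1; [| lra]. apply Rmult_le_compat_r with (r := r) in Ho2; [| lra].
      replace (t1 / r * r) with t1 in Ho1 by (field; lra). replace ((h + eta) / r * r) with (h + eta) in Ho2 by (field; lra).
      apply Rabs_def1; unfold eta in *; lra.
Qed.

(** Relative to the n-th derivative of T_n, the value at the zero has order n^(-m/2) while the value
    at 1 tends to 1/m!; hence the factors n^(m/2) and m!. *)
Lemma tau_limit_m (p : nat) (h : R) : is_largest_zero (he (S p)) h ->
  (forall j t, (j <= p)%nat -> h <= t -> 0 < he j t) ->
  is_lim_seq (fun n => sqrt (INR n) ^ (S (S p)) * tau n (n - S (S p))) (INR (fact (S (S p))) * Rabs (he (S (S p)) h)).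
Proof.
  intros Hh Hj.
  set (m := S (S p)).
  apply is_lim_seq_ext_loc with (fun n => / (chebF n (n - m) 1 / chebF n n 0) * Rabs (cheb_e n m (omega n (n - m) * sqrt (INR n)))).
  { exists m. intros n Hn. assert (Hn1 : (1 <= n)%nat) by lia.
    unfold tau. rewrite !chebD_chebF. rewrite (chebF_cheb_e n m (omega _ _)) by auto.
    pose proof (le_INR _ _ Hn1) as HN. simpl in HN.
    assert (Hs : 0 < sqrt (INR n)) by (apply sqrt_lt_R0; lra).
    assert (0 < sqrt (INR n) ^ m) by now apply pow_lt.
    destruct (chebF_diag n) as [Hd _]. pose proof (chebF_1_pos n (n - m) ltac:(lia)).
    unfold Rdiv at 3. rewrite !Rabs_mult, Rabs_inv, (Rabs_pos_eq (chebF n n 0)), (Rabs_pos_eq (sqrt (INR n) ^ m)) by lra.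
    field. lra. }
  pose proof (INR_fact_neq_0 m).
  apply is_lim_seq_mult'.
  - replace (INR (fact m)) with (/ / INR (fact m)) by (field; auto).
    apply (is_lim_seq_inv _ (Finite _)). apply cheb_ratio_1_lim.
    injection. now apply Rinv_neq_0_compat.
  - apply (is_lim_seq_abs _ (Finite _)). apply cheb_e_lim. now apply omega_scaled_lim.
Qed.

(** * Comparison with the Airy integral; Wallis and Stirling *)

(** The difference on [0, T] integrates to O(1/r) by [poly_gauss_le]; the missing Airy tail is at
    most a multiple of e^(-T) <= 1/T <= 1/(a r). *)
Lemma airy_integral_compare (A a : R) : 0 <= A -> 0 < a -> exists C, 0 <= C /\ forall r T F, 0 < r -> a * r <= T ->
  (forall x, continuous F x) ->
  (forall t, 0 <= t <= T -> Rabs (F t - airy_g0 0 t) <= A / r * ((1 + t + t ^ 2 + t ^ 3 + t ^ 4) * exp (- (/ 18 * t ^ 2)))) ->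
  Rabs (RInt F 0 T - airy_K0 0) <= C / r.
Proof.
  intros HA Ha. set (B := A * (24 * exp (/ / 18))).
  assert (HB : 0 <= B). { unfold B. pose proof (exp_pos (/ / 18)). apply Rmult_le_pos; lra. }
  assert (HC : 0 <= airy_C) by (unfold airy_C; pose proof (exp_pos (/ 1)); lra).
  exists (B + airy_C / a). split. { assert (0 <= airy_C / a) by (apply Rmult_le_pos; [lra | left; now apply Rinv_0_lt_compat]). lra. }
  intros r T F Hr HT Hc HF.
  assert (HT0 : 0 < T) by nra.
  assert (Hg : forall x, continuous (airy_g0 0) x) by apply airy_g0_dom.
  replace (RInt F 0 T - airy_K0 0) with ((1 * RInt F 0 T + (-1) * RInt (airy_g0 0) 0 T) - (RInt_oo (airy_g0 0) - RInt (airy_g0 0) 0 T)).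
  2:{ unfold airy_K0. ring. }
  eapply Rle_trans. apply Rabs_triang. rewrite Rabs_Ropp.
  replace ((B + airy_C / a) / r) with (B / r + airy_C / a / r) by (field; lra).
  apply Rplus_le_compat.
  - rewrite <- RInt_lin by auto.
    apply Rle_trans with (RInt (fun t => B / r * exp (- t)) 0 T).
    + apply RInt_abs_le; try lra.
      * intros x. apply continuous_lin; auto.
      * intros x. cont1.
      * intros t Ht. replace (1 * F t + -1 * airy_g0 0 t) with (F t - airy_g0 0 t) by ring.
        eapply Rle_trans. apply HF; auto.
        replace (B / r * exp (- t)) with (A / r * (24 * exp (/ / 18) * exp (- t))) by (unfold B; field; lra).
        apply Rmult_le_compat_l. apply Rmult_le_pos; [lra | left; now apply Rinv_0_lt_compat].
        apply poly_gauss_le; lra.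
    + rewrite RInt_exp_neg, Ropp_0, exp_0. pose proof (exp_pos (- T)).
      assert (0 <= B / r) by (apply Rmult_le_pos; [lra | left; now apply Rinv_0_lt_compat]). nra.
  - eapply Rle_trans. apply (RInt_oo_tail (airy_g0 0) airy_C T); auto; try lra. apply airy_g0_dom.
    unfold Rdiv. rewrite Rmult_assoc. apply Rmult_le_compat_l; auto.
    rewrite exp_Ropp, <- Rinv_mult. apply Rinv_le_contravar. nra.
    pose proof (exp_ge_1_plus T). lra.
Qed.

Lemma exp_cos_compare (A r t P Q : R) : 0 <= A -> 0 < r -> 0 <= t ->
  Rabs (P + t ^ 2) <= A / r * (1 + t + t ^ 2 + t ^ 3 + t ^ 4) ->
  Rabs (Q - (t ^ 3 / 3 - t)) <= A / r * (1 + t + t ^ 2 + t ^ 3 + t ^ 4) ->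
  P <= - (/ 18 * t ^ 2) ->
  Rabs (exp P * cos Q - airy_g0 0 t) <= 2 * A / r * ((1 + t + t ^ 2 + t ^ 3 + t ^ 4) * exp (- (/ 18 * t ^ 2))).
Proof.
  intros HA Hr Ht HP HQ HM. unfold airy_g0.
  replace (t ^ 3 / 3 + (0 - 1) * t) with (t ^ 3 / 3 - t) by ring.
  eapply Rle_trans. apply (Rabs_exp_cos_sub_le _ _ _ _ (- (/ 18 * t ^ 2))); auto. { nra. }
  rewrite <- Rmult_assoc. apply Rmult_le_compat_r. left; apply exp_pos.
  replace (P - - (1 * t ^ 2)) with (P + t ^ 2) by ring.
  replace (2 * A / r) with (A / r + A / r) by (field; lra). lra.
Qed.

(* [wallis k] is the integral of (1 - t^2)^k over [-1, 1]. *)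
Fixpoint wallis (k : nat) : R :=
  match k with O => 2 | S k => (2 * INR k + 2) / (2 * INR k + 3) * wallis k end.

Definition sin_int (n : nat) : R := RInt (fun t => sin t ^ n) 0 PI.

Lemma sin_pow_cont (n : nat) (x : R) : continuous (fun t => sin t ^ n) x.
Proof. cont1. Qed.

Lemma sin_int_rec (n : nat) : (INR n + 2) * sin_int (S (S n)) = (INR n + 1) * sin_int n.
Proof.
  assert (E : (INR n + 2) * sin_int (S (S n)) + - (INR n + 1) * sin_int n = 0); [| lra].
  unfold sin_int. rewrite <- RInt_lin by apply sin_pow_cont.
  rewrite (RInt_FTC (fun t => - cos t * sin t ^ S n)).
  - rewrite sin_PI, sin_0. simpl. ring.
  - intros t.
    replace ((INR n + 2) * sin t ^ S (S n) + - (INR n + 1) * sin t ^ n) with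
      (sin t * sin t ^ S n + - cos t * (INR (S n) * cos t * sin t ^ pred (S n))).
    + apply (is_derive_Rmult (fun t => - cos t) (fun t => sin t ^ S n)).
      * auto_derive; auto; ring.
      * apply is_derive_pow, is_derive_sin.
    + rewrite S_INR. simpl pred. simpl pow.
      replace (- cos t * ((INR n + 1) * cos t * sin t ^ n)) with (- (INR n + 1) * (cos t * cos t) * sin t ^ n) by ring.
      replace (cos t * cos t) with (1 - sin t * sin t) by (pose proof (sin2_cos2 t); unfold Rsqr in *; lra). ring.
  - intros t. apply (ex_derive_continuous (V := R_NormedModule)). auto_derive; auto.
Qed.

Lemma sin_int_decr (n : nat) : sin_int (S n) <= sin_int n.
Proof.
  apply RInt_le. left; apply PI_RGT_0.
  - apply ex_RInt_cont, sin_pow_cont.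
  - apply ex_RInt_cont, sin_pow_cont.
  - intros x Hx. simpl. assert (0 < sin x) by (apply sin_gt_0; lra). pose proof (SIN_bound x).
    assert (0 < sin x ^ n) by now apply pow_lt. nra.
Qed.

(** By [sin_int_rec] the left side does not depend on n. *)
Lemma sin_int_prod (n : nat) : (INR n + 1) * (sin_int n * sin_int (S n)) = 2 * PI.
Proof.
  induction n.
  - assert (E0 : sin_int 0 = PI).
    { unfold sin_int. rewrite (RInt_FTC (fun t => t)). ring. intros; simpl; auto_derive; auto. intros; apply sin_pow_cont. }
    assert (E1 : sin_int 1 = 2).
    { unfold sin_int. rewrite (RInt_FTC (fun t => - cos t)). rewrite cos_PI, cos_0; ring.
      intros; simpl; auto_derive; auto; ring. intros; apply sin_pow_cont. }
    rewrite E0, E1. simpl. ring.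
  - pose proof (sin_int_rec n). rewrite S_INR.
    replace ((INR n + 1 + 1) * (sin_int (S n) * sin_int (S (S n)))) with (sin_int (S n) * ((INR n + 2) * sin_int (S (S n)))) by ring.
    rewrite H. rewrite <- IHn. ring.
Qed.

Lemma wallis_sin_int (k : nat) : wallis k = sin_int (2 * k + 1).
Proof.
  induction k.
  - pose proof (sin_int_prod 0). assert (E0 : sin_int 0 = PI).
    { unfold sin_int. rewrite (RInt_FTC (fun t => t)). ring. intros; simpl; auto_derive; auto. intros; apply sin_pow_cont. }
    rewrite E0 in H. pose proof PI_RGT_0. simpl in *. apply Rmult_eq_reg_l with PI; lra.
  - pose proof (pos_INR k). pose proof (sin_int_rec (2 * k + 1)) as E.
    rewrite plus_INR, mult_INR in E. change (INR 2) with 2 in E. change (INR 1) with 1 in E.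
    change (wallis (S k)) with ((2 * INR k + 2) / (2 * INR k + 3) * wallis k). rewrite IHk.
    replace (2 * S k + 1)%nat with (S (S (2 * k + 1))) by lia.
    apply Rmult_eq_reg_l with (2 * INR k + 3); [| lra].
    replace (2 * INR k + 1 + 2) with (2 * INR k + 3) in E by ring. rewrite E. field. lra.
Qed.

Lemma wallis_pos (k : nat) : 0 < wallis k.
Proof.
  induction k. simpl; lra. pose proof (pos_INR k).
  change (wallis (S k)) with ((2 * INR k + 2) / (2 * INR k + 3) * wallis k).
  apply Rmult_lt_0_compat; auto. apply Rdiv_lt_0_compat; lra.
Qed.

(** [wallis k] is the sine integral of odd index 2k + 1; monotonicity compares it with its two
    neighbours, and the product formula evaluates the mixed products. *)
Lemma wallis_bounds (k : nat) : PI <= (INR k + 1) * wallis k ^ 2 /\ (INR k + 1 / 2) * wallis k ^ 2 <= PI.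
Proof.
  pose proof (sin_int_prod (2 * k)) as E1. pose proof (sin_int_prod (2 * k + 1)) as E2.
  pose proof (sin_int_decr (2 * k)) as D1. pose proof (sin_int_decr (2 * k + 1)) as D2.
  pose proof (wallis_sin_int k) as W. pose proof (wallis_pos k).
  replace (S (2 * k))%nat with (2 * k + 1)%nat in * by lia.
  rewrite plus_INR in E2. rewrite mult_INR in *. change (INR 2) with 2 in *. change (INR 1) with 1 in *. rewrite <- W in *.
  pose proof (pos_INR k). split.
  - assert ((2 * INR k + 1 + 1) * (wallis k * sin_int (S (2 * k + 1))) <= (2 * INR k + 1 + 1) * (wallis k * wallis k)); [| simpl; lra].
    apply Rmult_le_compat_l; [lra |]. apply Rmult_le_compat_l; lra.
  - assert ((2 * INR k + 1) * (wallis k * wallis k) <= (2 * INR k + 1) * (sin_int (2 * k) * wallis k)); [| simpl; lra].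
    apply Rmult_le_compat_l; [lra |]. apply Rmult_le_compat_r; lra.
Qed.

Lemma wallis_fact (n : nat) : wallis n * (2 * INR n + 1) * INR (fact (2 * n)) = 2 * 4 ^ n * INR (fact n) ^ 2.
Proof.
  induction n.
  - simpl. ring.
  - pose proof (pos_INR n).
    change (wallis (S n)) with ((2 * INR n + 2) / (2 * INR n + 3) * wallis n).
    replace (2 * S n)%nat with (S (S (2 * n))) by lia. rewrite 3!fact_simpl, !mult_INR.
    replace (INR (S (S (2 * n)))) with (2 * INR n + 2) by (rewrite 2!S_INR, mult_INR; simpl INR; ring).
    replace (INR (S (2 * n))) with (2 * INR n + 1) by (rewrite S_INR, mult_INR; simpl INR; ring).
    rewrite S_INR. change (4 ^ S n) with (4 * 4 ^ n).
    replace (2 * (4 * 4 ^ n) * ((INR n + 1) * INR (fact n)) ^ 2) with (4 * (INR n + 1) ^ 2 * (2 * 4 ^ n * INR (fact n) ^ 2)) by ring.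
    rewrite <- IHn. field. lra.
Qed.

(** * Stirling's formula with an explicit error *)

Lemma ln_1_plus_bounds (x : R) : 0 <= x -> 2 * x / (2 + x) <= ln (1 + x) <= x - x ^ 2 / 2 + x ^ 3 / 3.
Proof.
  intros Hx. split.
  - apply (le_of_derive_le (fun x => 2 * x / (2 + x)) (fun x => 4 / (2 + x) ^ 2) (fun x => ln (1 + x)) (fun x => / (1 + x)) 0 x Hx).
    + intros y Hy. auto_derive. lra. field. lra.
    + intros y Hy. auto_derive. lra. field. lra.
    + intros y Hy. apply Rmult_le_reg_r with ((2 + y) ^ 2 * (1 + y)). { apply Rmult_lt_0_compat; [apply pow_lt |]; lra. }
      replace (4 / (2 + y) ^ 2 * ((2 + y) ^ 2 * (1 + y))) with (4 * (1 + y)) by (field; lra).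
      replace (/ (1 + y) * ((2 + y) ^ 2 * (1 + y))) with ((2 + y) ^ 2) by (field; lra). nra.
    + replace (1 + 0) with 1 by ring. rewrite ln_1. right. field.
  - apply (le_of_derive_le (fun x => ln (1 + x)) (fun x => / (1 + x)) (fun x => x - x ^ 2 / 2 + x ^ 3 / 3) (fun x => 1 - x + x ^ 2) 0 x Hx).
    + intros y Hy. auto_derive. lra. field. lra.
    + intros y Hy. auto_derive; auto. field.
    + intros y Hy. apply Rmult_le_reg_r with (1 + y). lra. rewrite Rinv_l by lra.
      assert (0 <= y ^ 3) by (apply pow_le; lra). lra.
    + replace (1 + 0) with 1 by ring. rewrite ln_1. right. field.
Qed.

(** n! = n^(n + 1/2) e^(-n) e^(stirling_err n). *)
Definition stirling_err (n : nat) : R := ln (INR (fact n)) - (INR n + 1 / 2) * ln (INR n) + INR n.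

Lemma stirling_err_step (n : nat) : (1 <= n)%nat ->
  0 <= stirling_err n - stirling_err (S n) <= 1 / 2 * (/ INR n - / INR (S n)).
Proof.
  intros Hn. apply (le_INR 1) in Hn. simpl in Hn.
  assert (E : stirling_err n - stirling_err (S n) = (INR n + 1 / 2) * ln (1 + / INR n) - 1).
  { unfold stirling_err. rewrite fact_simpl, mult_INR, S_INR.
    pose proof (INR_fact_lt_0 n). rewrite ln_mult by lra.
    replace (1 + / INR n) with ((INR n + 1) * / INR n) by (field; lra).
    rewrite ln_mult, ln_Rinv by (try apply Rinv_0_lt_compat; lra). field. }
  rewrite E, S_INR. destruct (ln_1_plus_bounds (/ INR n)) as [H1 H2]. left; apply Rinv_0_lt_compat; lra.
  set (x := INR n) in *.
  split.
  (* At 1/x the minorant 2 y / (2 + y) of ln (1 + y) times x + 1/2 is exactly 1. *)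
  - apply Rmult_le_compat_l with (r := x + 1 / 2) in H1; [| lra].
    replace ((x + 1 / 2) * (2 * / x / (2 + / x))) with 1 in H1. lra. field. split; lra.
  - apply Rmult_le_compat_l with (r := x + 1 / 2) in H2; [| lra].
    eapply Rle_trans. apply Rplus_le_compat_r. exact H2.
    replace ((x + 1 / 2) * (/ x - (/ x) ^ 2 / 2 + (/ x) ^ 3 / 3) + - (1)) with ((x + 2) / (12 * x ^ 3)) by (field; lra).
    replace (1 / 2 * (/ x - / (x + 1))) with (1 / (2 * (x * (x + 1)))) by (field; lra).
    apply Rmult_le_reg_r with (12 * x ^ 3 * (x + 1)). { apply Rmult_lt_0_compat; [apply Rmult_lt_0_compat; [lra | apply pow_lt; lra] | lra]. }
    replace ((x + 2) / (12 * x ^ 3) * (12 * x ^ 3 * (x + 1))) with ((x + 2) * (x + 1)) by (field; lra).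
    replace (1 / (2 * (x * (x + 1))) * (12 * x ^ 3 * (x + 1))) with (6 * x ^ 2) by (field; lra). nra.
Qed.

Lemma stirling_err_double (n : nat) : (1 <= n)%nat ->
  0 <= stirling_err n - stirling_err (2 * n) <= / INR n.
Proof.
  intros Hn. assert (H : forall j, 0 <= stirling_err n - stirling_err (n + j) <= 1 / 2 * (/ INR n - / INR (n + j))).
  { induction j. rewrite Nat.add_0_r. lra.
    pose proof (stirling_err_step (n + j) ltac:(lia)). rewrite Nat.add_succ_r. lra. }
  specialize (H n). replace (n + n)%nat with (2 * n)%nat in H by lia.
  assert (0 < / INR (2 * n)) by (apply Rinv_0_lt_compat, lt_0_INR; lia).
  assert (0 < / INR n) by (apply Rinv_0_lt_compat, lt_0_INR; lia). lra.
Qed.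

Lemma ln_pow_nat (x : R) (n : nat) : 0 < x -> ln (x ^ n) = INR n * ln x.
Proof. intros. now apply ln_pow. Qed.

(** err n = (2 err n - err (2n)) - (err n - err (2n)): the first part is explicit through [wallis],
    the second is O(1/n). No limit of the errors has to be constructed. *)
Lemma stirling (n : nat) : (1 <= n)%nat -> Rabs (stirling_err n - ln (2 * PI) / 2) <= / INR n.
Proof.
  intros Hn. pose proof (stirling_err_double n Hn) as Hd.
  apply (le_INR 1) in Hn. simpl in Hn. set (x := INR n) in *.
  pose proof (INR_fact_lt_0 n). pose proof (INR_fact_lt_0 (2 * n)). pose proof (wallis_pos n) as Hw. pose proof PI_RGT_0.
  assert (E : 2 * stirling_err n - stirling_err (2 * n) = ln (wallis n ^ 2 * (x + 1 / 2) ^ 2 * 2 / x) / 2).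
  { assert (E1 : ln (wallis n * (2 * x + 1) * INR (fact (2 * n))) = ln (2 * 4 ^ n * INR (fact n) ^ 2)) by (unfold x; now rewrite wallis_fact).
    rewrite !ln_mult, !ln_pow_nat in E1 by (try apply pow_lt; try apply Rmult_lt_0_compat; try apply pow_lt; lra).
    unfold stirling_err. rewrite mult_INR. fold x. change (INR 2) with 2 in *.
    unfold Rdiv. 
    rewrite !ln_mult, !ln_pow_nat, !ln_Rinv by (repeat (try apply Rinv_0_lt_compat; try apply Rmult_lt_0_compat; try apply pow_lt); lra).
    replace (ln 4) with (2 * ln 2) in E1 by (replace 4 with (2 * 2) by ring; rewrite ln_mult by lra; ring).
    replace (2 * x + 1) with (2 * (x + 1 * / 2)) in E1 by field. rewrite (ln_mult 2 (x + 1 * / 2)) in E1 by lra.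
    fold x in E1. change (INR 2) with 2 in *. lra. }
  destruct (wallis_bounds n) as [B1 B2]. fold x in B1, B2.
  assert (H2 : 2 * PI <= wallis n ^ 2 * (x + 1 / 2) ^ 2 * 2 / x <= 2 * PI * (1 + / x)).
  { split; apply Rmult_le_reg_r with x; try lra.
    - replace (wallis n ^ 2 * (x + 1 / 2) ^ 2 * 2 / x * x) with (2 * (wallis n ^ 2 * (x + 1 / 2) ^ 2)) by (field; lra).
      assert (PI * x <= (x + 1) * wallis n ^ 2 * x) by (apply Rmult_le_compat_r; lra).
      assert (0 <= wallis n ^ 2) by apply pow2_ge_0. nra.
    - replace (wallis n ^ 2 * (x + 1 / 2) ^ 2 * 2 / x * x) with (2 * (((x + 1 / 2) * wallis n ^ 2) * (x + 1 / 2))) by (field; lra).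
      replace (2 * PI * (1 + / x) * x) with (2 * (PI * (x + 1))) by (field; lra).
      assert ((x + 1 / 2) * wallis n ^ 2 * (x + 1 / 2) <= PI * (x + 1 / 2)) by (apply Rmult_le_compat_r; lra). nra. }
  assert (H3 : ln (2 * PI) <= ln (wallis n ^ 2 * (x + 1 / 2) ^ 2 * 2 / x) <= ln (2 * PI) + / x).
  { assert (0 < / x) by (apply Rinv_0_lt_compat; lra). split.
    - apply ln_le; lra.
    - apply Rle_trans with (ln (2 * PI * (1 + / x))). apply ln_le; lra.
      rewrite ln_mult by lra. apply Rplus_le_compat_l.
      rewrite <- (ln_exp (/ x)) at 2. apply ln_le; [lra | apply exp_ge_1_plus]. }
  apply Rabs_le. lra.
Qed.

(** * Hermite polynomials at the turning point *)

Lemma sin_nat_PI (j : nat) : sin (INR j * PI) = 0.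
Proof.
  induction j. simpl. rewrite Rmult_0_l. apply sin_0.
  rewrite S_INR. replace ((INR j + 1) * PI) with (INR j * PI + PI) by ring. rewrite neg_sin, IHj. ring.
Qed.

(* Real and imaginary part of [x w - w^2 / 4] at [w = rho e^(i th)]; [he p x] is the coefficient of [w^p]
   in [exp (x w - w^2 / 4)]. *)
Definition hermP (x rho th : R) : R := x * rho * cos th - rho ^ 2 * cos (2 * th) / 4.
Definition hermQ (x rho th : R) : R := x * rho * sin th - rho ^ 2 * sin (2 * th) / 4.

Lemma hermQ_0 (x rho : R) : hermQ x rho 0 = 0.
Proof. unfold hermQ. rewrite Rmult_0_r, sin_0. field. Qed.

Lemma hermQ_PI (x rho : R) : hermQ x rho PI = 0.
Proof. unfold hermQ. rewrite sin_2PI, sin_PI. field. Qed.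

(** Independence of the radius for the integral of Re (w^j e^(x w - w^2/4)) over a half circle: in
    polar form u d/du of the real part is d/dth of the imaginary part, which vanishes at both
    ends. *)
Lemma herm_mean_value (x rho : R) (j : nat) : 0 < rho ->
  RInt (fun th => rho ^ j * exp (hermP x rho th) * cos (hermQ x rho th + INR j * th)) 0 PI =
  RInt (fun th => 0 ^ j * exp (hermP x 0 th) * cos (hermQ x 0 th + INR j * th)) 0 PI :> R.
Proof.
  intros Hrho.
  set (f := fun u th => u ^ j * exp (hermP x u th) * cos (hermQ x u th + INR j * th)).
  set (df := fun u th => (INR j * u ^ pred j) * exp (hermP x u th) * cos (hermQ x u th + INR j * th) +
    u ^ j * (exp (hermP x u th) * ((x * cos th - u * cos (2 * th) / 2) * cos (hermQ x u th + INR j * th)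
      - (x * sin th - u * sin (2 * th) / 2) * sin (hermQ x u th + INR j * th)))).
  assert (Hd : forall u, is_derive (fun u => RInt (f u) 0 PI) u (RInt (df u) 0 PI)).
  { intros u. apply is_derive_RInt_param_cont.
    - intros w t. unfold f, df, hermP, hermQ. auto_derive; auto. 
      field_trig.
    - intros w t. unfold df, hermP, hermQ. cbv beta. cont2.
    - intros w t. unfold f, hermP, hermQ. cont1. }
  destruct (MVT_gen (fun u => RInt (f u) 0 PI) 0 rho (fun _ => 0)) as [c [_ E]].
  - intros u Hu. rewrite Rmin_left, Rmax_right in Hu by lra.
    assert (E0 : RInt (df u) 0 PI = 0 :> R); [| specialize (Hd u); rewrite E0 in Hd; exact Hd].
    assert (Hdf : forall t, continuous (df u) t) by (intros t; unfold df, hermP, hermQ; cont1).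
    assert (E : u * RInt (df u) 0 PI + 0 * RInt (df u) 0 PI = 0).
    { rewrite <- RInt_lin by auto.
      rewrite (RInt_FTC (fun th => u ^ j * exp (hermP x u th) * sin (hermQ x u th + INR j * th))).
      - rewrite hermQ_0, hermQ_PI.
        replace (0 + INR j * PI) with (INR j * PI) by ring. replace (0 + INR j * 0) with 0 by ring.
        rewrite sin_nat_PI, sin_0. ring.
      - intros th. unfold df, hermP, hermQ. auto_derive; auto.
        replace (INR j * u ^ pred j) with (INR j * u ^ j / u).
        field_trig. destruct j; simpl; field; lra.
      - intros t. apply continuous_lin; auto. }
    apply Rmult_eq_reg_l with u; lra.
  - intros u _. apply continuity_pt_filterlim. apply (is_derive_cont _ _ _ (Hd u)).
  - fold (f rho). fold (f 0). lra.
Qed.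

Definition herm_int (x rho : R) (p : nat) : R :=
  RInt (fun th => exp (hermP x rho th) * cos (hermQ x rho th - INR p * th)) 0 PI.

Lemma herm_int_cont (x rho a : R) (th : R) : continuous (fun th => exp (hermP x rho th) * cos (hermQ x rho th + a * th)) th.
Proof. unfold hermP, hermQ. cont1. Qed.

(** The integrand combination is the derivative of e^P sin (Q + a th), zero at 0 and at pi because a
    is an integer. The real [a] allows the shifts a + 1 and a + 2 to pass zero. *)
Lemma herm_int_rec (x rho a : R) (p : nat) : a = - INR p ->
  x * rho * RInt (fun th => exp (hermP x rho th) * cos (hermQ x rho th + (a + 1) * th)) 0 PI
  - rho ^ 2 / 2 * RInt (fun th => exp (hermP x rho th) * cos (hermQ x rho th + (a + 2) * th)) 0 PI
  = INR p * RInt (fun th => exp (hermP x rho th) * cos (hermQ x rho th + a * th)) 0 PI.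
Proof.
  intros Ha.
  set (f := fun b th => exp (hermP x rho th) * cos (hermQ x rho th + b * th)).
  assert (Hc : forall b th, continuous (f b) th) by (intros; apply herm_int_cont).
  assert (Hc2 : forall u v b c th, continuous (fun th => u * f b th + v * f c th) th).
  { intros. apply continuous_lin; auto. }
  assert (E : 1 * RInt (fun th => (x * rho) * f (a + 1) th + (- (rho ^ 2 / 2)) * f (a + 2) th) 0 PI
     + a * RInt (f a) 0 PI = 0).
  { rewrite <- RInt_lin by auto.
    rewrite (RInt_FTC (fun th => exp (hermP x rho th) * sin (hermQ x rho th + a * th))).
    - rewrite hermQ_0, hermQ_PI. replace (0 + a * PI) with (- (INR p * PI)) by (rewrite Ha; ring).
      replace (0 + a * 0) with 0 by ring. rewrite sin_neg, sin_nat_PI, sin_0. ring.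
    - intros th. unfold f.
      replace (hermQ x rho th + (a + 1) * th) with ((hermQ x rho th + a * th) + th) by ring.
      replace (hermQ x rho th + (a + 2) * th) with ((hermQ x rho th + a * th) + 2 * th) by ring.
      rewrite (cos_plus _ th), (cos_plus _ (2 * th)). unfold hermP, hermQ. auto_derive; auto. field_trig.
    - intros th. unfold f. unfold hermP, hermQ. cont1. }
  rewrite RInt_lin in E by auto. unfold f in E. rewrite Ha in *. lra.
Qed.

(** Cauchy's formula for the coefficients of e^(x w - w^2/4), proved by matching three-term
    recurrences. *)
Lemma he_herm_int (x rho : R) (p : nat) : 0 < rho -> herm_int x rho p = PI * rho ^ p * he p x.
Proof.
  intros Hrho.
  assert (Hz : forall p a, a = - INR p -> herm_int x rho p = RInt (fun th => exp (hermP x rho th) * cos (hermQ x rho th + a * th)) 0 PI).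
  { intros q a ->. apply RInt_ext. intros th _. f_equal. f_equal. ring. }
  assert (H0 : herm_int x rho 0 = PI).
  { pose proof (herm_mean_value x rho 0 Hrho) as E. unfold herm_int.
    transitivity (RInt (fun th => 0 ^ 0 * exp (hermP x 0 th) * cos (hermQ x 0 th + INR 0 * th)) 0 PI).
    - rewrite <- E. apply RInt_ext. intros th _. simpl pow. rewrite Rmult_1_l. f_equal. f_equal. simpl; ring.
    - rewrite (RInt_FTC (fun th => th)). ring.
      + intros th. unfold hermP, hermQ. simpl pow.
        replace (x * 0 * cos th - 0 * (0 * 1) * cos (2 * th) / 4) with 0 by field.
        replace (x * 0 * sin th - 0 * (0 * 1) * sin (2 * th) / 4 + INR 0 * th) with 0 by (simpl; field).
        rewrite exp_0, cos_0. auto_derive; auto; ring.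
      + intros th. unfold hermP, hermQ. cont1. }
  (* The coefficient of index -1 vanishes; the recurrence needs it to reach index 1. *)
  assert (Hm1 : RInt (fun th => exp (hermP x rho th) * cos (hermQ x rho th + 1 * th)) 0 PI = 0 :> R).
  { pose proof (herm_mean_value x rho 1 Hrho) as E.
    assert (E1 : rho * RInt (fun th => exp (hermP x rho th) * cos (hermQ x rho th + 1 * th)) 0 PI
         + 0 * RInt (fun th => exp (hermP x rho th) * cos (hermQ x rho th + 1 * th)) 0 PI = 0).
    { rewrite <- RInt_lin by apply herm_int_cont.
      transitivity (RInt (fun th => rho ^ 1 * exp (hermP x rho th) * cos (hermQ x rho th + INR 1 * th)) 0 PI).
      { apply RInt_ext. intros th _. simpl. eq_in_R. ring. }
      rewrite E. rewrite (RInt_FTC (fun _ => 0)). ring.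
      intros th. replace (0 ^ 1 * exp (hermP x 0 th) * cos (hermQ x 0 th + INR 1 * th)) with 0 by (simpl; ring).
      apply is_derive_Rconst.
      intros th. unfold hermP, hermQ. cont1. }
    apply Rmult_eq_reg_l with rho; lra. }
  induction p as [| | p IH1 IH2] using nat_ind2.
  - rewrite H0. simpl. ring.
  - pose proof (herm_int_rec x rho (-1) 1 ltac:(simpl; ring)) as E.
    replace (-1 + 2) with 1 in E by ring. rewrite Hm1 in E.
    rewrite <- (Hz 0%nat) in E by (simpl; ring). rewrite <- (Hz 1%nat) in E by (simpl; ring).
    rewrite H0 in E. simpl in *. lra.
  - pose proof (herm_int_rec x rho (- INR (S (S p))) (S (S p)) eq_refl) as E.
    rewrite <- (Hz (S (S p)) (- INR (S (S p))) eq_refl) in E.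
    rewrite <- (Hz (S p) (- INR (S (S p)) + 1)) in E by (rewrite (S_INR (S p)); ring).
    rewrite <- (Hz p (- INR (S (S p)) + 2)) in E by (rewrite !S_INR; ring).
    rewrite IH1, IH2, !S_INR in E. pose proof (pos_INR p).
    apply Rmult_eq_reg_l with (INR p + 1 + 1); [| lra]. rewrite <- E, he_SS.
    simpl pow. field. lra.
Qed.

Lemma RInt_rescale (g : R -> R) (r b : R) : 0 < r -> (forall x, continuous g x) ->
  RInt g 0 b = RInt (fun t => g (t / r)) 0 (b * r) / r :> R.
Proof.
  intros Hr Hg.
  assert (Hg' : forall t, continuous (fun t => g (t / r)) t).
  { intros t. apply (continuous_comp (fun t => t / r) g); auto. cont1. }
  pose proof (RInt_comp_lin (V := R_CompleteNormedModule) g (/ r) 0 0 (b * r)) as E.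
  replace (/ r * 0 + 0) with 0 in E by ring. replace (/ r * (b * r) + 0) with b in E by (field; lra).
  specialize (E (ex_RInt_cont _ _ _ Hg)).
  rewrite <- E.
  rewrite (RInt_ext _ (fun t => / r * g (t / r) + 0 * g (t / r))).
  - rewrite (RInt_lin (fun t => g (t / r)) (fun t => g (t / r))) by auto. eq_in_R. unfold Rdiv. ring.
  - intros t _. change (/ r * g (/ r * t + 0) = / r * g (t / r) + 0 * g (t / r)).
    rewrite Rmult_0_l, !Rplus_0_r. replace (/ r * t) with (t / r) by (unfold Rdiv; ring). reflexivity.
Qed.

Lemma le_div_pos (a b c : R) : 0 < c -> a * c <= b -> a <= b / c.
Proof.
  intros Hc H. apply Rmult_le_reg_r with c; auto. unfold Rdiv. rewrite Rmult_assoc, Rinv_l, Rmult_1_r; lra.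
Qed.

(* With th = t / r, r^3 = N / 2, the saddle point th = 0 is degenerate: phase t^3/3 - t and modulus - t^2 up to O(1/r). *)
Lemma herm_phase_bounds (r th : R) : 2 <= r -> 0 <= th <= PI ->
  let N := 2 * r ^ 3 in let h := / r in let t := r * th in
  let P := N * (1 - h) * cos th - N * (1 - h) ^ 2 * cos (2 * th) / 4 - (N * (1 - h) - N * (1 - h) ^ 2 / 4) in
  let Q := N * (1 - h) * sin th - N * (1 - h) ^ 2 * sin (2 * th) / 4 - (r ^ 3 - 1 / 2) * th in
  Rabs (P + t ^ 2) <= 1 / r * (1 + t + t ^ 2 + t ^ 3 + t ^ 4) /\
  Rabs (Q - (t ^ 3 / 3 - t)) <= 1 / r * (1 + t + t ^ 2 + t ^ 3 + t ^ 4) /\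
  P <= - (/ 18 * t ^ 2).
Proof.
  intros Hr Hth N h t P Q.
  assert (Hrh : r * h = 1) by (unfold h; field; lra).
  assert (Hh : 0 < h) by (unfold h; apply Rinv_0_lt_compat; lra).
  assert (Hh2 : h <= 1 / 2) by nra.
  set (d := 1 - cos th).
  assert (Hd : th ^ 2 / 18 <= d) by (apply one_minus_cos_ge; lra).
  assert (Hd1 : d <= th ^ 2 / 2) by (unfold d; pose proof (cos_ge_2 th); lra).
  assert (Hd2 : th ^ 2 / 2 - th ^ 4 / 24 <= d) by (unfold d; pose proof (cos_le_4 th); lra).
  (* Without the offset the terms linear in d would cancel, the saddle point being degenerate; N h =
     2 r^2 makes the remaining term produce - t^2. *)
  assert (EP : P = - 2 * r ^ 2 * (1 - h) * d - r ^ 3 * (1 - h) ^ 2 * d ^ 2).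
  { unfold P, N, d. rewrite cos_2a_cos.
    replace (- 2 * r ^ 2 * (1 - h) * (1 - cos th)) with (- 2 * r ^ 3 * h * (1 - h) * (1 - cos th)).
    2:{ replace (- 2 * r ^ 3 * h * (1 - h) * (1 - cos th)) with (- 2 * r ^ 2 * (r * h) * (1 - h) * (1 - cos th)) by ring. rewrite Hrh. ring. }
    field. }
  assert (Ht : 0 <= t) by (unfold t; nra).
  assert (Ht1 : 0 <= t ^ 2 /\ 0 <= t ^ 3 /\ 0 <= t ^ 4) by (repeat split; now apply pow_le).
  assert (Hr2 : 0 < r ^ 2) by nra. assert (Hr3 : 0 < r ^ 3) by (apply pow_lt; lra).
  assert (Hth2 : 0 <= th ^ 2) by nra. assert (Hth4 : 0 <= th ^ 4) by (apply pow_le; lra).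
  assert (Ht2 : t ^ 2 = r ^ 2 * th ^ 2) by (unfold t; ring).
  assert (Ht4 : 1 / r * t ^ 4 = r ^ 3 * th ^ 4) by (unfold t; field; lra).
  assert (Ht2' : 1 / r * t ^ 2 = r * th ^ 2) by (unfold t; field; lra).
  assert (Hr1 : 0 <= 1 / r * (1 + t + t ^ 3)) by (apply Rmult_le_pos; [unfold Rdiv; rewrite Rmult_1_l; fold h; lra | lra]).
  assert (Hsplit : 1 / r * (1 + t + t ^ 2 + t ^ 3 + t ^ 4) = 1 / r * (1 + t + t ^ 3) + r * th ^ 2 + r ^ 3 * th ^ 4).
  { rewrite <- Ht4, <- Ht2'. ring. }
  split; [| split].
  - rewrite Hsplit.
    assert (EP' : P + t ^ 2 = r ^ 2 * (th ^ 2 - 2 * d) + 2 * r * d - r ^ 3 * (1 - h) ^ 2 * d ^ 2).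
    { rewrite EP, Ht2. replace (2 * r * d) with (2 * r ^ 2 * h * d) by (replace (2 * r ^ 2 * h * d) with (2 * r * (r * h) * d) by ring; rewrite Hrh; ring). ring. }
    rewrite EP'.
    assert (A1 : 0 <= r ^ 2 * (th ^ 2 - 2 * d) <= r ^ 3 * th ^ 4).
    { split. apply Rmult_le_pos; lra.
      apply Rle_trans with (r ^ 2 * th ^ 4). apply Rmult_le_compat_l; lra. apply Rmult_le_compat_r; auto. nra. }
    assert (A2 : 0 <= 2 * r * d <= r * th ^ 2) by nra.
    assert (A3 : 0 <= r ^ 3 * (1 - h) ^ 2 * d ^ 2 <= r ^ 3 * th ^ 4).
    { rewrite Rmult_assoc. split. apply Rmult_le_pos; [lra |]. apply Rmult_le_pos; apply pow2_ge_0.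
      apply Rmult_le_compat_l; [lra |].
      apply Rle_trans with (1 * d ^ 2). apply Rmult_le_compat_r. apply pow2_ge_0. nra.
      replace (th ^ 4) with ((th ^ 2) ^ 2) by ring. nra. }
    apply Rabs_le. lra.
  - rewrite Hsplit.
    pose proof (sin_ge_3 th ltac:(lra)) as S1. pose proof (sin_le_5 th ltac:(lra)) as S2.
    pose proof (sin_ge_3 (2 * th) ltac:(lra)) as S3. pose proof (sin_le_5 (2 * th) ltac:(lra)) as S4.
    set (e1 := sin th - (th - th ^ 3 / 6)). set (e2 := sin (2 * th) - (2 * th - (2 * th) ^ 3 / 6)).
    assert (He1 : 0 <= e1 <= th ^ 5 / 120) by (unfold e1; lra).
    assert (He2 : 0 <= e2 <= 32 * th ^ 5 / 120) by (unfold e2; lra).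
    assert (EQ : Q - (t ^ 3 / 3 - t) = th / 2 + t ^ 3 / 3 * h * (- 3 + 2 * h) + 2 * r ^ 3 * (1 - h) * e1 - r ^ 3 * (1 - h) ^ 2 * e2 / 2).
    { unfold Q, N, e1, e2, t, h. field. lra. }
    rewrite EQ.
    assert (B0 : 0 <= th / 2 <= 1 / r * t). { unfold t. replace (1 / r * (r * th)) with th by (field; lra). lra. }
    assert (B1 : - (1 / r * t ^ 3) <= t ^ 3 / 3 * h * (- 3 + 2 * h) <= 0).
    { replace (1 / r) with h by (unfold h; field; lra).
      assert (0 <= h * t ^ 3) by (apply Rmult_le_pos; lra).
      replace (t ^ 3 / 3 * h * (- 3 + 2 * h)) with (h * t ^ 3 * (-1 + 2 / 3 * h)) by field. nra. }
    pose proof PI_4.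
    assert (Hth5 : 0 <= th ^ 5 <= 4 * th ^ 4). { replace (th ^ 5) with (th * th ^ 4) by ring. nra. }
    assert (B2 : 0 <= 2 * r ^ 3 * (1 - h) * e1 <= r ^ 3 * th ^ 4).
    { replace (2 * r ^ 3 * (1 - h) * e1) with (r ^ 3 * (2 * (1 - h) * e1)) by ring.
      split. apply Rmult_le_pos; [lra |]. apply Rmult_le_pos; lra. apply Rmult_le_compat_l; [lra |]. nra. }
    assert (B3 : 0 <= r ^ 3 * (1 - h) ^ 2 * e2 / 2 <= r ^ 3 * th ^ 4).
    { replace (r ^ 3 * (1 - h) ^ 2 * e2 / 2) with (r ^ 3 * ((1 - h) ^ 2 * (e2 / 2))) by field.
      assert (0 <= (1 - h) ^ 2 <= 1) by nra.
      split. apply Rmult_le_pos; [lra |]. apply Rmult_le_pos; lra. apply Rmult_le_compat_l; [lra |]. nra. }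
    assert (B4 : 1 / r * (1 + t + t ^ 3) = 1 / r + 1 / r * t + 1 / r * t ^ 3) by ring.
    assert (0 <= 1 / r) by (unfold Rdiv; rewrite Rmult_1_l; fold h; lra).
    assert (0 <= r * th ^ 2) by nra.
    apply Rabs_le. lra.
  - rewrite EP, Ht2.
    assert (0 <= r ^ 3 * (1 - h) ^ 2 * d ^ 2) by (repeat apply Rmult_le_pos; try apply pow2_ge_0; lra).
    assert (r ^ 2 * d <= 2 * r ^ 2 * (1 - h) * d).
    { replace (2 * r ^ 2 * (1 - h) * d) with (r ^ 2 * d * (2 * (1 - h))) by ring.
      assert (0 <= r ^ 2 * d) by (apply Rmult_le_pos; lra). nra. }
    assert (r ^ 2 * (th ^ 2 / 18) <= r ^ 2 * d) by (apply Rmult_le_compat_l; lra). lra.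
Qed.

(** At x = sqrt N the two saddle points nearly coalesce at w = sqrt N. Writing w = sqrt N e^(i t /
    r), the shift t -> t + i multiplies |w| by e^(-1/r), whence the radius sqrt N (1 - 1/r). *)
Lemma he_turning_point : exists C, 0 <= C /\ forall p r, 2 <= r -> 2 * r ^ 3 = 2 * INR p + 1 ->
  let N := 2 * r ^ 3 in
  Rabs (he p (sqrt N) * (PI * r * (sqrt N * (1 - / r)) ^ p * exp (- (N * (1 - / r) - N * (1 - / r) ^ 2 / 4))) - airy_K0 0) <= C / r.
Proof.
  (* 2 doubles the constant 1 of [herm_phase_bounds] as in [exp_cos_compare]; the cut-off is pi r >=
     r. *)
  destruct (airy_integral_compare 2 1 ltac:(lra) ltac:(lra)) as [C [HC H]]. exists C. split; auto.
  intros p r Hr Hp N.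
  assert (HN : 0 < N) by (unfold N; assert (0 < r ^ 3) by (apply pow_lt; lra); lra).
  pose proof (sqrt_lt_R0 N HN) as HsN.
  assert (Hh : 0 < / r <= 1 / 2) by (apply inv_le_half; lra).
  set (rho := sqrt N * (1 - / r)).
  assert (Hrho : 0 < rho) by (apply Rmult_lt_0_compat; lra).
  set (P0 := N * (1 - / r) - N * (1 - / r) ^ 2 / 4).
  pose proof (he_herm_int (sqrt N) rho p Hrho) as E. unfold herm_int in E.
  rewrite (RInt_rescale _ r PI) in E; [| lra |].
  2:{ intros th. unfold hermP, hermQ. cont1. }
  set (g := fun t => exp (hermP (sqrt N) rho (t / r)) * cos (hermQ (sqrt N) rho (t / r) - INR p * (t / r))) in E.
  assert (Hg : forall t, continuous g t). { intros t. unfold g, hermP, hermQ. cont1. }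
  set (F := fun t => exp (- P0) * g t).
  replace (he p (sqrt N) * (PI * r * rho ^ p * exp (- P0))) with (RInt F 0 (PI * r)).
  2:{ transitivity (exp (- P0) * RInt g 0 (PI * r)).
      - unfold F. apply (RInt_scal (V := R_CompleteNormedModule) g). now apply ex_RInt_cont.
      - assert (E2 : RInt g 0 (PI * r) = PI * rho ^ p * he p (sqrt N) * r :> R) by
          (rewrite <- E; unfold Rdiv; rewrite Rmult_assoc, Rinv_l, Rmult_1_r by lra; reflexivity).
        rewrite E2. eq_in_R. ring. }
  assert (Hs2 : sqrt N * sqrt N = N) by (apply sqrt_sqrt; lra).
  apply H; try lra.
  - pose proof PI2_3_2. nra.
  - intros t. apply (continuous_mult (K := R_AbsRing) (fun _ => exp (- P0)) g); auto. apply continuous_const.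
  - intros t Ht.
    assert (Hth : 0 <= t / r <= PI).
    { split. apply Rmult_le_pos; lra. apply Rmult_le_reg_r with r; [lra |]. replace (t / r * r) with t by (field; lra). lra. }
    destruct (herm_phase_bounds r (t / r) Hr Hth) as [B1 [B2 B3]].
    replace (r * (t / r)) with t in B1, B2, B3 by (field; lra).
    set (th := t / r) in *.
    replace (F t) with (exp (N * (1 - / r) * cos th - N * (1 - / r) ^ 2 * cos (2 * th) / 4 - P0) *
      cos (N * (1 - / r) * sin th - N * (1 - / r) ^ 2 * sin (2 * th) / 4 - (r ^ 3 - 1 / 2) * th)).
    2:{ unfold F, g. fold th. rewrite <- Rmult_assoc, <- exp_plus. unfold hermP, hermQ, rho.
        replace (sqrt N * (sqrt N * (1 - / r))) with (N * (1 - / r)) by (rewrite <- Hs2 at 1; ring).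
        replace ((sqrt N * (1 - / r)) ^ 2) with (N * (1 - / r) ^ 2) by (rewrite <- Hs2 at 1; ring).
        f_equal; f_equal. ring. replace (INR p) with (r ^ 3 - 1 / 2) by lra. ring. }
    replace (2 / r) with (2 * 1 / r) by (field; lra).
    apply exp_cos_compare; auto; lra.
Qed.

(** * Bessel functions at the turning point *)

(* Half of the integral of (1 - t^2)^k e^(izt) from -1 to 1, along the circular arc
   t = rho sin th + i rho (cos th - cos g), where 1 - t^2 = 2 rho^2 (cos th - cos g) e^(-i th). *)
Definition arc_A (g rho th : R) : R := 2 * rho ^ 2 * (cos th - cos g).
Definition arc_P (z g rho th : R) : R := z * rho * (cos g - cos th).
Definition arc_Q (z rho th : R) : R := z * rho * sin th.
Definition arc_f (z g rho : R) (k : nat) (th : R) : R :=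
  rho * arc_A g rho th ^ k * exp (arc_P z g rho th) * cos (arc_Q z rho th - (INR k + 1) * th).

Lemma arc_f_cont (z g rho : R) (k : nat) (th : R) : continuous (arc_f z g rho k) th.
Proof. unfold arc_f, arc_A, arc_P, arc_Q. cont1. Qed.

Definition arc_int (z g rho : R) (k : nat) : R := RInt (arc_f z g rho k) 0 g.

Lemma arc_int_0 (z g rho : R) : 0 < z -> rho * sin g = 1 -> arc_int z g rho 0 = sin z / z.
Proof.
  intros Hz Hg. unfold arc_int.
  rewrite (RInt_FTC (fun th => exp (arc_P z g rho th) * sin (arc_Q z rho th) / z)).
  - unfold arc_P, arc_Q. replace (z * rho * sin g) with z by (rewrite Rmult_assoc, Hg; ring).
    replace (z * rho * (cos g - cos g)) with 0 by ring. rewrite sin_0, exp_0, Rmult_0_r, sin_0. field. lra.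
  - intros th. change R in th. unfold arc_f, arc_A, arc_P, arc_Q. simpl INR. replace ((0 + 1) * th) with th by (eq_in_R; ring).
    rewrite cos_minus. auto_derive; auto. simpl pow. field_trig.
  - intros; apply arc_f_cont.
Qed.

(** The real part of [t (1 - t^2)^k + i z (1 - t^2)^(k+1) / (2 (k + 1))] e^(i z t) on the arc. Its
    t-derivative is e^(i z t) times a combination of (1 - t^2)^j for j = k - 1, k, k + 1 with
    constant coefficients. *)
Definition arc_D (z g rho : R) (k : nat) (th : R) : R :=
  exp (arc_P z g rho th) *
   (arc_A g rho th ^ k * (rho * sin th * cos (arc_Q z rho th - INR k * th) - rho * (cos th - cos g) * sin (arc_Q z rho th - INR k * th))
    - z / (2 * (INR k + 1)) * arc_A g rho th ^ (S k) * sin (arc_Q z rho th - (INR k + 1) * th)).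

(** The derivative of [arc_D] as a polynomial identity: [E] is the exponential, [a] and [B] are the
    powers of A with exponents k and k - 1. The last hypothesis keeps the factor [K] so that it also
    holds for k = 0. *)
Lemma arc_algebra (z rho s c g C S E B a K w : R) : s ^ 2 = 1 - c ^ 2 -> rho ^ 2 * g ^ 2 = rho ^ 2 - 1 ->
  K * w = z / 2 - w -> K * a = K * (2 * rho ^ 2 * (c - g) * B) ->
  let A := 2 * rho ^ 2 * (c - g) in let q := z * rho * c - K in
  let S2 := S * c - C * s in let C2 := C * c + S * s in
  z * rho * s * E * (a * (rho * s * C - rho * (c - g) * S) - w * (A * a) * S2)
  + E * (K * B * (- 2 * rho ^ 2 * s) * (rho * s * C - rho * (c - g) * S)
         + a * ((rho * c * C - rho * s * (q * S)) - (- rho * s * S + rho * (c - g) * (q * C)))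
         - w * ((K + 1) * a * (- 2 * rho ^ 2 * s) * S2 + A * a * ((q - 1) * C2)))
  = (2 * K + 1) * (rho * a * E * C2) - 2 * K * (rho * B * E * C) - z * w * (rho * (A * a) * E * (C * (2 * c ^ 2 - 1) + S * (2 * s * c))).
Proof.
  intros H1 H2 H3 H4. cbv zeta.
  apply Rminus_diag_uniq. ring_simplify [H1 H2 H3 H4].
  field.
Qed.

Lemma arc_D_derive (z g rho : R) (k : nat) (th : R) : rho * sin g = 1 ->
  is_derive (arc_D z g rho k) th ((2 * INR k + 1) * arc_f z g rho k th
    + (- (2 * INR k) * (rho * arc_A g rho th ^ pred k * exp (arc_P z g rho th) * cos (arc_Q z rho th - INR k * th))
       + - (z ^ 2 / (2 * (INR k + 1))) * arc_f z g rho (S k) th)).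
Proof.
  intros Hg. pose proof (pos_INR k).
  set (A := arc_A g rho). set (E := fun th => exp (arc_P z g rho th)).
  set (phi := fun th => arc_Q z rho th - INR k * th).
  set (w := z / (2 * (INR k + 1))).
  assert (Hg2 : rho ^ 2 * cos g ^ 2 = rho ^ 2 - 1).
  { pose proof (sin2_cos2 g) as F. unfold Rsqr in F.
    replace (cos g ^ 2) with (1 - sin g * sin g) by lra.
    replace (rho ^ 2 * (1 - sin g * sin g)) with (rho ^ 2 - (rho * sin g) ^ 2) by ring. rewrite Hg. ring. }
  assert (Hs2 : sin th ^ 2 = 1 - cos th ^ 2) by (pose proof (sin2_cos2 th) as F; unfold Rsqr in F; simpl; lra).
  assert (Hw : INR k * w = z / 2 - w) by (unfold w; field; lra).
  assert (Ha : INR k * A th ^ k = INR k * (2 * rho ^ 2 * (cos th - cos g) * A th ^ pred k)).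
  { unfold A, arc_A. destruct k. simpl; ring. simpl pred. simpl pow. ring. }
  assert (DE : is_derive E th (z * rho * sin th * E th)).
  { unfold E, arc_P. auto_derive; auto. field_trig. }
  assert (DA : forall n, is_derive (fun th => A th ^ n) th (INR n * (- 2 * rho ^ 2 * sin th) * A th ^ pred n)).
  { intros n. apply (is_derive_pow A). unfold A, arc_A. auto_derive; auto; ring. }
  assert (Dphi : is_derive phi th (z * rho * cos th - INR k)).
  { unfold phi, arc_Q. auto_derive; auto; ring. }
  set (q := z * rho * cos th - INR k) in *.
  assert (DC : is_derive (fun th => cos (phi th)) th (q * - sin (phi th))).
  { apply (is_derive_Rcomp cos phi); auto. apply is_derive_cos. }
  assert (DS : is_derive (fun th => sin (phi th)) th (q * cos (phi th))).
  { apply (is_derive_Rcomp sin phi); auto. apply is_derive_sin. }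
  assert (DS2 : is_derive (fun th => sin (phi th - th)) th ((q - 1) * cos (phi th - th))).
  { apply (is_derive_Rcomp sin (fun th => phi th - th)). apply is_derive_sin.
    apply is_derive_Rminus; auto. apply (is_derive_id (K := R_AbsRing)). }
  apply is_derive_ext with (fun th => E th * (A th ^ k * (rho * sin th * cos (phi th) - rho * (cos th - cos g) * sin (phi th))
     - w * (A th ^ S k * sin (phi th - th)))).
  { intros t. unfold arc_D, A, E, phi, w.
    replace (arc_Q z rho t - (INR k + 1) * t) with (arc_Q z rho t - INR k * t - t) by ring. eq_in_R. ring. }
  unfold arc_f. fold (A th) (E th) (phi th).
  rewrite (S_INR k). 
  replace (arc_Q z rho th - (INR k + 1) * th) with (phi th - th) by (unfold phi; ring).
  replace (arc_Q z rho th - (INR k + 1 + 1) * th) with (phi th - 2 * th) by (unfold phi; ring).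
  match goal with |- is_derive _ _ ?d => replace d with (z * rho * sin th * E th * (A th ^ k * (rho * sin th * cos (phi th) - rho * (cos th - cos g) * sin (phi th)) - w * (A th ^ S k * sin (phi th - th)))
     + E th * ((INR k * (- 2 * rho ^ 2 * sin th) * A th ^ pred k) * (rho * sin th * cos (phi th) - rho * (cos th - cos g) * sin (phi th))
         + A th ^ k * ((rho * cos th * cos (phi th) + rho * sin th * (q * - sin (phi th))) - (- rho * sin th * sin (phi th) + rho * (cos th - cos g) * (q * cos (phi th))))
         - w * ((INR (S k) * (- 2 * rho ^ 2 * sin th) * A th ^ pred (S k)) * sin (phi th - th) + A th ^ S k * ((q - 1) * cos (phi th - th))))) end.
  - apply (is_derive_Rmult E (fun th => A th ^ k * (rho * sin th * cos (phi th) - rho * (cos th - cos g) * sin (phi th))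
     - w * (A th ^ S k * sin (phi th - th)))); auto.
    apply (is_derive_Rminus (fun th => A th ^ k * (rho * sin th * cos (phi th) - rho * (cos th - cos g) * sin (phi th)))
      (fun th => w * (A th ^ S k * sin (phi th - th)))).
    + apply (is_derive_Rmult (fun th => A th ^ k) (fun th => rho * sin th * cos (phi th) - rho * (cos th - cos g) * sin (phi th))); auto.
      apply (is_derive_Rminus (fun th => rho * sin th * cos (phi th)) (fun th => rho * (cos th - cos g) * sin (phi th))).
      * apply (is_derive_Rmult (fun th => rho * sin th) (fun th => cos (phi th))); auto.
        auto_derive; auto; ring.
      * apply (is_derive_Rmult (fun th => rho * (cos th - cos g)) (fun th => sin (phi th))); auto.
        auto_derive; auto; ring.
    + apply (is_derive_scal (fun th => A th ^ S k * sin (phi th - th)) th w).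
      apply (is_derive_Rmult (fun th => A th ^ S k) (fun th => sin (phi th - th))); auto.
  - pose proof (arc_algebra z rho (sin th) (cos th) (cos g) (cos (phi th)) (sin (phi th)) (E th) (A th ^ pred k) (A th ^ k) (INR k) w Hs2 Hg2 Hw Ha) as G.
    cbv zeta in G. fold q in G.
    rewrite (sin_minus (phi th) th), (cos_minus (phi th) th), (cos_minus (phi th) (2 * th)), cos_2a_cos, sin_2a.
    simpl pred. rewrite S_INR.
    replace (A th ^ S k) with (2 * rho ^ 2 * (cos th - cos g) * A th ^ k) by (simpl; unfold A, arc_A; ring).
    replace (z ^ 2 / (2 * (INR k + 1))) with (z * w) by (unfold w; field; lra).
    eq_in_R. lra.
Qed.

(** For k = 0 the boundary term at t = 1 survives and equals cos z. *)
Lemma arc_int_base (z g rho : R) : rho * sin g = 1 ->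
  arc_int z g rho 0 - z ^ 2 / 2 * arc_int z g rho 1 = cos z.
Proof.
  intros Hg. unfold arc_int.
  assert (E : 1 * RInt (arc_f z g rho 0) 0 g + - (z ^ 2 / 2) * RInt (arc_f z g rho 1) 0 g = cos z); [| lra].
  rewrite <- RInt_lin by apply arc_f_cont.
  rewrite (RInt_FTC (arc_D z g rho 0)).
  - unfold arc_D, arc_P, arc_Q, arc_A. simpl INR. simpl pow.
    replace (z * rho * sin g) with z by (rewrite Rmult_assoc, Hg; ring).
    replace (z * rho * (cos g - cos g)) with 0 by ring. rewrite sin_0, exp_0.
    replace (z - 0 * g) with z by ring. replace (z * rho * 0 - 0 * 0) with 0 by ring.
    replace (z * rho * 0 - (0 + 1) * 0) with 0 by ring. rewrite sin_0, cos_0.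
    replace (rho * 1) with rho by ring. rewrite Hg. ring.
  - intros th. change R in th.
    replace (1 * arc_f z g rho 0 th + - (z ^ 2 / 2) * arc_f z g rho 1 th) with
      ((2 * INR 0 + 1) * arc_f z g rho 0 th
    + (- (2 * INR 0) * (rho * arc_A g rho th ^ pred 0 * exp (arc_P z g rho th) * cos (arc_Q z rho th - INR 0 * th))
       + - (z ^ 2 / (2 * (INR 0 + 1))) * arc_f z g rho 1 th)).
    + now apply arc_D_derive.
    + change (INR 0) with 0. field.
  - intros th. apply continuous_lin; apply arc_f_cont.
Qed.

(** For exponent at least 1 both boundary terms of [arc_D] vanish: A = 0 at th = g, and the sines
    vanish at th = 0. *)
Lemma arc_int_rec (z g rho : R) (j : nat) : rho * sin g = 1 ->
  (2 * INR j + 3) * arc_int z g rho (S j) - 2 * (INR j + 1) * arc_int z g rho j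
    = z ^ 2 / (2 * (INR j + 2)) * arc_int z g rho (S (S j)).
Proof.
  intros Hg. unfold arc_int. pose proof (pos_INR j).
  set (u := - (2 * (INR j + 1))). set (v := - (z ^ 2 / (2 * (INR j + 2)))).
  assert (Hc : forall k th, continuous (arc_f z g rho k) th) by (intros; apply arc_f_cont).
  assert (Hc2 : forall th, continuous (fun th => u * arc_f z g rho j th + v * arc_f z g rho (S (S j)) th) th).
  { intros th. apply continuous_lin; auto. }
  assert (E : (2 * INR j + 3) * RInt (arc_f z g rho (S j)) 0 g + 1 * RInt (fun th => u * arc_f z g rho j th + v * arc_f z g rho (S (S j)) th) 0 g = 0).
  { rewrite <- RInt_lin by auto.
    rewrite (RInt_FTC (arc_D z g rho (S j))).
    - unfold arc_D, arc_Q, arc_A. rewrite sin_0. rewrite Rminus_diag, !Rmult_0_r.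
      rewrite !pow_i by lia. rewrite Rminus_diag, sin_0. ring.
    - intros th. change R in th.
      replace ((2 * INR j + 3) * arc_f z g rho (S j) th + 1 * (u * arc_f z g rho j th + v * arc_f z g rho (S (S j)) th)) with
      ((2 * INR (S j) + 1) * arc_f z g rho (S j) th
    + (- (2 * INR (S j)) * (rho * arc_A g rho th ^ pred (S j) * exp (arc_P z g rho th) * cos (arc_Q z rho th - INR (S j) * th))
       + - (z ^ 2 / (2 * (INR (S j) + 1))) * arc_f z g rho (S (S j)) th)).
      + now apply arc_D_derive.
      + simpl pred. rewrite S_INR. unfold u, v.
        replace (rho * arc_A g rho th ^ j * exp (arc_P z g rho th) * cos (arc_Q z rho th - (INR j + 1) * th)) with (arc_f z g rho j th) by reflexivity.
        field. lra.
    - intros th. apply continuous_lin; auto. }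
  rewrite RInt_lin in E by auto. unfold u, v in E. lra.
Qed.

(** Poisson's integral for Bessel functions on the deformed path, again by matching recurrences. *)
Lemma arc_int_Phi (z g rho : R) (k : nat) : 0 < z -> rho * sin g = 1 ->
  arc_int z g rho k = wallis k / 2 * Phi (S k) (z ^ 2 / 4).
Proof.
  intros Hz Hg.
  induction k as [| | j IH1 IH2] using nat_ind2.
  - rewrite arc_int_0, <- Phi_1_sin by auto. simpl. field. lra.
  - pose proof (arc_int_base z g rho Hg) as E. rewrite arc_int_0 in E by auto.
    pose proof (Phi_recurrence 0 (z ^ 2 / 4)) as F. rewrite Phi_0_cos in F.
    pose proof (Phi_1_sin z) as G.
    replace (sin z / z) with (Phi 1 (z ^ 2 / 4)) in E by (rewrite <- G; field; lra).
    change (INR 0) with 0 in F.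
    assert (z ^ 2 / 2 * arc_int z g rho 1 = z ^ 2 / 2 * (wallis 1 / 2 * Phi 2 (z ^ 2 / 4))).
    { replace (z ^ 2 / 2 * (wallis 1 / 2 * Phi 2 (z ^ 2 / 4))) with (z ^ 2 / 4 * Phi 2 (z ^ 2 / 4) / ((0 + 1 / 2) * (0 + 3 / 2))).
      2:{ simpl wallis. field. }
      lra. }
    apply Rmult_eq_reg_l with (z ^ 2 / 2); auto. apply Rgt_not_eq. assert (0 < z ^ 2) by now apply pow_lt. lra.
  - pose proof (arc_int_rec z g rho j Hg) as E. rewrite IH1, IH2 in E.
    pose proof (Phi_recurrence (S j) (z ^ 2 / 4)) as F. rewrite S_INR in F.
    pose proof (pos_INR j). assert (Hz2 : 0 < z ^ 2) by now apply pow_lt.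
    apply Rmult_eq_reg_l with (z ^ 2 / (2 * (INR j + 2))).
    2:{ apply Rgt_not_eq. apply Rdiv_lt_0_compat; lra. }
    rewrite <- E.
    change (wallis (S (S j))) with ((2 * INR (S j) + 2) / (2 * INR (S j) + 3) * ((2 * INR j + 2) / (2 * INR j + 3) * wallis j)).
    change (wallis (S j)) with ((2 * INR j + 2) / (2 * INR j + 3) * wallis j).
    rewrite F, S_INR. field. lra.
Qed.

Lemma ln_1_minus_bounds (w : R) : 0 <= w <= 1 / 2 -> - w - w ^ 2 <= ln (1 - w) <= - w.
Proof.
  intros Hw. split.
  - apply (le_of_derive_le (fun x => - x - x ^ 2) (fun x => - 1 - 2 * x) (fun x => ln (1 - x)) (fun x => - / (1 - x)) 0 w ltac:(lra)).
    + intros y Hy. auto_derive; auto; ring.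
    + intros y Hy. auto_derive. lra. field. lra.
    + intros y Hy. apply Rmult_le_reg_r with (1 - y). lra. rewrite Ropp_mult_distr_l_reverse, Rinv_l by lra. nra.
    + replace (1 - 0) with 1 by ring. rewrite ln_1. lra.
  - rewrite <- (ln_exp (- w)). apply ln_le. lra. pose proof (exp_ge_1_plus (- w)). lra.
Qed.

Lemma exp_pow_nat (x : R) (n : nat) : exp x ^ n = exp (INR n * x).
Proof.
  induction n. simpl. now rewrite Rmult_0_l, exp_0.
  rewrite S_INR. simpl. rewrite IHn, <- exp_plus. f_equal. ring.
Qed.

(* With th = t / r and u = 1 - 1/r, the arc passes just below the degenerate saddle point t = i. *)
Lemma arc_phase_bounds (k : nat) (r th u : R) : 2 <= r -> 2 * r ^ 3 = INR k + 1 / 2 -> u = 1 - / r ->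
  0 <= th <= PI ->
  let nu := 2 * r ^ 3 in let a := (1 + u ^ 2) / (2 * u ^ 2) in let rho := (1 + u ^ 2) / (2 * u) in
  let d := 1 - cos th in let t := r * th in
  a * d <= 1 ->
  Rabs ((1 - a * d) ^ k * exp (nu * rho * d) * cos ((INR k + 1) * th - nu * rho * sin th) - airy_g0 0 t)
    <= 2 * 4 / r * ((1 + t + t ^ 2 + t ^ 3 + t ^ 4) * exp (- (/ 18 * t ^ 2))).
Proof.
  intros Hr Hk Hu Hth nu a rho d t Had.
  set (h := / r) in *.
  assert (Hrh : r * h = 1) by (unfold h; field; lra).
  assert (Hh : 0 < h) by (unfold h; apply Rinv_0_lt_compat; lra).
  assert (Hh2 : h <= 1 / 2) by nra.
  assert (Hu2 : 1 / 2 <= u < 1) by lra.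
  assert (Hd : th ^ 2 / 18 <= d) by (apply one_minus_cos_ge; lra).
  assert (Hd1 : d <= th ^ 2 / 2) by (unfold d; pose proof (cos_ge_2 th); lra).
  assert (Hd2 : th ^ 2 / 2 - th ^ 4 / 24 <= d) by (unfold d; pose proof (cos_le_4 th); lra).
  assert (Hd0 : 0 <= d) by (pose proof (pow2_ge_0 th); lra).
  assert (Ha1 : a = 1 + h * (1 + u) / (2 * u ^ 2)) by (unfold a; replace h with (1 - u) by lra; field; lra).
  assert (Hu4 : 1 / 4 <= u ^ 2) by nra.
  assert (Haw : 0 <= h * (1 + u) / (2 * u ^ 2) <= 3 * h).
  { split. apply Rmult_le_pos; [nra | left; apply Rinv_0_lt_compat; nra].
    apply Rmult_le_reg_r with (2 * u ^ 2); [nra |].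
    replace (h * (1 + u) / (2 * u ^ 2) * (2 * u ^ 2)) with (h * (1 + u)) by (field; lra). nra. }
  assert (Ha : 1 <= a <= 5 / 2) by lra.
  assert (Hrho : rho = 1 + h ^ 2 / (2 * u)) by (unfold rho; replace h with (1 - u) by lra; field; lra).
  assert (Hrw : 0 <= h ^ 2 / (2 * u) <= h ^ 2).
  { split. apply Rmult_le_pos; [nra | left; apply Rinv_0_lt_compat; lra].
    apply Rmult_le_reg_r with (2 * u); [lra |].
    replace (h ^ 2 / (2 * u) * (2 * u)) with (h ^ 2) by (field; lra). nra. }
  assert (Hr2 : 0 < r ^ 2) by nra. assert (Hr3 : 0 < r ^ 3) by (apply pow_lt; lra).
  assert (Hnuh : nu * h = 2 * r ^ 2). { unfold nu. replace (2 * r ^ 3 * h) with (2 * r ^ 2 * (r * h)) by ring. rewrite Hrh. ring. }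
  (* The growth e^(nu rho d) cancels the leading decay e^(-nu a d) of the power; what remains, - 2
     r^2 a d, is due to the offset 1/r alone. *)
  assert (Hnurho : nu * rho * d = nu * a * d - 2 * r ^ 2 * a * d).
  { replace (2 * r ^ 2) with (nu * h) by auto. replace h with (1 - u) by lra. unfold rho, a. field. lra. }
  assert (Ek : INR k = nu - 1 / 2) by (unfold nu; lra).
  assert (Ht : 0 <= t) by (unfold t; nra).
  assert (Ht1 : 0 <= t ^ 2 /\ 0 <= t ^ 3 /\ 0 <= t ^ 4) by (repeat split; now apply pow_le).
  assert (Hth2 : 0 <= th ^ 2) by nra. assert (Hth4 : 0 <= th ^ 4) by (apply pow_le; lra).
  assert (Ht2 : t ^ 2 = r ^ 2 * th ^ 2) by (unfold t; ring).
  assert (Ht4 : 1 / r * t ^ 4 = r ^ 3 * th ^ 4) by (unfold t; field; lra).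
  assert (Ht2' : 1 / r * t ^ 2 = r * th ^ 2) by (unfold t; field; lra).
  assert (Ht1' : 1 / r * t = th) by (unfold t; field; lra).
  assert (Hir : 0 <= 1 / r) by (unfold Rdiv; rewrite Rmult_1_l; fold h; lra).
  assert (Ht3p : 0 <= 1 / r * t ^ 3) by (apply Rmult_le_pos; lra).
  assert (Hsplit : 4 / r * (1 + t + t ^ 2 + t ^ 3 + t ^ 4) = 4 * (1 / r) + 4 * th + 4 * (r * th ^ 2) + 4 * (1 / r * t ^ 3) + 4 * (r ^ 3 * th ^ 4)).
  { rewrite <- Ht4, <- Ht2', <- Ht1'. field. lra. }
  set (w := a * d) in *.
  assert (Hw0 : 0 <= w) by (unfold w; apply Rmult_le_pos; lra).
  assert (Hr2d : r ^ 2 * th ^ 2 / 18 <= r ^ 2 * w).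
  { assert (d <= w) by (unfold w; rewrite <- (Rmult_1_l d) at 1; apply Rmult_le_compat_r; lra). replace (r ^ 2 * th ^ 2 / 18) with (r ^ 2 * (th ^ 2 / 18)) by field. apply Rmult_le_compat_l; lra. }
  assert (Hexp : - INR k * w + nu * rho * d <= - (/ 18 * t ^ 2)).
  { rewrite Hnurho, Ek, Ht2. fold w. replace (- (nu - 1 / 2) * w + (nu * a * d - 2 * r ^ 2 * a * d)) with (w / 2 - 2 * (r ^ 2 * w)) by (unfold w; field).
    assert (w <= r ^ 2 * w) by (rewrite <- (Rmult_1_l w) at 1; apply Rmult_le_compat_r; [auto | nra]). lra. }
  (* For w <= 1/2 the logarithm can be expanded. Otherwise th is bounded below, the polynomial
     factor exceeds 2, and it suffices that both integrands are at most e^(-t^2/18). *)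
  destruct (Rle_dec w (1 / 2)) as [Hw | Hw].
  - destruct (ln_1_minus_bounds w ltac:(lra)) as [L1 L2].
    set (l := ln (1 - w)) in *.
    replace ((1 - w) ^ k * exp (nu * rho * d)) with (exp (INR k * l + nu * rho * d)).
    2:{ rewrite exp_plus. f_equal. unfold l. rewrite <- ln_pow_nat by lra. apply exp_ln. apply pow_lt; lra. }
    pose proof (pos_INR k).
    apply exp_cos_compare; try lra.
    + rewrite Hsplit.
      replace (INR k * l + nu * rho * d + t ^ 2) with (INR k * (l + w) + w / 2 + r ^ 2 * (th ^ 2 - 2 * d) - 2 * r ^ 2 * (a - 1) * d).
      2:{ rewrite Hnurho, Ht2, Ek. unfold w. field. }
      assert (Hkw : - (4 * (r ^ 3 * th ^ 4)) <= INR k * (l + w) <= 0).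
      { assert (w ^ 2 <= 2 * th ^ 4).
        { apply Rle_trans with ((5 / 2 * (th ^ 2 / 2)) ^ 2).
          - apply pow_incr. split; auto. unfold w. apply Rmult_le_compat; lra.
          - replace ((5 / 2 * (th ^ 2 / 2)) ^ 2) with (25 / 16 * th ^ 4) by field. lra. }
        split; [| nra].
        apply Rle_trans with (- (2 * r ^ 3 * (2 * th ^ 4))). right; ring.
        apply Rle_trans with (- (INR k * w ^ 2)); [| nra].
        apply Ropp_le_contravar. apply Rmult_le_compat; try lra; unfold nu in Ek; lra. }
      assert (Hrth : th ^ 2 <= r * th ^ 2) by nra.
      assert (Hw1 : 0 <= w / 2 <= r * th ^ 2).
      { split; [lra |]. assert (w <= 5 / 2 * (th ^ 2 / 2)) by (unfold w; apply Rmult_le_compat; lra). lra. }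
      assert (A1 : 0 <= r ^ 2 * (th ^ 2 - 2 * d) <= r ^ 3 * th ^ 4).
      { split. apply Rmult_le_pos; lra.
        apply Rle_trans with (r ^ 2 * th ^ 4). apply Rmult_le_compat_l; lra. apply Rmult_le_compat_r; auto. nra. }
      assert (A2 : 0 <= 2 * r ^ 2 * (a - 1) * d <= 3 * (r * th ^ 2)).
      { split. apply Rmult_le_pos; [apply Rmult_le_pos |]; lra.
        apply Rle_trans with (2 * r ^ 2 * (3 * h) * (th ^ 2 / 2)).
        - apply Rmult_le_compat; try lra. apply Rmult_le_pos; lra. apply Rmult_le_compat_l; lra.
        - replace (2 * r ^ 2 * (3 * h) * (th ^ 2 / 2)) with (3 * (r * (r * h) * th ^ 2)) by field. rewrite Hrh. right; ring. }
      assert (0 <= r ^ 3 * th ^ 4) by (apply Rmult_le_pos; lra). 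
      apply Rabs_le. lra.
    + rewrite Hsplit.
      pose proof (sin_ge_3 th ltac:(lra)) as S1. pose proof (sin_le_5 th ltac:(lra)) as S2.
      set (e1 := sin th - (th - th ^ 3 / 6)).
      assert (He1 : 0 <= e1 <= th ^ 5 / 120) by (unfold e1; lra).
      replace ((INR k + 1) * th - nu * rho * sin th - (t ^ 3 / 3 - t)) with
        (th / 2 - th * (h / u) * r + t ^ 3 / 3 * (h ^ 2 / (2 * u)) - nu * rho * e1).
      2:{ rewrite Hrho, Ek. unfold e1, nu, t. replace h with (1 - u) by lra.
          assert (Er : r = / (1 - u)) by (replace (1 - u) with h by lra; unfold h; rewrite Rinv_inv; auto).
          rewrite Er. field. lra. }
      assert (B1 : 0 <= th * (h / u) * r <= 2 * th).
      { replace (th * (h / u) * r) with (th * (r * h) * / u) by (unfold Rdiv; ring). rewrite Hrh.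
        assert (0 < / u <= 2). { split. apply Rinv_0_lt_compat; lra. replace 2 with (/ (1 / 2)) by field. apply Rinv_le_contravar; lra. }
        nra. }
      assert (B2 : 0 <= t ^ 3 / 3 * (h ^ 2 / (2 * u)) <= 1 / r * t ^ 3).
      { replace (1 / r) with h by (unfold h; field; lra).
        split. apply Rmult_le_pos; lra.
        apply Rle_trans with (t ^ 3 / 3 * h ^ 2). apply Rmult_le_compat_l; lra.
        assert (h ^ 2 <= h) by nra. nra. }
      pose proof PI_4.
      assert (Hth5 : 0 <= th ^ 5 <= 4 * th ^ 4). { replace (th ^ 5) with (th * th ^ 4) by ring. nra. }
      assert (B3 : 0 <= nu * rho * e1 <= r ^ 3 * th ^ 4).
      { assert (0 <= rho <= 2) by nra. unfold nu. replace (2 * r ^ 3 * rho * e1) with (r ^ 3 * (2 * rho * e1)) by ring.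
        split. apply Rmult_le_pos; [lra |]. apply Rmult_le_pos; lra.
        apply Rmult_le_compat_l; [lra |].
        apply Rle_trans with (2 * 2 * (th ^ 5 / 120)). apply Rmult_le_compat; try lra. lra. }
      assert (0 <= r * th ^ 2) by (apply Rmult_le_pos; lra).
      apply Rabs_le. lra.
    + nra.
  - assert (Hr3t : 2 <= 2 * 4 / r * (1 + t + t ^ 2 + t ^ 3 + t ^ 4)).
    { replace (2 * 4 / r * (1 + t + t ^ 2 + t ^ 3 + t ^ 4)) with (2 * (4 / r * (1 + t + t ^ 2 + t ^ 3 + t ^ 4))) by (field; lra).
      rewrite Hsplit.
      assert (w <= 5 / 2 * (th ^ 2 / 2)) by (unfold w; apply Rmult_le_compat; lra).
      assert (th ^ 2 <= r * th ^ 2) by nra. assert (0 <= r ^ 3 * th ^ 4) by (apply Rmult_le_pos; lra). lra. }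
    pose proof (exp_pos (- (/ 18 * t ^ 2))) as HE.
    rewrite <- Rmult_assoc.
    apply Rle_trans with (2 * exp (- (/ 18 * t ^ 2))); [| apply Rmult_le_compat_r; lra].
    eapply Rle_trans. apply Rabs_triang. rewrite Rabs_Ropp.
    replace (2 * exp (- (/ 18 * t ^ 2))) with (exp (- (/ 18 * t ^ 2)) + exp (- (/ 18 * t ^ 2))) by ring.
    assert (Hcc : forall p c, 0 <= p <= exp (- (/ 18 * t ^ 2)) -> Rabs (p * cos c) <= exp (- (/ 18 * t ^ 2))).
    { intros p c Hp. rewrite Rabs_mult, (Rabs_pos_eq p) by lra. pose proof (Rabs_cos_le_1 c). pose proof (Rabs_pos (cos c)). nra. }
    apply Rplus_le_compat.
    + apply Hcc. split.
      * apply Rmult_le_pos. apply pow_le; lra. left; apply exp_pos.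
      * apply Rle_trans with (exp (- w) ^ k * exp (nu * rho * d)).
        -- apply Rmult_le_compat_r. left; apply exp_pos. apply pow_incr. pose proof (exp_ge_1_plus (- w)). lra.
        -- rewrite exp_pow_nat, <- exp_plus. apply exp_le. lra.
    + unfold airy_g0. apply Hcc. split. left; apply exp_pos. apply exp_le. lra.
Qed.

(** The saddle points of (1 - t^2)^nu e^(i nu t) coalesce at t = i. The divisor, named [J] in the
    proof, is the value of the arc integrand at th = 0. *)
Lemma Phi_turning_point : exists C, 0 <= C /\ forall k r, 2 <= r -> 2 * r ^ 3 = INR k + 1 / 2 ->
  let nu := 2 * r ^ 3 in let u := 1 - / r in
  Rabs (wallis k / 2 * Phi (S k) (nu ^ 2 / 4) * (r / ((1 + u ^ 2) / (2 * u) * (1 + u ^ 2) ^ k * exp (- (nu * u)))) - airy_K0 0) <= C / r.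
Proof.
  (* 2 * 4 is the constant of [arc_phase_bounds]; the cut-off g r is at least r/2 since g >= sin g
     >= 1/2. *)
  destruct (airy_integral_compare (2 * 4) (1 / 2) ltac:(lra) ltac:(lra)) as [C [HC H]]. exists C. split; auto.
  intros k r Hr Hk nu u.
  assert (Hh : 0 < / r <= 1 / 2) by (apply inv_le_half; lra).
  assert (Hu : 1 / 2 <= u < 1) by (unfold u; lra).
  assert (Hu4 : 1 / 4 <= u ^ 2 < 1) by nra.
  assert (Hnu : 0 < nu) by (unfold nu; assert (0 < r ^ 3) by (apply pow_lt; lra); lra).
  (* The cosine of the half opening angle of the circle through -1, i u and 1: rho (1 - c0) = u and
     rho sin g = 1. *)
  set (c0 := (1 - u ^ 2) / (1 + u ^ 2)).
  assert (Hc0 : 0 < c0 < 1).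
  { unfold c0. split. apply Rdiv_lt_0_compat; lra. apply Rmult_lt_reg_r with (1 + u ^ 2); [lra |].
    replace ((1 - u ^ 2) / (1 + u ^ 2) * (1 + u ^ 2)) with (1 - u ^ 2) by (field; lra). lra. }
  set (g := acos c0).
  assert (Hcg : cos g = c0) by (apply cos_acos; lra).
  assert (Hg : 0 <= g <= PI) by (unfold g; apply acos_bound).
  set (rho := (1 + u ^ 2) / (2 * u)).
  assert (Hsg : sin g = / rho).
  { unfold g. rewrite sin_acos by lra. replace (1 - Rsqr c0) with (Rsqr (/ rho)).
    - apply sqrt_Rsqr. left. apply Rinv_0_lt_compat. unfold rho. apply Rdiv_lt_0_compat; lra.
    - unfold Rsqr, c0, rho. field. split; lra. }
  assert (Hrho : 0 < rho) by (unfold rho; apply Rdiv_lt_0_compat; lra).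
  assert (Hrg : rho * sin g = 1) by (rewrite Hsg; field; lra).
  rewrite <- (arc_int_Phi nu g rho k Hnu Hrg).
  unfold arc_int. rewrite (RInt_rescale _ r g); [| lra | apply arc_f_cont].
  set (J := rho * (1 + u ^ 2) ^ k * exp (- (nu * u))).
  assert (HJ : 0 < J).
  { unfold J. apply Rmult_lt_0_compat; [apply Rmult_lt_0_compat; [auto | apply pow_lt; lra] | apply exp_pos]. }
  set (F := fun t => / J * arc_f nu g rho k (t / r)).
  assert (Hfc : forall t, continuous (fun t => arc_f nu g rho k (t / r)) t).
  { intros t. apply (continuous_comp (fun t => t / r) (arc_f nu g rho k)). cont1. apply arc_f_cont. }
  assert (EF : RInt F 0 (g * r) = / J * RInt (fun t => arc_f nu g rho k (t / r)) 0 (g * r)).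
  { unfold F. apply (RInt_scal (V := R_CompleteNormedModule) (fun t => arc_f nu g rho k (t / r))). now apply ex_RInt_cont. }
  replace (RInt (fun t => arc_f nu g rho k (t / r)) 0 (g * r) / r * (r / J)) with (/ J * RInt (fun t => arc_f nu g rho k (t / r)) 0 (g * r)) by (field; lra).
  rewrite <- EF.
  apply H; try lra.
  - assert (1 / 2 <= sin g).
    { rewrite Hsg. unfold rho. apply Rmult_le_reg_r with ((1 + u ^ 2) / (2 * u)); auto. rewrite Rinv_l by now apply Rgt_not_eq.
      apply Rmult_le_reg_r with (2 * u); [lra |]. replace (1 / 2 * ((1 + u ^ 2) / (2 * u)) * (2 * u)) with ((1 + u ^ 2) / 2) by (field; lra). lra. }
    pose proof (sin_le_id g ltac:(lra)). apply Rmult_le_compat_r; lra.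
  - intros t. apply (continuous_mult (K := R_AbsRing) (fun _ => / J) (fun t => arc_f nu g rho k (t / r))); auto. apply continuous_const.
  - intros t Ht.
    assert (Hth : 0 <= t / r <= g).
    { split. apply Rmult_le_pos; lra. apply Rmult_le_reg_r with r; [lra |]. replace (t / r * r) with t by (field; lra). lra. }
    pose proof (arc_phase_bounds k r (t / r) u Hr Hk eq_refl ltac:(lra)) as B. cbv zeta in B.
    replace (r * (t / r)) with t in B by (field; lra).
    set (th := t / r) in *.
    assert (Hcc : c0 <= cos th). { rewrite <- Hcg. apply cos_decr_1; lra. }
    set (a := (1 + u ^ 2) / (2 * u ^ 2)) in *.
    assert (Hac : a * (1 - c0) = 1) by (unfold a, c0; field; lra).
    assert (Ha : 0 < a) by (unfold a; apply Rdiv_lt_0_compat; lra).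
    specialize (B ltac:(rewrite <- Hac; apply Rmult_le_compat_l; lra)).
    eapply Rle_trans; [| exact B]. right. f_equal. f_equal.
    unfold F, arc_f. fold th.
    replace (arc_A g rho th) with ((1 + u ^ 2) * (1 - a * (1 - cos th))).
    2:{ unfold arc_A, rho, a. rewrite Hcg. unfold c0. field. lra. }
    rewrite Rpow_mult_distr. unfold arc_P, arc_Q. fold nu. fold rho.
    replace (nu * rho * (cos g - cos th)) with (- (nu * u) + nu * rho * (1 - cos th)).
    2:{ unfold rho. rewrite Hcg. unfold c0. field. lra. }
    rewrite exp_plus.
    replace (cos (nu * rho * sin th - (INR k + 1) * th)) with (cos ((INR k + 1) * th - nu * rho * sin th)).
    2:{ rewrite <- cos_neg. f_equal. ring. }
    unfold J. field. repeat split; try lra. apply Rgt_not_eq, exp_pos. apply pow_nonzero; lra.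
Qed.

(** * Extreme zeros *)

Lemma exp_scaled_vanishes (C a : R) : 0 < a -> vanishes_oo (fun s => C * exp (- (a * s))).
Proof.
  intros Ha eps Heps. destruct (exp_neg_vanishes C eps Heps) as [A HA].
  exists (A / a). intros s Hs. apply HA.
  apply Rmult_le_compat_l with (r := a) in Hs; [| lra]. replace (a * (A / a)) with A in Hs by (field; lra). auto.
Qed.

Lemma exp_neg_bounds (y : R) : 0 <= y -> 1 - y <= exp (- y) <= 1 - y + y ^ 2 / 2.
Proof.
  intros Hy. split. pose proof (exp_ge_1_plus (- y)); lra.
  apply (le_of_derive_le (fun y => exp (- y)) (fun y => - exp (- y)) (fun y => 1 - y + y ^ 2 / 2) (fun y => -1 + y) 0 y Hy).
  - intros x _. auto_derive; auto; ring.
  - intros x _. auto_derive; auto; field.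
  - intros x Hx. pose proof (exp_ge_1_plus (- x)). lra.
  - rewrite Ropp_0, exp_0. lra.
Qed.

Lemma exp_le_quadratic (y : R) : 0 <= y <= 1 -> exp y <= 1 + y + y ^ 2.
Proof.
  intros Hy.
  assert (H : 1 <= (1 + y + y ^ 2) * exp (- y)).
  { apply (le_of_derive_le (fun _ => 1) (fun _ => 0) (fun y => (1 + y + y ^ 2) * exp (- y)) (fun y => y * (1 - y) * exp (- y)) 0 y ltac:(lra)).
    - intros x _. apply is_derive_Rconst.
    - intros x _. auto_derive; auto; ring.
    - intros x Hx. pose proof (exp_pos (- x)). apply Rmult_le_pos; [apply Rmult_le_pos |]; lra.
    - rewrite Ropp_0, exp_0. lra. }
  rewrite exp_Ropp in H. pose proof (exp_pos y).
  apply Rmult_le_compat_r with (r := exp y) in H; [| lra]. rewrite Rmult_assoc, Rinv_l in H by lra. lra.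
Qed.

Lemma bessel_potential_bound (r S s : R) : 0 < r -> 0 < S -> S <= r ^ 2 -> - S <= s ->
  Rabs (r ^ 2 * (1 - exp (- (s / r ^ 2))) - s) <= / r ^ 2 * s ^ 2.
Proof.
  intros Hr HS HSr Hs. assert (Hr2 : 0 < r ^ 2) by (apply pow_lt; lra).
  set (y := s / r ^ 2). assert (Es : s = r ^ 2 * y) by (unfold y; field; lra).
  replace (/ r ^ 2 * s ^ 2) with (r ^ 2 * y ^ 2) by (rewrite Es; field; lra).
  replace (r ^ 2 * (1 - exp (- y)) - s) with (r ^ 2 * (1 - y - exp (- y))) by (rewrite Es; ring).
  rewrite Rabs_mult, (Rabs_pos_eq (r ^ 2)) by lra. apply Rmult_le_compat_l; [lra |].
  pose proof (pow2_ge_0 y).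
  destruct (Rle_dec 0 y) as [Hy | Hy].
  - pose proof (exp_neg_bounds y Hy). apply Rabs_le. lra.
  - assert (- 1 <= y).
    { unfold y. apply Rmult_le_reg_r with (r ^ 2); auto. replace (s / r ^ 2 * r ^ 2) with s by (field; lra). lra. }
    pose proof (exp_le_quadratic (- y) ltac:(lra)) as H1. pose proof (exp_ge_1_plus (- y)).
    replace ((- y) ^ 2) with (y ^ 2) in H1 by ring. apply Rabs_le. lra.
Qed.

(* In the variable s given by X = nu^2 e^(-s/r^2) / 4, the function e^(-rs) Phi (k+1) X solves f'' = q f
   with q = r^2 (1 - e^(-s/r^2)): this is Bessel's equation near its turning point. *)
Lemma Phi_zero_near_Ai_zero (i1 : R) : Ai i1 = 0 -> (forall x, i1 < x -> Ai x <> 0) ->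
  exists C r0, 0 < C /\ 1 <= r0 /\ forall k r X0, r0 <= r -> 2 * r ^ 3 = INR k + 1 / 2 -> is_first_zero (Phi (S k)) X0 ->
    exists s0 l, Rabs (s0 - i1) <= C / r ^ 2 /\ Rabs (l - dAi i1 / Ai 0) <= C / r ^ 2 /\
      Rabs (Phi k X0) = Rabs l * Rabs (Phi (S k) ((2 * r ^ 3) ^ 2 / 4)) * exp (r * s0) / (2 * r).
Proof.
  intros Hz Hnz. destruct (turning_point i1 Hz Hnz) as [C [e0 [HC [He0 H]]]].
  pose proof (Ai_zero_neg i1 Hz Hnz) as Hi1.
  (* r >= 1 + 1/e0 gives 1/r^2 <= e0, and r^2 >= 1 - i1 gives s / r^2 >= -1 on the whole range, as
     the potential bound requires. *)
  exists C, (1 + / e0 + (1 - i1)).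
  assert (Hie : 0 < / e0) by now apply Rinv_0_lt_compat.
  split; auto. split; [lra |].
  intros k r X0 Hr Hk [HX [HX0 HXp]].
  assert (Hrr : r <= r ^ 2) by nra.
  assert (Hr2 : 0 < r ^ 2) by nra.
  pose proof (pos_INR k) as Hk0.
  set (nu := 2 * r ^ 3) in *.
  set (X := fun s => nu ^ 2 * exp (- (s / r ^ 2)) / 4).
  set (f := fun s => exp (- (r * s)) * Phi (S k) (X s)).
  set (f1 := fun s => exp (- (r * s)) * (- r * Phi (S k) (X s) + / r ^ 2 * X s * Phi (S (S k)) (X s) / (nu + 1))).
  set (q := fun s => r ^ 2 * (1 - exp (- (s / r ^ 2)))).
  assert (HXpos : forall s, 0 < X s).
  { intros s. unfold X. pose proof (exp_pos (- (s / r ^ 2))). assert (0 < nu ^ 2) by (apply pow_lt; lra).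
    apply Rmult_lt_0_compat; [apply Rmult_lt_0_compat |]; lra. }
  assert (DX : forall s, is_derive X s (- / r ^ 2 * X s)).
  { intros s. unfold X. auto_derive; auto. field_trig. }
  assert (DPhi : forall j s, is_derive (fun s => Phi j (X s)) s (- / r ^ 2 * X s * - (Phi (S j) (X s) / (INR j + 1 / 2)))).
  { intros j s. apply (is_derive_Rcomp (Phi j) X); auto. apply is_derive_Phi. }
  assert (DE : forall s, is_derive (fun s => exp (- (r * s))) s (- r * exp (- (r * s)))).
  { intros s. auto_derive; auto; ring. }
  assert (Df : forall s, is_derive f s (f1 s)).
  { intros s. unfold f.
    replace (f1 s) with (- r * exp (- (r * s)) * Phi (S k) (X s) + exp (- (r * s)) * (- / r ^ 2 * X s * - (Phi (S (S k)) (X s) / (INR (S k) + 1 / 2)))).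
    2:{ unfold f1. rewrite S_INR. replace (INR k + 1 + 1 / 2) with (nu + 1) by lra. field. lra. }
    apply (is_derive_Rmult (fun s => exp (- (r * s))) (fun s => Phi (S k) (X s))); auto. }
  assert (Df1 : forall s, is_derive f1 s (q s * f s)).
  { intros s. unfold f1.
    set (u := / r ^ 2).
    apply is_derive_ext with (fun s => exp (- (r * s)) * (- r * Phi (S k) (X s) + u / (nu + 1) * (X s * Phi (S (S k)) (X s)))).
    { intros t. eq_in_R. unfold u. field. lra. }
    replace (q s * f s) with (- r * exp (- (r * s)) * (- r * Phi (S k) (X s) + u / (nu + 1) * (X s * Phi (S (S k)) (X s)))
      + exp (- (r * s)) * (- r * (- u * X s * - (Phi (S (S k)) (X s) / (INR (S k) + 1 / 2)))
        + u / (nu + 1) * (- u * X s * Phi (S (S k)) (X s) + X s * (- u * X s * - (Phi (S (S (S k))) (X s) / (INR (S (S k)) + 1 / 2)))))).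
    2:{ unfold q, f. rewrite !S_INR. replace (INR k + 1 + 1 / 2) with (nu + 1) by lra. replace (INR k + 1 + 1 + 1 / 2) with (nu + 2) by lra.
        pose proof (Phi_recurrence (S k) (X s)) as F. rewrite S_INR in F.
        replace (INR k + 1 + 1 / 2) with (nu + 1) in F by lra. replace (INR k + 1 + 3 / 2) with (nu + 2) in F by lra.
        assert (E3 : Phi (S (S (S k))) (X s) = (Phi (S (S k)) (X s) - Phi (S k) (X s)) * ((nu + 1) * (nu + 2)) / X s).
        { rewrite F. specialize (HXpos s). field. repeat split; lra. }
        rewrite E3.
        assert (EX : exp (- (s / r ^ 2)) = 4 * X s / nu ^ 2) by (unfold X; field; lra).
        rewrite EX. unfold u. specialize (HXpos s).
        generalize (exp (- (r * s))) (Phi (S (S k)) (X s)) (Phi (S k) (X s)). intros A B D.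
        assert (Hnu : nu = 2 * r ^ 3) by reflexivity. assert (Hr3 : 0 < r ^ 3) by (apply pow_lt; lra).
        clearbody nu. rewrite Hnu. generalize dependent (X s). intros x Hx. intros. field. repeat split; lra. }
    apply (is_derive_Rmult (fun s => exp (- (r * s))) (fun s => - r * Phi (S k) (X s) + u / (nu + 1) * (X s * Phi (S (S k)) (X s)))); auto.
    apply (is_derive_Rplus (fun s => - r * Phi (S k) (X s)) (fun s => u / (nu + 1) * (X s * Phi (S (S k)) (X s)))).
    - apply (is_derive_scal (fun s => Phi (S k) (X s)) s (- r)). apply DPhi.
    - apply (is_derive_scal (fun s => X s * Phi (S (S k)) (X s)) s (u / (nu + 1))).
      apply (is_derive_Rmult X (fun s => Phi (S (S k)) (X s))). apply DX. apply DPhi. }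
  destruct (H (/ r ^ 2) q f f1) as [Hf0 [s0 [_ [Hs0 [Hs0' [Hs0i Hl]]]]]]; auto.
  - split. now apply Rinv_0_lt_compat. rewrite <- (Rinv_inv e0). apply Rinv_le_contravar; lra.
  - intros s Hs. apply (bessel_potential_bound r (1 - i1) s); lra.
  - intros s Hs. unfold q. apply Rmult_le_pos; [lra |].
    assert (0 <= s / r ^ 2) by (apply Rmult_le_pos; [lra | left; now apply Rinv_0_lt_compat]).
    pose proof (exp_le (- (s / r ^ 2)) 0 ltac:(lra)). rewrite exp_0 in H1. lra.
  - intros eps Heps. destruct (exp_scaled_vanishes (exp (nu ^ 2 / 4)) r ltac:(lra) eps Heps) as [A HA].
    exists (Rmax A 0). intros s Hs. pose proof (Rmax_l A 0). pose proof (Rmax_r A 0).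
    eapply Rle_trans. 2: apply (HA s ltac:(lra)).
    rewrite (Rabs_pos_eq (_ * _)) by (apply Rmult_le_pos; left; apply exp_pos).
    unfold f. rewrite Rabs_mult, Rabs_pos_eq, Rmult_comm by (left; apply exp_pos).
    apply Rmult_le_compat_r. left; apply exp_pos.
    eapply Rle_trans. apply Phi_bound; lia. apply exp_le. rewrite Rabs_pos_eq by (left; apply HXpos).
    unfold X. assert (0 <= s / r ^ 2) by (apply Rmult_le_pos; [lra | left; now apply Rinv_0_lt_compat]).
    pose proof (exp_le (- (s / r ^ 2)) 0 ltac:(lra)) as H3. rewrite exp_0 in H3.
    pose proof (pow2_ge_0 nu). nra.
  (* As s grows, X s decreases to 0 and falls below the first zero X0, where Phi is positive. *)
  - intros A. destruct (exp_scaled_vanishes (nu ^ 2 / 4) (/ r ^ 2) ltac:(now apply Rinv_0_lt_compat) (X0 / 2) ltac:(lra)) as [B HB].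
    exists (Rmax A B + 1). pose proof (Rmax_l A B). pose proof (Rmax_r A B). split; [lra |].
    specialize (HB (Rmax A B + 1) ltac:(lra)). set (s := Rmax A B + 1) in *.
    assert (EX : X s = nu ^ 2 / 4 * exp (- (/ r ^ 2 * s))).
    { unfold X. replace (- (/ r ^ 2 * s)) with (- (s / r ^ 2)) by (unfold Rdiv; ring). field. }
    rewrite <- EX in HB. pose proof (Rle_abs (X s)). specialize (HXpos s).
    specialize (HXp (X s) ltac:(lra)). unfold f. apply Rgt_not_eq. apply Rmult_lt_0_compat; auto. apply exp_pos.
  - assert (HPhi0 : Phi (S k) (X s0) = 0).
    { unfold f in Hs0. apply Rmult_integral in Hs0. destruct Hs0 as [E | E]; auto. pose proof (exp_pos (- (r * s0))). lra. }
    (* s -> X s is decreasing, so the largest zero in s is the first zero in X; if X s0 exceeded X0,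
       the preimage s1 of X0 would be a zero beyond s0. *)
    assert (EX0 : X s0 = X0).
    { destruct (Rtotal_order (X s0) X0) as [E | [E | E]]; auto; exfalso.
      - specialize (HXp (X s0)). specialize (HXpos s0). lra.
      - set (s1 := s0 + r ^ 2 * ln (X s0 / X0)).
        assert (0 < ln (X s0 / X0)).
        { rewrite <- ln_1. apply ln_increasing; [lra |]. apply Rmult_lt_reg_r with X0; auto. replace (X s0 / X0 * X0) with (X s0) by (field; lra). lra. }
        apply (Hs0' s1). { unfold s1. assert (0 < r ^ 2 * ln (X s0 / X0)) by (apply Rmult_lt_0_compat; lra). lra. }
        assert (EX1 : X s1 = X0).
        { unfold s1. unfold X at 1.
          replace (- ((s0 + r ^ 2 * ln (X s0 / X0)) / r ^ 2)) with (- (s0 / r ^ 2) + - ln (X s0 / X0)) by (field; lra).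
          rewrite exp_plus, (exp_Ropp (ln _)), exp_ln by (apply Rdiv_lt_0_compat; auto).
          assert (EE : nu ^ 2 * exp (- (s0 / r ^ 2)) = 4 * X s0) by (unfold X; field; lra).
          match goal with |- ?A * (?B * ?D) / 4 = _ => replace (A * (B * D) / 4) with (A * B * D / 4) by (unfold Rdiv; ring) end.
          rewrite EE. specialize (HXpos s0). field. split; lra. }
        unfold f. rewrite EX1, HX0. apply Rmult_0_r. }
    exists s0, (f1 s0 / f 0).     split; [exact Hs0i |]. split; [exact Hl |].
    assert (Ef0 : f 0 = Phi (S k) (nu ^ 2 / 4)).
    { unfold f, X. replace (- (r * 0)) with 0 by ring. replace (- (0 / r ^ 2)) with 0 by (field; lra). rewrite exp_0.
      replace (nu ^ 2 * 1 / 4) with (nu ^ 2 / 4) by field. ring. }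
    rewrite <- Ef0, <- Rabs_mult.
    replace (f1 s0 / f 0 * f 0) with (f1 s0) by (field; auto).
    match goal with |- _ = ?u * ?v / ?w => replace (u * v / w) with (u * (v / w)) by (unfold Rdiv; ring) end.
    replace (exp (r * s0) / (2 * r)) with (Rabs (exp (r * s0) / (2 * r))).
    2:{ apply Rabs_pos_eq. apply Rmult_le_pos. left; apply exp_pos. left; apply Rinv_0_lt_compat; lra. }
    rewrite <- Rabs_mult.
    (* At X0 the recurrence expresses Phi k by Phi (k + 2), which also gives the slope f1 s0. *)
    pose proof (Phi_recurrence k X0) as F. rewrite HX0 in F.
    rewrite F. unfold f1. rewrite HPhi0, EX0.
    rewrite <- Rabs_Ropp. f_equal.
    replace (INR k + 1 / 2) with nu by lra. replace (INR k + 3 / 2) with (nu + 1) by lra.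
    rewrite exp_Ropp. pose proof (exp_pos (r * s0)).
    assert (Hnu : nu = 2 * r ^ 3) by reflexivity. assert (Hr3 : 0 < r ^ 3) by (apply pow_lt; lra).
    clearbody nu. rewrite Hnu. field. repeat split; lra.
Qed.

(** The coefficient integral at radius 1. With the Gaussian weight this shows that the Hermite
    function tends to 0. *)
Lemma he_exp_bound (p : nat) (x : R) : Rabs (he p x) <= exp (Rabs x + 1 / 4).
Proof.
  pose proof (he_herm_int x 1 p ltac:(lra)) as E. rewrite pow1, Rmult_1_r in E. pose proof PI_RGT_0 as HPI.
  assert (B : Rabs (herm_int x 1 p) <= (PI - 0) * exp (Rabs x + 1 / 4)).
  { apply (abs_RInt_le_const (fun th => exp (hermP x 1 th) * cos (hermQ x 1 th - INR p * th))); try lra.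
    - apply ex_RInt_cont. intros t. unfold hermP, hermQ. cont1.
    - intros t _. rewrite Rabs_mult, (Rabs_pos_eq (exp _)) by (left; apply exp_pos).
      rewrite <- (Rmult_1_r (exp (Rabs x + 1 / 4))).
      apply Rmult_le_compat; try apply Rabs_pos; try apply Rabs_cos_le_1. left; apply exp_pos.
      apply exp_le. unfold hermP.
      assert (Rabs (x * 1 * cos t) <= Rabs x).
      { rewrite Rmult_1_r, Rabs_mult. pose proof (Rabs_cos_le_1 t). pose proof (Rabs_pos x). pose proof (Rabs_pos (cos t)). nra. }
      pose proof (Rle_abs (x * 1 * cos t)). pose proof (COS_bound (2 * t)). lra. }
  rewrite E, Rabs_mult, (Rabs_pos_eq PI) in B by lra.
  apply Rmult_le_reg_l with PI; lra.
Qed.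

(* In the variable s given by x = sqrt N + delta s with N = 2 p + 1, the Hermite function solves
   f'' = (s + s^2 / (4 r^2)) f. *)
Lemma he_zero_near_Ai_zero (i1 : R) : Ai i1 = 0 -> (forall x, i1 < x -> Ai x <> 0) ->
  exists C r0, 0 < C /\ 1 <= r0 /\ forall p r h, (2 <= p)%nat -> r0 <= r -> 2 * r ^ 3 = 2 * INR p + 1 -> is_largest_zero (he p) h ->
    exists s0 l, Rabs (s0 - i1) <= C / r ^ 2 /\ Rabs (l - dAi i1 / Ai 0) <= C / r ^ 2 /\
      Rabs (he (S p) h) = Rabs l * Rabs (he p (sqrt (2 * r ^ 3))) * exp (r * s0 + s0 ^ 2 / (4 * r)) * (sqrt (2 * r ^ 3) / (2 * r * (INR p + 1))).
Proof.
  intros Hz Hnz. destruct (turning_point i1 Hz Hnz) as [C [e0 [HC [He0 H]]]].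
  pose proof (Ai_zero_neg i1 Hz Hnz) as Hi1.
  exists C, (1 + / e0).
  assert (Hie : 0 < / e0) by now apply Rinv_0_lt_compat.
  split; auto. split; [lra |].
  intros p r h Hp Hr Hr3 [Hh Hhp].
  destruct p as [| [| j]]; try lia. set (p := S (S j)) in *.
  assert (Hr2 : r <= r ^ 2) by nra.
  assert (Hr3p : 0 < r ^ 3) by (apply pow_lt; lra).
  set (N := 2 * r ^ 3) in *.
  assert (HN : 0 < N) by (unfold N; lra).
  set (sN := sqrt N). assert (HsN : 0 < sN) by now apply sqrt_lt_R0.
  assert (HsN2 : sN ^ 2 = 2 * r ^ 3) by (unfold sN; rewrite pow2_sqrt; [reflexivity | lra]).
  set (dl := r / sN). assert (Hdl : 0 < dl) by (apply Rdiv_lt_0_compat; lra).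
  set (x := fun s => sN + dl * s).
  set (f := fun s => exp (- (x s ^ 2 / 2)) * he p (x s)).
  set (f1 := fun s => exp (- (x s ^ 2 / 2)) * (dl * (he (S j) (x s) - x s * he p (x s)))).
  set (q := fun s => s + / (4 * r ^ 2) * s ^ 2).
  assert (Hdl2 : dl ^ 2 = / (2 * r)).
  { unfold dl. replace ((r / sN) ^ 2) with (r ^ 2 / sN ^ 2) by (field; lra). rewrite HsN2. field. lra. }
  assert (Hdls : dl * sN = r) by (unfold dl; field; lra).
  assert (Dx : forall s, is_derive x s dl) by (intros s; unfold x; auto_derive; auto; ring).
  assert (Dhe : forall m s, is_derive (fun s => he (S m) (x s)) s (dl * he m (x s))).
  { intros m s. apply (is_derive_Rcomp (he (S m)) x); auto. apply is_derive_he. }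
  assert (DE : forall s, is_derive (fun s => exp (- (x s ^ 2 / 2))) s (- (dl * x s) * exp (- (x s ^ 2 / 2)))).
  { intros s. unfold x. auto_derive; auto. field_trig. }
  assert (Df : forall s, is_derive f s (f1 s)).
  { intros s. unfold f.
    replace (f1 s) with (- (dl * x s) * exp (- (x s ^ 2 / 2)) * he p (x s) + exp (- (x s ^ 2 / 2)) * (dl * he (S j) (x s))) by (unfold f1; ring).
    apply (is_derive_Rmult (fun s => exp (- (x s ^ 2 / 2))) (fun s => he p (x s))); auto. apply (Dhe (S j)). }
  assert (Df1 : forall s, is_derive f1 s (q s * f s)).
  { intros s. unfold f1.
    replace (q s * f s) with (- (dl * x s) * exp (- (x s ^ 2 / 2)) * (dl * (he (S j) (x s) - x s * he p (x s)))
      + exp (- (x s ^ 2 / 2)) * (dl * (dl * he j (x s) - (dl * he p (x s) + x s * (dl * he (S j) (x s)))))).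
    2:{ unfold f.
        assert (Eq : q s = dl ^ 2 * (x s ^ 2 - (2 * INR p + 1))).
        { rewrite <- Hr3. replace (x s ^ 2 - N) with (2 * r * s + / (2 * r) * s ^ 2).
          - rewrite Hdl2. unfold q. field. lra.
          - unfold x. replace ((sN + dl * s) ^ 2) with (sN ^ 2 + 2 * (dl * sN) * s + dl ^ 2 * s ^ 2) by ring.
            rewrite HsN2, Hdls, Hdl2. unfold N. ring. }
        assert (EH : he j (x s) = 2 * x s * he (S j) (x s) - 2 * INR p * he p (x s)).
        { unfold p. rewrite he_SS, !S_INR. pose proof (pos_INR j). field. lra. }
        rewrite Eq, EH. ring. }
    apply (is_derive_Rmult (fun s => exp (- (x s ^ 2 / 2))) (fun s => dl * (he (S j) (x s) - x s * he p (x s)))); auto.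
    apply (is_derive_scal (fun s => he (S j) (x s) - x s * he p (x s)) s dl).
    apply (is_derive_Rminus (fun s => he (S j) (x s)) (fun s => x s * he p (x s))). apply Dhe.
    apply (is_derive_Rmult x (fun s => he p (x s))); auto. apply (Dhe (S j)). }
  assert (Hr24 : 0 < / (4 * r ^ 2) <= / r).
  { split. apply Rinv_0_lt_compat; nra. apply Rinv_le_contravar; nra. }
  destruct (H (/ r ^ 2) q f f1) as [Hf0 [s0 [_ [Hs0 [Hs0' [Hs0i Hl]]]]]]; auto.
  - split. apply Rinv_0_lt_compat; nra. rewrite <- (Rinv_inv e0). apply Rinv_le_contravar; lra.
  - intros s Hs. unfold q. replace (s + / (4 * r ^ 2) * s ^ 2 - s) with (/ (4 * r ^ 2) * s ^ 2) by ring.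
    rewrite Rabs_pos_eq by (apply Rmult_le_pos; [lra | apply pow2_ge_0]).
    apply Rmult_le_compat_r. apply pow2_ge_0. apply Rinv_le_contravar; nra.
  - intros s Hs. unfold q. assert (0 <= / (4 * r ^ 2) * s ^ 2) by (apply Rmult_le_pos; [lra | apply pow2_ge_0]). lra.
  (* (x - 2)^2 >= 0 gives - x^2/2 + x + 1/4 <= 9/4 - x. *)
  - intros eps Heps. destruct (exp_scaled_vanishes (exp (9 / 4)) dl Hdl eps Heps) as [A HA].
    exists (Rmax A 0). intros s Hs. pose proof (Rmax_l A 0). pose proof (Rmax_r A 0).
    eapply Rle_trans. 2: apply (HA s ltac:(lra)).
    rewrite (Rabs_pos_eq (_ * _)) by (apply Rmult_le_pos; left; apply exp_pos).
    unfold f. rewrite Rabs_mult, Rabs_pos_eq by (left; apply exp_pos).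
    apply Rle_trans with (exp (- (x s ^ 2 / 2)) * exp (Rabs (x s) + 1 / 4)).
    { apply Rmult_le_compat_l. left; apply exp_pos. apply he_exp_bound. }
    rewrite <- !exp_plus. apply exp_le.
    assert (0 <= dl * s) by (apply Rmult_le_pos; lra).
    rewrite Rabs_pos_eq by (unfold x; lra).
    assert (dl * s <= x s) by (unfold x; lra).
    pose proof (pow2_ge_0 (x s - 2)) as Hsq.
    replace ((x s - 2) ^ 2) with (x s ^ 2 - 4 * x s + 4) in Hsq by ring. lra.
  - intros A. exists (Rmax A ((h - sN) / dl) + 1). pose proof (Rmax_l A ((h - sN) / dl)). pose proof (Rmax_r A ((h - sN) / dl)).
    split; [lra |]. set (s := Rmax A ((h - sN) / dl) + 1) in *. unfold f. apply Rgt_not_eq. apply Rmult_lt_0_compat. apply exp_pos.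
    apply Hhp. unfold x. assert (dl * ((h - sN) / dl) < dl * s) by (apply Rmult_lt_compat_l; [auto | unfold s; lra]).
    replace (dl * ((h - sN) / dl)) with (h - sN) in H2 by (field; lra). lra.
  - assert (Hhe0 : he p (x s0) = 0).
    { unfold f in Hs0. apply Rmult_integral in Hs0. destruct Hs0 as [E | E]; auto. pose proof (exp_pos (- (x s0 ^ 2 / 2))). lra. }
    assert (Exh : x s0 = h).
    { destruct (Rtotal_order (x s0) h) as [E | [E | E]]; auto; exfalso.
      - set (s1 := (h - sN) / dl). assert (Ex1 : x s1 = h) by (unfold x, s1; field; lra).
        apply (Hs0' s1).
        + apply Rmult_lt_reg_l with dl; auto. unfold x in E, Ex1. lra.
        + unfold f. rewrite Ex1, Hh. apply Rmult_0_r.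
      - specialize (Hhp _ E). lra. }
    exists s0, (f1 s0 / f 0). split; [exact Hs0i |]. split; [exact Hl |].
    assert (Ex0 : x 0 = sN) by (unfold x; ring).
    assert (Ef0 : he p sN = f 0 * exp (N / 2)).
    { unfold f. rewrite Ex0, HsN2. fold N. rewrite exp_Ropp. pose proof (exp_pos (N / 2)). field. lra. }
    rewrite Ef0. rewrite Rabs_mult, (Rabs_pos_eq (exp (N / 2))) by (left; apply exp_pos).
    rewrite <- (Rmult_assoc (Rabs (f1 s0 / f 0))), <- Rabs_mult.
    replace (f1 s0 / f 0 * f 0) with (f1 s0) by (field; auto).
    pose proof (pos_INR j) as Hj.
    (* At a zero of [he p] the recurrence reduces [he (S p)] to [he (p - 1)], the derivative
       there. *)
    assert (EhS : he (S p) h = - he (S j) h / (2 * (INR p + 1))).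
    { assert (E : he (S p) h = (2 * h * he p h - he (S j) h) / (2 * (INR (S j) + 2))) by reflexivity.
      rewrite E, Hh. unfold p. rewrite (S_INR (S j)). field. rewrite S_INR. lra. }
    rewrite EhS.
    assert (EF1 : f1 s0 = exp (- (h ^ 2 / 2)) * (dl * he (S j) h)).
    { unfold f1. rewrite Exh, Hh. ring. }
    rewrite EF1.
    assert (Eh2 : h ^ 2 / 2 = N / 2 + (r * s0 + s0 ^ 2 / (4 * r))).
    { rewrite <- Exh. unfold x. replace ((sN + dl * s0) ^ 2) with (sN ^ 2 + 2 * (dl * sN) * s0 + dl ^ 2 * s0 ^ 2) by ring.
      rewrite HsN2, Hdls, Hdl2. fold N. field. lra. }
    assert (Hpp : 0 < INR p + 1) by (pose proof (pos_INR p); lra).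
    unfold Rdiv at 1. rewrite !Rabs_mult, Rabs_Ropp, (Rabs_pos_eq (exp _)), (Rabs_pos_eq dl), (Rabs_pos_eq (/ _)); try lra.
    2:{ left; apply Rinv_0_lt_compat; lra. }
    2:{ left; apply exp_pos. }
    rewrite Eh2, exp_Ropp, exp_plus. pose proof (exp_pos (N / 2)). pose proof (exp_pos (r * s0 + s0 ^ 2 / (4 * r))).
    unfold dl. fold sN. field. repeat split; lra.
Qed.

(** * Assembly of the asymptotics *)

Lemma near_1_mult (h A B u v : R) : 0 <= h <= 1 -> 0 <= A -> 0 <= B ->
  Rabs (u - 1) <= A * h -> Rabs (v - 1) <= B * h -> Rabs (u * v - 1) <= (A + B + A * B) * h.
Proof.
  intros Hh HA HB Hu Hv.
  replace (u * v - 1) with ((u - 1) * (v - 1) + ((u - 1) + (v - 1))) by ring.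
  eapply Rle_trans. apply Rabs_triang.
  pose proof (Rabs_triang (u - 1) (v - 1)).
  assert (Rabs ((u - 1) * (v - 1)) <= A * B * h).
  { rewrite Rabs_mult. apply Rle_trans with (A * h * (B * h)).
    - apply Rmult_le_compat; auto; apply Rabs_pos.
    - assert (0 <= A * B) by (apply Rmult_le_pos; auto). assert (h * h <= h) by nra.
      replace (A * h * (B * h)) with (A * B * (h * h)) by ring. now apply Rmult_le_compat_l. }
  lra.
Qed.

Lemma near_1_exp (h D E : R) : 0 <= h <= 1 -> 0 <= D -> Rabs E <= D * h -> Rabs (exp E - 1) <= D * exp D * h.
Proof.
  intros Hh HD HE. rewrite <- exp_0 at 1. assert (Rabs E <= D) by nra.
  eapply Rle_trans. apply (Rabs_exp_sub_le E 0 D); auto. pose proof (Rle_abs E); lra.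
  rewrite Rminus_0_r. pose proof (exp_pos D).
  replace (D * exp D * h) with (D * h * exp D) by ring. apply Rmult_le_compat_r; lra.
Qed.

(** The three sources of error are the slope ratio u, the ratio v of the contour integral to its
    Airy limit, and the exponent E; h = 1/r <= 1 lets products of errors be absorbed. *)
Lemma near_1_final (A B D : R) : 0 <= A -> 0 <= B -> 0 <= D -> exists M, 0 <= M /\ forall h u v E, 0 <= h <= 1 ->
  Rabs (u - 1) <= A * h -> Rabs (v - 1) <= B * h -> Rabs E <= D * h -> Rabs (u * v * exp E - 1) <= M * h.
Proof.
  intros HA HB HD.
  assert (0 <= A * B) by now apply Rmult_le_pos.
  assert (0 <= D * exp D) by (apply Rmult_le_pos; auto; left; apply exp_pos).
  assert (0 <= (A + B + A * B) * (D * exp D)) by (apply Rmult_le_pos; lra).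
  exists ((A + B + A * B) + D * exp D + (A + B + A * B) * (D * exp D)). split. lra.
  intros h u v E Hh Hu Hv HE.
  apply near_1_mult; auto. lra. apply near_1_mult; auto. apply near_1_exp; auto.
Qed.

Lemma near_1_ratio (x y C : R) : y <> 0 -> Rabs (x - y) <= C -> Rabs (Rabs x / Rabs y - 1) <= C / Rabs y.
Proof.
  intros Hy Hx. assert (0 < Rabs y) by now apply Rabs_pos_lt.
  replace (Rabs x / Rabs y - 1) with ((Rabs x - Rabs y) / Rabs y) by (field; lra).
  unfold Rdiv. rewrite Rabs_mult, (Rabs_pos_eq (/ Rabs y)) by (left; now apply Rinv_0_lt_compat).
  apply Rmult_le_compat_r. left; now apply Rinv_0_lt_compat.
  eapply Rle_trans. apply Rabs_triang_inv2. auto.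
Qed.

(** The logarithm will be multiplied by r^3 with w of order 1/r, so a remainder of order 4 is
    needed. *)
Lemma ln_1_minus_order_3 (w : R) : 0 <= w <= 1 / 2 -> - w ^ 4 <= ln (1 - w) + w + w ^ 2 / 2 + w ^ 3 / 3 <= 0.
Proof.
  intros Hw. split.
  - apply (le_of_derive_le (fun w => - w ^ 4) (fun w => - 4 * w ^ 3) (fun w => ln (1 - w) + w + w ^ 2 / 2 + w ^ 3 / 3) (fun w => - / (1 - w) + 1 + w + w ^ 2) 0 w ltac:(lra)).
    + intros y Hy. auto_derive; auto; ring.
    + intros y Hy. auto_derive. lra. field. lra.
    + intros y Hy. apply Rmult_le_reg_r with (1 - y). lra.
      replace ((- / (1 - y) + 1 + y + y ^ 2) * (1 - y)) with (- y ^ 3) by (field; lra).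
      assert (0 <= y ^ 3) by (apply pow_le; lra). nra.
    + replace (1 - 0) with 1 by ring. rewrite ln_1. lra.
  - apply (le_of_derive_le (fun w => ln (1 - w) + w + w ^ 2 / 2 + w ^ 3 / 3) (fun w => - / (1 - w) + 1 + w + w ^ 2) (fun _ => 0) (fun _ => 0) 0 w ltac:(lra)).
    + intros y Hy. auto_derive. lra. field. lra.
    + intros y Hy. apply is_derive_Rconst.
    + intros y Hy. apply Rmult_le_reg_r with (1 - y). lra.
      replace ((- / (1 - y) + 1 + y + y ^ 2) * (1 - y)) with (- y ^ 3) by (field; lra).
      assert (0 <= y ^ 3) by (apply pow_le; lra). lra.
    + replace (1 - 0) with 1 by ring. rewrite ln_1. lra.
Qed.

(** The limit 1/3 compensates the factor e^(1/3) between Ai 0 and [airy_K0 0];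
    [circle_top_expansion] does the same for the Hermite case. *)
Lemma arc_top_expansion (r : R) : 2 <= r ->
  Rabs (2 * r ^ 3 * (ln ((1 + (1 - / r) ^ 2) / 2) + / r) - 1 / 3) <= 3 * / r.
Proof.
  intros Hr. set (h := / r). assert (Hh : 0 < h <= 1 / 2) by (apply inv_le_half; lra).
  set (w := h - h ^ 2 / 2). replace ((1 + (1 - h) ^ 2) / 2) with (1 - w) by (unfold w; field).
  assert (Hw : 0 <= w <= h) by (unfold w; nra).
  pose proof (ln_1_minus_order_3 w ltac:(lra)) as L.
  set (e := ln (1 - w) + w + w ^ 2 / 2 + w ^ 3 / 3) in L.
  assert (Hw4 : 0 <= w ^ 4 <= h ^ 4) by (split; [apply pow_le | apply pow_incr]; lra).
  assert (Hrh : r = / h) by (unfold h; now rewrite Rinv_inv).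
  replace (2 * r ^ 3 * (ln (1 - w) + h) - 1 / 3) with (h * (3 / 4 - h / 2 + h ^ 2 / 12) + 2 * (e / h ^ 3)).
  2:{ replace (ln (1 - w)) with (e - w - w ^ 2 / 2 - w ^ 3 / 3) by (unfold e; ring). rewrite Hrh. unfold w. field. lra. }
  assert (Hh3 : 0 < h ^ 3) by (apply pow_lt; lra).
  assert (He : - h <= e / h ^ 3 <= 0).
  { split; apply Rmult_le_reg_r with (h ^ 3); auto; replace (e / h ^ 3 * h ^ 3) with e by (field; lra).
    replace (- h * h ^ 3) with (- h ^ 4) by ring. lra. lra. }
  apply Rabs_le. nra.
Qed.

Lemma circle_top_expansion (r : R) : 2 <= r ->
  Rabs (r ^ 3 * (- ln (1 - / r) - / r - (/ r) ^ 2 / 2) - 1 / 3) <= / r.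
Proof.
  intros Hr. set (h := / r). assert (Hh : 0 < h <= 1 / 2) by (apply inv_le_half; lra).
  pose proof (ln_1_minus_order_3 h ltac:(lra)) as L.
  set (e := ln (1 - h) + h + h ^ 2 / 2 + h ^ 3 / 3) in L.
  assert (Hrh : r = / h) by (unfold h; now rewrite Rinv_inv).
  replace (r ^ 3 * (- ln (1 - h) - h - h ^ 2 / 2) - 1 / 3) with (- (e / h ^ 3)).
  2:{ unfold e. rewrite Hrh. field. lra. }
  assert (Hh3 : 0 < h ^ 3) by (apply pow_lt; lra).
  assert (He : - h <= e / h ^ 3 <= 0).
  { split; apply Rmult_le_reg_r with (h ^ 3); auto; replace (e / h ^ 3 * h ^ 3) with e by (field; lra).
    replace (- h * h ^ 3) with (- h ^ 4) by ring. lra. lra. }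
  rewrite Rabs_Ropp. apply Rabs_le. lra.
Qed.

Lemma Rpower_third_cube (y : R) : 0 < y -> 0 < Rpower y (1 / 3) /\ Rpower y (1 / 3) ^ 3 = y.
Proof.
  intros Hy. assert (H : 0 < Rpower y (1 / 3)) by apply exp_pos. split; auto.
  rewrite <- Rpower_pow by auto. rewrite Rpower_mult. replace (1 / 3 * INR 3) with 1 by (simpl; field). now apply Rpower_1.
Qed.

Lemma cube_le (a b : R) : 0 <= b -> a ^ 3 <= b ^ 3 -> a <= b.
Proof.
  intros Hb H. apply Rnot_lt_le. intros Hl. assert (b ^ 3 < a ^ 3); [| lra].
  assert (0 < a) by lra. replace (a ^ 3) with (a * a * a) by ring. replace (b ^ 3) with (b * b * b) by ring.
  assert (b * b < a * a) by nra. nra.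
Qed.

(** Converts an error 1/r into the stated power; 8 is the cube of the factor 2. *)
Lemma inv_le_2_Rpower (x y : R) : 0 < x -> x / 8 <= y -> / Rpower y (1 / 3) <= 2 * Rpower x (- (1 / 3)).
Proof.
  intros Hx Hy. destruct (Rpower_third_cube y ltac:(lra)) as [H1 H2]. destruct (Rpower_third_cube x Hx) as [H3 H4].
  rewrite Rpower_Ropp. set (r := Rpower y (1 / 3)) in *. set (k := Rpower x (1 / 3)) in *.
  assert (k / 2 <= r). { apply cube_le. lra. replace ((k / 2) ^ 3) with (k ^ 3 / 8) by field. lra. }
  replace (2 * / k) with (/ (k / 2)) by (field; lra). apply Rinv_le_contravar; lra.
Qed.

Lemma cube_diff_le (a b c : R) : 0 < a -> 0 <= b -> 0 <= c -> a ^ 3 - b ^ 3 = c -> 0 <= a - b <= c / a ^ 2.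
Proof.
  intros Ha Hb Hc E.
  assert (Hba : b <= a) by (apply cube_le; lra).
  split. lra. assert (0 < a ^ 2) by nra. apply le_div_pos; auto. rewrite <- E.
  replace (a ^ 3 - b ^ 3) with ((a - b) * (a ^ 2 + a * b + b ^ 2)) by ring.
  apply Rmult_le_compat_l; [lra |]. assert (0 <= a * b) by (apply Rmult_le_pos; lra). nra.
Qed.

Lemma Rabs_mult_le (c x B : R) : Rabs x <= B -> Rabs (c * x) <= Rabs c * B.
Proof. intros H. rewrite Rabs_mult. apply Rmult_le_compat_l; auto. apply Rabs_pos. Qed.

(** The first line is the logarithm of the approximation to tau* with |Ai'(i1)| divided out, the
    second that of the claimed form. The constant 7 merely dominates the sum of the individual
    errors. *)
Lemma part1_log (i1 : R) (k : nat) (r : R) : (1 <= k)%nat -> 2 <= r -> r = Rpower ((INR k + 1 / 2) / 2) (1 / 3) ->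
  let u := 1 - / r in let nu := INR k + 1 / 2 in
  Rabs (ln PI - 1 / 3 + ln ((1 + u ^ 2) / (2 * u)) + INR k * ln (1 + u ^ 2) - nu * u + r * i1 - ln (wallis k) - 2 * ln r
    - (1 / 3 * ln 4 + (ln PI - 1) / 2 + INR k * (ln 2 - 1) + i1 * Rpower (INR k / 2) (1 / 3) - 1 / 6 * ln (INR k)))
  <= (Rabs i1 + 7) * / r.
Proof.
  intros Hk Hr Er u nu.
  apply (le_INR 1) in Hk. simpl in Hk. set (x := INR k) in *.
  destruct (Rpower_third_cube ((x + 1 / 2) / 2) ltac:(lra)) as [_ Hr3]. rewrite <- Er in Hr3.
  assert (Hnu : nu = 2 * r ^ 3) by (unfold nu; lra).
  set (h := / r). assert (Hh : 0 < h <= 1 / 2) by (apply inv_le_half; lra).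
  assert (Hu : 1 / 2 <= u < 1) by (unfold u; fold h; lra).
  pose proof (arc_top_expansion r Hr) as La. fold h in La. fold u in La.
  replace (1 - h) with u in La by reflexivity.
  assert (Hlr : 2 * ln r = 2 / 3 * (ln nu - ln 2)).
  { rewrite Er. unfold Rpower. rewrite ln_exp. fold nu. unfold Rdiv at 2. rewrite ln_mult, ln_Rinv by (unfold nu; lra). field. }
  assert (Hl4 : ln 4 = 2 * ln 2) by (replace 4 with (2 * 2) by ring; rewrite ln_mult by lra; ring).
  assert (Hlu : ln (1 + u ^ 2) = ln ((1 + u ^ 2) / 2) + ln 2).
  { pose proof (pow2_ge_0 u). rewrite <- ln_mult; [f_equal; field | lra | lra]. }
  set (lu := ln ((1 + u ^ 2) / 2)) in *.
  assert (Hrho : 0 <= ln ((1 + u ^ 2) / (2 * u)) <= h).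
  { assert (E : (1 + u ^ 2) / (2 * u) = 1 + h ^ 2 / (2 * u)) by (replace h with (1 - u) by (unfold u, h; ring); field; lra).
    assert (0 <= h ^ 2 / (2 * u) <= h).
    { split. apply Rmult_le_pos; [nra | left; apply Rinv_0_lt_compat; lra].
      apply Rmult_le_reg_r with (2 * u); [lra |]. replace (h ^ 2 / (2 * u) * (2 * u)) with (h ^ 2) by (field; lra). nra. }
    rewrite E. split. rewrite <- ln_1. apply ln_le; lra.
    apply Rle_trans with (ln (exp h)); [| rewrite ln_exp; lra]. apply ln_le. lra. pose proof (exp_ge_1_plus h). lra. }
  assert (Hlub : - 2 * h <= lu <= 0).
  { unfold lu. replace ((1 + u ^ 2) / 2) with (1 - (h - h ^ 2 / 2)) by (unfold u; fold h; field).
    destruct (ln_1_minus_bounds (h - h ^ 2 / 2)) as [L1 L2]. nra. split; nra. }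
  assert (Hri : Rabs (i1 * (r - Rpower (x / 2) (1 / 3))) <= Rabs i1 * h).
  { apply Rabs_mult_le. destruct (Rpower_third_cube (x / 2) ltac:(lra)) as [H1 H2].
    destruct (cube_diff_le r (Rpower (x / 2) (1 / 3)) (1 / 4)) as [D1 D2]; try lra.
    rewrite Rabs_pos_eq by lra. eapply Rle_trans. exact D2.
    replace (1 / 4 / r ^ 2) with (h * (1 / 4 * h)) by (unfold h; field; lra). nra. }
  assert (Hr1 : r <= r ^ 3) by nra.
  assert (Hxr : r <= x) by (unfold nu in Hnu; lra).
  assert (Hxh : / x <= h) by (unfold h; apply Rinv_le_contravar; lra).
  assert (Hix : 0 < / x) by (apply Rinv_0_lt_compat; lra).
  assert (Hlx : 0 <= ln nu - ln x <= h).
  { split. assert (ln x <= ln nu) by (apply ln_le; unfold nu; lra). lra.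
    replace nu with (x * (1 + / x / 2)) by (unfold nu; field; lra). rewrite ln_mult by lra.
    assert (ln (1 + / x / 2) <= / x / 2). { rewrite <- (ln_exp (/ x / 2)) at 2. apply ln_le. lra. apply exp_ge_1_plus. } lra. }
  assert (Hlx1 : ln (x + 1) - ln x <= h).
  { replace (x + 1) with (x * (1 + / x)) by (field; lra). rewrite ln_mult by lra.
    assert (ln (1 + / x) <= / x). { rewrite <- (ln_exp (/ x)) at 2. apply ln_le. lra. apply exp_ge_1_plus. } lra. }
  destruct (wallis_bounds k) as [W1 W2]. fold x in W1, W2. fold nu in W2. pose proof (wallis_pos k) as Hw. pose proof PI_RGT_0.
  assert (Hw2 : 0 < wallis k ^ 2) by now apply pow_lt.
  assert (HW1 : ln PI <= ln (x + 1) + 2 * ln (wallis k)).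
  { replace (2 * ln (wallis k)) with (ln (wallis k ^ 2)) by (rewrite ln_pow_nat by auto; simpl; ring). rewrite <- ln_mult by lra. apply ln_le; lra. }
  assert (HW2 : ln nu + 2 * ln (wallis k) <= ln PI).
  { replace (2 * ln (wallis k)) with (ln (wallis k ^ 2)) by (rewrite ln_pow_nat by auto; simpl; ring). rewrite <- ln_mult by (unfold nu; lra).
    apply ln_le; [| lra]. apply Rmult_lt_0_compat; unfold nu; lra. }
  rewrite <- Hnu in La.
  (* After regrouping, each summand is O(1/r): top of the arc, rho, the half unit in k = nu - 1/2,
     the cube roots, Wallis, and ln nu against ln k. *)
  match goal with |- Rabs ?e <= _ => replace e with ((nu * (lu + h) - 1 / 3) + ln ((1 + u ^ 2) / (2 * u)) - 1 / 2 * lu + i1 * (r - Rpower (x / 2) (1 / 3))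
     + 1 / 2 * (ln PI - ln nu - 2 * ln (wallis k)) - 1 / 6 * (ln nu - ln x)) end.
  2:{ rewrite Hlr, Hl4, Hlu. replace (nu * (lu + h)) with (nu * (lu + (1 - u))) by (unfold u, h; ring).
      generalize (ln ((1 + u ^ 2) / (2 * u))) (ln nu) (ln x) (ln 2) (ln PI). intros. unfold nu. field. }
  apply Rabs_le_between in La. apply Rabs_le_between in Hri.
  apply Rabs_le. lra.
Qed.

(** The counterpart for m = p + 1, written [x]; Stirling's formula replaces Wallis's. *)
Lemma part2_log (i1 : R) (p : nat) (r : R) : 2 <= r -> r = Rpower (INR p + 1 / 2) (1 / 3) ->
  let N := 2 * r ^ 3 in let h := / r in let x := INR p + 1 in
  Rabs (ln (INR (fact p)) - 1 / 3 + (N * (1 - h) - N * (1 - h) ^ 2 / 4) - 2 * ln r - ln 2 - INR p * ln (sqrt N * (1 - h)) + r * i1 + ln N / 2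
    - ((ln (2 * PI) - 1) / 2 + x / 2 * (1 + ln x - ln 2) + i1 * Rpower x (1 / 3) - 1 / 6 * ln x))
  <= (Rabs i1 + 7) * / r.
Proof.
  intros Hr Er N h x. pose proof (pos_INR p) as Hp0.
  destruct (Rpower_third_cube (INR p + 1 / 2) ltac:(lra)) as [_ Hr3]. rewrite <- Er in Hr3.
  assert (Hh : 0 < h <= 1 / 2) by (apply inv_le_half; lra).
  assert (Hrh : r * h = 1) by (unfold h; field; lra).
  assert (Hr1 : 4 * r <= r ^ 3) by nra.
  assert (Hpr : r + 1 / 2 <= INR p) by lra.
  assert (HN : N = 2 * x - 1) by (unfold N, x; lra).
  assert (HN0 : 0 < N) by (unfold N; lra).
  pose proof (circle_top_expansion r Hr) as La. fold h in La.
  destruct (ln_1_minus_bounds h ltac:(lra)) as [Lh1 Lh2].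
  set (lh := ln (1 - h)) in *.
  assert (HlN : ln (sqrt N * (1 - h)) = ln N / 2 + lh).
  { rewrite ln_mult; [| now apply sqrt_lt_R0 | lra]. fold lh. f_equal.
    assert (E : ln N = ln (sqrt N * sqrt N)) by (rewrite sqrt_sqrt; lra).
    rewrite E, ln_mult by now apply sqrt_lt_R0. field. }
  assert (Hlr : 2 * ln r = 2 / 3 * (ln N - ln 2)).
  { rewrite Er at 1. unfold Rpower. rewrite ln_exp. replace (INR p + 1 / 2) with (N * / 2) by (unfold N; lra).
    rewrite ln_mult, ln_Rinv by lra. field. }
  set (y := / x).
  assert (Hy : 0 < y <= h). { unfold y, h, x. split. apply Rinv_0_lt_compat; lra. apply Rinv_le_contravar; lra. }
  assert (Hxy : x * y = 1) by (unfold y; field; unfold x; lra).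
  destruct (ln_1_minus_bounds y ltac:(lra)) as [L11 L12]. destruct (ln_1_minus_bounds (y / 2) ltac:(lra)) as [L21 L22].
  assert (Hlp : ln (INR p) = ln x + ln (1 - y)).
  { rewrite <- ln_mult; [f_equal; replace (x * (1 - y)) with (x - x * y) by ring; rewrite Hxy; unfold x; ring | unfold x; lra | lra]. }
  assert (HlN2 : ln N = ln 2 + ln x + ln (1 - y / 2)).
  { rewrite <- !ln_mult; try (unfold x; lra). f_equal. replace (2 * x * (1 - y / 2)) with (2 * x - x * y) by field. rewrite Hxy. lra. }
  set (l1 := ln (1 - y)) in *. set (l2 := ln (1 - y / 2)) in *.
  assert (Hs : Rabs (stirling_err p - ln (2 * PI) / 2) <= h).
  { eapply Rle_trans. apply stirling. apply INR_le. simpl; lra. unfold h. apply Rinv_le_contravar; lra. }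
  assert (Hri : Rabs (i1 * (r - Rpower x (1 / 3))) <= Rabs i1 * h).
  { apply Rabs_mult_le. destruct (Rpower_third_cube x ltac:(unfold x; lra)) as [H1 H2].
    assert (Hrx : r <= Rpower x (1 / 3)) by (apply cube_le; unfold x in *; lra).
    destruct (cube_diff_le (Rpower x (1 / 3)) r (1 / 2)) as [D1 D2]; try lra. { unfold x in *; lra. }
    rewrite Rabs_minus_sym, Rabs_pos_eq by lra. eapply Rle_trans. exact D2.
    apply Rle_trans with (1 / 2 * h ^ 2); [| nra].
    unfold Rdiv. apply Rmult_le_compat_l; [lra |].
    replace (h ^ 2) with (/ r ^ 2) by (unfold h; field; lra). apply Rinv_le_contravar; [nra |]. apply pow_incr; lra. }
  (* Passing from p and N = 2 p + 1 to x in the logarithms leaves the constant -1 + 1/4 = -3/4 up to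
     O(1/x). *)
  assert (HB : Rabs ((x - 1 / 2) * l1 + (2 - x) / 2 * l2 - 2 / 3 * l2 + 3 / 4) <= 3 * h).
  { set (e1 := - l1 - y). set (e2 := - l2 - y / 2).
    assert (He1 : 0 <= e1 <= y ^ 2) by (unfold e1; lra). assert (He2 : 0 <= e2 <= y ^ 2 / 4) by (unfold e2; lra).
    replace ((x - 1 / 2) * l1 + (2 - x) / 2 * l2 - 2 / 3 * l2 + 3 / 4) with
      (y / 2 - x * e1 + e1 / 2 - 1 / 3 * (e2 + y / 2) + x * e2 / 2 + (1 - x * y) * 3 / 4).
    2:{ unfold e1, e2. field. }
    rewrite Hxy.
    assert (0 <= x * e1 <= y).
    { split. apply Rmult_le_pos; [unfold x; lra | lra]. apply Rle_trans with (x * y ^ 2). apply Rmult_le_compat_l; [unfold x; lra | lra].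
      replace (x * y ^ 2) with (x * y * y) by ring. rewrite Hxy. lra. }
    assert (0 <= x * e2 <= y / 4).
    { split. apply Rmult_le_pos; [unfold x; lra | lra]. apply Rle_trans with (x * (y ^ 2 / 4)). apply Rmult_le_compat_l; [unfold x; lra | lra].
      replace (x * (y ^ 2 / 4)) with (x * y * y / 4) by field. rewrite Hxy. lra. }
    assert (y ^ 2 <= y) by nra.
    apply Rabs_le. lra. }
  match goal with |- Rabs ?e <= _ => replace e with ((stirling_err p - ln (2 * PI) / 2) + (r ^ 3 * (- lh - h - h ^ 2 / 2) - 1 / 3)
    + lh / 2 + i1 * (r - Rpower x (1 / 3)) + ((x - 1 / 2) * l1 + (2 - x) / 2 * l2 - 2 / 3 * l2 + 3 / 4)) end.
  2:{ unfold stirling_err. rewrite HlN, Hlr, Hlp, HlN2.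
      replace (INR p) with (x - 1) by (unfold x; ring).
      assert (Er3 : r ^ 3 = x - 1 / 2) by (unfold x; lra).
      unfold N. rewrite Er3.
      generalize (ln (INR (fact p))) (ln (2 * PI)) (ln x) (ln 2) (Rpower x (1 / 3)). intros. field. }
  apply Rabs_le_between in La. apply Rabs_le_between in Hri. apply Rabs_le_between in Hs. apply Rabs_le_between in HB.
  assert (h ^ 2 <= h) by nra.
  apply Rabs_le. fold h. lra.
Qed.

Lemma Ai_0_K0 : Rabs (airy_K0 0) = PI * exp (- (1 / 3)) * Rabs (Ai 0).
Proof.
  rewrite Ai_eq_shifted. rewrite Rabs_mult, (Rabs_pos_eq (_ / _)).
  - rewrite Rminus_0_r, exp_Ropp. pose proof PI_RGT_0. pose proof (exp_pos (1 / 3)). field. lra.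
  - pose proof PI_RGT_0. apply Rmult_le_pos. left; apply exp_pos. left; now apply Rinv_0_lt_compat.
Qed.

Lemma exp_nat_ln (n : nat) (y : R) : 0 < y -> exp (INR n * ln y) = y ^ n.
Proof. intros Hy. rewrite <- exp_pow_nat, exp_ln; auto. Qed.

Lemma sqrt_exp_ln (y : R) : 0 < y -> sqrt y = exp (ln y / 2).
Proof. intros Hy. rewrite <- Rpower_sqrt by auto. unfold Rpower. f_equal. field. Qed.

Lemma nat_above (x : R) : exists K : nat, forall k : nat, (K <= k)%nat -> x <= INR k.
Proof.
  destruct (nfloor_ex (Rmax x 0) (Rmax_r x 0)) as [N [_ HN]]. pose proof (Rmax_l x 0).
  exists (S N). intros k Hk. apply le_INR in Hk. rewrite S_INR in Hk. lra.
Qed.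

Lemma Rpower_third_ge (r0 y : R) : 0 <= r0 -> 0 < y -> r0 ^ 3 <= y -> r0 <= Rpower y (1 / 3).
Proof.
  intros H0 Hy H. destruct (Rpower_third_cube y Hy) as [H1 H2]. apply cube_le. lra. lra.
Qed.

Lemma tau_star_asymptotics (i1 : R) : Ai i1 = 0 -> (forall x, i1 < x -> Ai x <> 0) ->
  exists M K, forall k X0, (K <= k)%nat -> (1 <= k)%nat -> is_first_zero (Phi (S k)) X0 ->
    Rabs (Rabs (Phi k X0) / (Rpower 4 (1/3) * sqrt (PI / exp 1) * Rabs (dAi i1) * (2 / exp 1) ^ k
       * exp (- (- i1 / Rpower 2 (1/3)) * Rpower (INR k) (1/3)) * Rpower (INR k) (- (1/6))) - 1)
    <= M * Rpower (INR k) (- (1/3)).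
Proof.
  intros Hz Hnz.
  destruct (Phi_zero_near_Ai_zero i1 Hz Hnz) as [C1 [r0 [HC1 [Hr0 H1]]]].
  destruct Phi_turning_point as [C3 [HC3 H3]].
  pose proof (dAi_zero_neq i1 Hz Hnz) as HD. pose proof (Hnz 0 (Ai_zero_neg i1 Hz Hnz)) as HA.
  assert (HDp : 0 < Rabs (dAi i1)) by now apply Rabs_pos_lt. assert (HAp : 0 < Rabs (Ai 0)) by now apply Rabs_pos_lt.
  set (L := dAi i1 / Ai 0) in *.
  assert (HL : L <> 0). { unfold L, Rdiv. apply Rmult_integral_contrapositive_currified; auto. now apply Rinv_neq_0_compat. }
  assert (HLp : 0 < Rabs L) by now apply Rabs_pos_lt.
  assert (ELA : Rabs (dAi i1) = Rabs L * Rabs (Ai 0)). { rewrite <- Rabs_mult. f_equal. unfold L. field. auto. }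
  pose proof Ai_0_K0 as EK. pose proof PI_RGT_0 as HPI.
  assert (HKp : 0 < Rabs (airy_K0 0)).
  { rewrite EK. apply Rmult_lt_0_compat; auto. apply Rmult_lt_0_compat; auto. apply exp_pos. }
  assert (HK : airy_K0 0 <> 0). { intros E. rewrite E, Rabs_R0 in HKp. lra. }
  pose proof (Rabs_pos i1) as Hi.
  destruct (near_1_final (C1 / Rabs L) (C3 / Rabs (airy_K0 0)) (C1 + (Rabs i1 + 7))) as [M [HM Hfin]].
  { apply Rmult_le_pos; [lra | left; now apply Rinv_0_lt_compat]. }
  { apply Rmult_le_pos; [lra | left; now apply Rinv_0_lt_compat]. }
  { lra. }
  (* This makes r = ((k + 1/2) / 2)^(1/3) at least 2 + r0. *)
  destruct (nat_above (2 * (2 + r0) ^ 3)) as [K HKn].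
  exists (2 * M), K. intros k X0 HkK Hk1 HX0. specialize (HKn k HkK).
  assert (Hx : 1 <= INR k) by (apply (le_INR 1); lia).
  set (r := Rpower ((INR k + 1 / 2) / 2) (1 / 3)).
  destruct (Rpower_third_cube ((INR k + 1 / 2) / 2) ltac:(lra)) as [_ Hr3]. fold r in Hr3.
  assert (Hr : 2 + r0 <= r) by (apply Rpower_third_ge; lra).
  pose proof (inv_le_2_Rpower (INR k) ((INR k + 1 / 2) / 2) ltac:(lra) ltac:(lra)) as Hinv. fold r in Hinv.
  assert (Hh : 0 < / r <= 1 / 2) by (apply inv_le_half; lra).
  assert (Hrr : C1 / r ^ 2 <= C1 * / r).
  { unfold Rdiv. apply Rmult_le_compat_l; [lra |]. apply Rinv_le_contravar; nra. }
  destruct (H1 k r X0 ltac:(lra) ltac:(lra) HX0) as [s0 [l [Hs0 [Hl Etau]]]].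
  specialize (H3 k r ltac:(lra) ltac:(lra)). cbv zeta in H3.
  pose proof (part1_log i1 k r Hk1 ltac:(lra) eq_refl) as Hlog. cbv zeta in Hlog.
  replace (2 * r ^ 3) with (INR k + 1 / 2) in * by lra.
  set (nu := INR k + 1 / 2) in *. set (u := 1 - / r) in *. set (rho := (1 + u ^ 2) / (2 * u)) in *.
  assert (Hu : 1 / 2 <= u < 1) by (unfold u; lra).
  assert (Hu2 : 0 < 1 + u ^ 2) by nra.
  assert (Hrho : 0 < rho) by (unfold rho; apply Rdiv_lt_0_compat; lra).
  set (J := rho * (1 + u ^ 2) ^ k * exp (- (nu * u))) in *.
  assert (HJ : 0 < J).
  { unfold J. apply Rmult_lt_0_compat; [apply Rmult_lt_0_compat; [auto | now apply pow_lt] | apply exp_pos]. }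
  pose proof (wallis_pos k) as Hw.
  set (ph := Phi (S k) (nu ^ 2 / 4)) in *.
  set (Lnum := ln PI - 1 / 3 + ln rho + INR k * ln (1 + u ^ 2) - nu * u + r * i1 - ln (wallis k) - 2 * ln r) in Hlog.
  set (Lden := 1 / 3 * ln 4 + (ln PI - 1) / 2 + INR k * (ln 2 - 1) + i1 * Rpower (INR k / 2) (1 / 3) - 1 / 6 * ln (INR k)) in Hlog.
  assert (EN : exp Lnum = PI * exp (- (1 / 3)) * J * exp (r * i1) / (wallis k * r ^ 2)).
  { unfold Lnum. replace (_ - 2 * ln r) with (ln PI + - (1 / 3) + ln rho + INR k * ln (1 + u ^ 2) + - (nu * u) + r * i1 + - ln (wallis k) + - (INR 2 * ln r)) by (simpl INR; ring).
    rewrite !exp_plus, (exp_Ropp (ln _)), (exp_Ropp (INR 2 * _)), !exp_nat_ln, !exp_ln by lra.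
    unfold J. field. lra. }
  assert (ED : exp Lden = Rpower 4 (1/3) * sqrt (PI / exp 1) * (2 / exp 1) ^ k * exp (- (- i1 / Rpower 2 (1/3)) * Rpower (INR k) (1/3)) * Rpower (INR k) (- (1/6))).
  { assert (He : forall y, 0 < y -> ln (y / exp 1) = ln y - 1) by (intros y Hy; rewrite ln_div, ln_exp; auto; apply exp_pos).
    pose proof (exp_pos 1) as He1.
    rewrite (sqrt_exp_ln (PI / exp 1)), <- (exp_nat_ln k (2 / exp 1)), !He by (try apply Rdiv_lt_0_compat; lra).
    replace (- (- i1 / Rpower 2 (1/3)) * Rpower (INR k) (1/3)) with (i1 * Rpower (INR k / 2) (1 / 3)).
    - unfold Rpower at 1 3. rewrite <- !exp_plus. f_equal. unfold Lden. ring.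
    - assert (E2 : Rpower (INR k / 2) (1 / 3) = Rpower (INR k) (1 / 3) / Rpower 2 (1 / 3)).
      { unfold Rpower, Rdiv at 1. rewrite ln_div, Rmult_minus_distr_l by lra. unfold Rminus. rewrite exp_plus, exp_Ropp. reflexivity. }
      rewrite E2. field. apply Rgt_not_eq, exp_pos. }
  set (V := Rabs l / Rabs L). set (W := Rabs (wallis k / 2 * ph * (r / J)) / Rabs (airy_K0 0)).
  assert (HV : Rabs (V - 1) <= C1 / Rabs L * / r).
  { eapply Rle_trans. apply (near_1_ratio l L (C1 / r ^ 2)); auto.
    replace (C1 / Rabs L * / r) with (C1 * / r / Rabs L) by (field; lra).
    apply Rmult_le_compat_r; auto. left; now apply Rinv_0_lt_compat. }
  assert (HW : Rabs (W - 1) <= C3 / Rabs (airy_K0 0) * / r).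
  { eapply Rle_trans. apply (near_1_ratio _ (airy_K0 0) (C3 / r)); auto. right. field. lra. }
  (* Here the accuracy O(1/r^2) of the zero is spent: r (s0 - i1) is O(1/r). *)
  assert (HE : Rabs (r * (s0 - i1) + (Lnum - Lden)) <= (C1 + (Rabs i1 + 7)) * / r).
  { eapply Rle_trans. apply Rabs_triang. rewrite Rmult_plus_distr_r. apply Rplus_le_compat; auto.
    rewrite Rabs_mult, (Rabs_pos_eq r) by lra.
    apply Rle_trans with (r * (C1 / r ^ 2)). apply Rmult_le_compat_l; lra. right; field; lra. }
  specialize (Hfin (/ r) V W _ ltac:(lra) HV HW HE).
  apply Rle_trans with (M * / r).
  2:{ replace (2 * M * Rpower (INR k) (- (1 / 3))) with (M * (2 * Rpower (INR k) (- (1 / 3)))) by ring. now apply Rmult_le_compat_l. }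
  replace (Rabs (Phi k X0) / _) with (V * W * exp (r * (s0 - i1) + (Lnum - Lden))); auto.
  replace (Rpower 4 (1/3) * sqrt (PI / exp 1) * Rabs (dAi i1) * (2 / exp 1) ^ k
       * exp (- (- i1 / Rpower 2 (1/3)) * Rpower (INR k) (1/3)) * Rpower (INR k) (- (1/6))) with (Rabs (dAi i1) * exp Lden) by (rewrite ED; ring).
  rewrite Etau. 
  replace (exp (r * (s0 - i1) + (Lnum - Lden))) with (exp (r * s0) * / exp (r * i1) * (exp Lnum * / exp Lden)).
  2:{ rewrite <- !exp_Ropp, <- !exp_plus. f_equal. ring. }
  rewrite EN. unfold V, W. rewrite ELA, EK.
  rewrite !Rabs_mult, (Rabs_pos_eq (wallis k / 2)), (Rabs_pos_eq (r / J)).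
  - pose proof (exp_pos (r * i1)). pose proof (exp_pos (- (1 / 3))). pose proof (exp_pos Lden).
    field. repeat split; lra.
  - apply Rmult_le_pos; [lra | left; now apply Rinv_0_lt_compat].
  - lra.
Qed.

Lemma tau_star2_asymptotics (i1 : R) : Ai i1 = 0 -> (forall x, i1 < x -> Ai x <> 0) ->
  exists M K, forall p h, (K <= p)%nat -> is_largest_zero (he p) h ->
    Rabs (INR (fact (S p)) * Rabs (he (S p) h) / (sqrt (2 * PI / exp 1) * Rabs (dAi i1) * sqrt (exp 1 * INR (S p) / 2) ^ (S p)
       * exp (- Rabs i1 * Rpower (INR (S p)) (1/3)) * Rpower (INR (S p)) (- (1/6))) - 1)
    <= M * Rpower (INR (S p)) (- (1/3)).
Proof.
  intros Hz Hnz.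
  destruct (he_zero_near_Ai_zero i1 Hz Hnz) as [C1 [r0 [HC1 [Hr0 H1]]]].
  destruct he_turning_point as [C3 [HC3 H3]].
  pose proof (Ai_zero_neg i1 Hz Hnz) as Hi1.
  pose proof (dAi_zero_neq i1 Hz Hnz) as HD. pose proof (Hnz 0 Hi1) as HA.
  assert (HDp : 0 < Rabs (dAi i1)) by now apply Rabs_pos_lt. assert (HAp : 0 < Rabs (Ai 0)) by now apply Rabs_pos_lt.
  set (L := dAi i1 / Ai 0) in *.
  assert (HL : L <> 0). { unfold L, Rdiv. apply Rmult_integral_contrapositive_currified; auto. now apply Rinv_neq_0_compat. }
  assert (HLp : 0 < Rabs L) by now apply Rabs_pos_lt.
  assert (ELA : Rabs (dAi i1) = Rabs L * Rabs (Ai 0)). { rewrite <- Rabs_mult. f_equal. unfold L. field. auto. }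
  pose proof Ai_0_K0 as EK. pose proof PI_RGT_0 as HPI.
  assert (HKp : 0 < Rabs (airy_K0 0)).
  { rewrite EK. apply Rmult_lt_0_compat; auto. apply Rmult_lt_0_compat; auto. apply exp_pos. }
  assert (HK : airy_K0 0 <> 0). { intros E. rewrite E, Rabs_R0 in HKp. lra. }
  pose proof (Rabs_pos i1) as Hi. pose proof (pow2_ge_0 (Rabs i1 + C1)) as HiC.
  destruct (near_1_final (C1 / Rabs L) (C3 / Rabs (airy_K0 0)) (C1 + (Rabs i1 + C1) ^ 2 + (Rabs i1 + 7))) as [M [HM Hfin]].
  { apply Rmult_le_pos; [lra | left; now apply Rinv_0_lt_compat]. }
  { apply Rmult_le_pos; [lra | left; now apply Rinv_0_lt_compat]. }
  { lra. }
  destruct (nat_above ((2 + r0) ^ 3)) as [K HKn].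
  exists (2 * M), (max 2 K). intros p hz HpK Hhz. specialize (HKn p ltac:(lia)).
  assert (Hx : 2 <= INR p) by (apply (le_INR 2); lia).
  set (r := Rpower (INR p + 1 / 2) (1 / 3)).
  destruct (Rpower_third_cube (INR p + 1 / 2) ltac:(lra)) as [_ Hr3]. fold r in Hr3.
  assert (Hr : 2 + r0 <= r) by (apply Rpower_third_ge; lra).
  rewrite S_INR. set (x := INR p + 1).
  pose proof (inv_le_2_Rpower x (INR p + 1 / 2) ltac:(unfold x; lra) ltac:(unfold x; lra)) as Hinv. fold r in Hinv.
  assert (Hh : 0 < / r <= 1 / 2) by (apply inv_le_half; lra).
  assert (Hrr : C1 / r ^ 2 <= C1 * / r).
  { unfold Rdiv. apply Rmult_le_compat_l; [lra |]. apply Rinv_le_contravar; nra. }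
  destruct (H1 p r hz ltac:(lia) ltac:(lra) ltac:(lra) Hhz) as [s0 [l [Hs0 [Hl Etau]]]].
  specialize (H3 p r ltac:(lra) ltac:(lra)). cbv zeta in H3.
  pose proof (part2_log i1 p r ltac:(lra) eq_refl) as Hlog. cbv zeta in Hlog.
  set (N := 2 * r ^ 3) in *.
  assert (HN : 0 < N) by (unfold N; lra).
  pose proof (sqrt_lt_R0 N HN) as HsN.
  set (h := / r) in *. set (P0 := N * (1 - h) - N * (1 - h) ^ 2 / 4) in *.
  set (rho := sqrt N * (1 - h)) in *.
  assert (Hrho : 0 < rho) by (unfold rho; apply Rmult_lt_0_compat; lra).
  fold x in Hlog, Etau.
  set (hp := he p (sqrt N)) in *.
  pose proof (INR_fact_lt_0 p) as Hfact.
  set (Lnum := ln (INR (fact p)) - 1 / 3 + P0 - 2 * ln r - ln 2 - INR p * ln rho + r * i1 + ln N / 2) in Hlog.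
  set (Lden := (ln (2 * PI) - 1) / 2 + x / 2 * (1 + ln x - ln 2) + i1 * Rpower x (1 / 3) - 1 / 6 * ln x) in Hlog.
  assert (Hrp : 0 < rho ^ p) by now apply pow_lt.
  assert (EN : exp Lnum = INR (fact p) * exp (- (1 / 3)) * exp P0 * exp (r * i1) * sqrt N / (2 * r ^ 2 * rho ^ p)).
  { unfold Lnum. replace (_ + ln N / 2) with (ln (INR (fact p)) + - (1 / 3) + P0 + - (INR 2 * ln r) + - ln 2 + - (INR p * ln rho) + r * i1 + ln N / 2) by (simpl INR; ring).
    rewrite !exp_plus, (exp_Ropp (ln 2)), (exp_Ropp (INR 2 * _)), (exp_Ropp (INR p * _)), !exp_nat_ln, !exp_ln, <- sqrt_exp_ln by lra.
    field. lra. }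
  assert (ED : exp Lden = sqrt (2 * PI / exp 1) * sqrt (exp 1 * x / 2) ^ (S p) * exp (- Rabs i1 * Rpower x (1/3)) * Rpower x (- (1/6))).
  { pose proof (exp_pos 1) as He1. assert (Hxp : 0 < x) by (unfold x; lra).
    rewrite (sqrt_exp_ln (2 * PI / exp 1)), (sqrt_exp_ln (exp 1 * x / 2)) by (apply Rdiv_lt_0_compat; [apply Rmult_lt_0_compat |]; lra).
    rewrite exp_pow_nat, !ln_div, (ln_mult (exp 1) x), !ln_exp by (try apply Rmult_lt_0_compat; lra).
    rewrite (Rabs_left i1) by lra.
    unfold Rpower at 2. rewrite <- !exp_plus. f_equal. rewrite S_INR. fold x. unfold Lden. field. }
  set (V := Rabs l / Rabs L). set (W := Rabs (hp * (PI * r * rho ^ p * exp (- P0))) / Rabs (airy_K0 0)).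
  assert (HV : Rabs (V - 1) <= C1 / Rabs L * h).
  { eapply Rle_trans. apply (near_1_ratio l L (C1 / r ^ 2)); auto.
    replace (C1 / Rabs L * h) with (C1 * h / Rabs L) by (field; lra).
    apply Rmult_le_compat_r; auto. left; now apply Rinv_0_lt_compat. }
  assert (HW : Rabs (W - 1) <= C3 / Rabs (airy_K0 0) * h).
  { eapply Rle_trans. apply (near_1_ratio _ (airy_K0 0) (C3 / r)); auto. right. unfold h. field. lra. }
  assert (HE : Rabs (r * (s0 - i1) + s0 ^ 2 / (4 * r) + (Lnum - Lden)) <= (C1 + (Rabs i1 + C1) ^ 2 + (Rabs i1 + 7)) * h).
  { eapply Rle_trans. apply Rabs_triang. rewrite Rmult_plus_distr_r. apply Rplus_le_compat; auto.
    eapply Rle_trans. apply Rabs_triang. rewrite Rmult_plus_distr_r. apply Rplus_le_compat.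
    - rewrite Rabs_mult, (Rabs_pos_eq r) by lra.
      apply Rle_trans with (r * (C1 / r ^ 2)). apply Rmult_le_compat_l; lra. right; unfold h; field; lra.
    (* The Hermite weight contributes the additional exponent s0^2 / (4 r), harmless because s0 is
       bounded. *)
    - assert (Rabs s0 <= Rabs i1 + C1).
      { replace s0 with ((s0 - i1) + i1) by ring. eapply Rle_trans. apply Rabs_triang. nra. }
      assert (s0 ^ 2 <= (Rabs i1 + C1) ^ 2). { rewrite <- pow2_abs. apply pow_incr. split; auto. apply Rabs_pos. }
      pose proof (pow2_ge_0 s0).
      replace (s0 ^ 2 / (4 * r)) with (s0 ^ 2 / 4 * h) by (unfold h; field; lra).
      rewrite Rabs_pos_eq by (apply Rmult_le_pos; lra). apply Rmult_le_compat_r; lra. }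
  specialize (Hfin h V W _ ltac:(lra) HV HW HE).
  apply Rle_trans with (M * h).
  2:{ replace (2 * M * Rpower x (- (1 / 3))) with (M * (2 * Rpower x (- (1 / 3)))) by ring. now apply Rmult_le_compat_l. }
  replace (INR (fact (S p)) * Rabs (he (S p) hz) / _) with (V * W * exp (r * (s0 - i1) + s0 ^ 2 / (4 * r) + (Lnum - Lden))); auto.
  replace (sqrt (2 * PI / exp 1) * Rabs (dAi i1) * sqrt (exp 1 * x / 2) ^ (S p) * exp (- Rabs i1 * Rpower x (1/3)) * Rpower x (- (1/6)))
    with (Rabs (dAi i1) * exp Lden) by (rewrite ED; ring).
  rewrite Etau, fact_simpl, mult_INR, S_INR. fold x.
  replace (exp (r * (s0 - i1) + s0 ^ 2 / (4 * r) + (Lnum - Lden))) with (exp (r * s0 + s0 ^ 2 / (4 * r)) * / exp (r * i1) * (exp Lnum * / exp Lden)).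
  2:{ rewrite <- !exp_Ropp, <- !exp_plus. f_equal. ring. }
  rewrite EN. unfold V, W. rewrite ELA, EK.
  rewrite (Rabs_mult hp), (Rabs_pos_eq (PI * r * rho ^ p * exp (- P0))).
  - pose proof (exp_pos (r * i1)). pose proof (exp_pos (- (1 / 3))). pose proof (exp_pos Lden). rewrite (exp_Ropp P0). pose proof (exp_pos P0).
    unfold x. field. repeat split; lra.
  - apply Rmult_le_pos; [| left; apply exp_pos]. apply Rmult_le_pos; [| lra]. apply Rmult_le_pos; lra.
Qed.

Theorem theorem1p6 (i1 : R) :
  (* i1 is the largest zero of Ai *)
  Ai i1 = 0 -> (forall x, i1 < x -> Ai x <> 0) ->
  let a0 := - i1 / Rpower 2 (1/3) in
  let C0 := Rpower 4 (1/3) * sqrt (PI / exp 1) * Rabs (Derive Ai i1) in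
  let a1 := Rabs i1 in
  let C1 := sqrt (2 * PI / exp 1) * Rabs (Derive Ai i1) in
  (exists tau_star : nat -> R,
     (forall k : nat, (1 <= k)%nat ->
        is_lim_seq (fun n => tau n k) (tau_star k)) /\
     exists (C : R) (K : nat), forall k : nat, (K <= k)%nat -> (1 <= k)%nat ->
       Rabs (tau_star k /
               (C0 * (2 / exp 1) ^ k * exp (- a0 * Rpower (INR k) (1/3))
                   * Rpower (INR k) (- (1/6)))
             - 1)
       <= C * Rpower (INR k) (- (1/3))) /\
  (exists tau_star2 : nat -> R,
     (forall m : nat, (2 <= m)%nat ->
        is_lim_seq (fun n => sqrt (INR n) ^ m * tau n (n - m)%nat) (tau_star2 m)) /\
     exists (C : R) (M : nat), forall m : nat, (M <= m)%nat -> (2 <= m)%nat ->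
       Rabs (tau_star2 m /
               (C1 * sqrt (exp 1 * INR m / 2) ^ m * exp (- a1 * Rpower (INR m) (1/3))
                   * Rpower (INR m) (- (1/6)))
             - 1)
       <= C * Rpower (INR m) (- (1/3))).
Proof.
  intros Hz Hnz a0 C0 a1 C1.
  assert (ED : Derive Ai i1 = dAi i1) by (apply is_derive_unique, is_derive_Ai).
  split.
  (* Taking the limit itself as a function of k avoids choosing a first zero for every k; each use
     identifies it through uniqueness of limits. *)
  - exists (fun k => real (Lim_seq (fun n => tau n k))).
    assert (Hlim : forall k X0, (1 <= k)%nat -> is_first_zero (Phi (S k)) X0 -> Lim_seq (fun n => tau n k) = Rabs (Phi k X0)).
    { intros k X0 Hk HX0. apply is_lim_seq_unique. now apply tau_limit_k. }
    split.
    + intros k Hk. destruct (Phi_first_zero (S k)) as [X0 HX0].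
      rewrite (Hlim k X0 Hk HX0). now apply tau_limit_k.
    + destruct (tau_star_asymptotics i1 Hz Hnz) as [M [K H]]. exists M, K. intros k HK Hk.
      destruct (Phi_first_zero (S k)) as [X0 HX0]. rewrite (Hlim k X0 Hk HX0).
      unfold C0, a0. rewrite ED. now apply H.
  - exists (fun m => real (Lim_seq (fun n => sqrt (INR n) ^ m * tau n (n - m)%nat))).
    assert (Hlim : forall p, exists h, is_largest_zero (he (S p)) h /\
      is_lim_seq (fun n => sqrt (INR n) ^ (S (S p)) * tau n (n - S (S p))%nat) (INR (fact (S (S p))) * Rabs (he (S (S p)) h))).
    { intros p. destruct (he_largest_zero p) as [h [H1 H2]]. exists h. split; auto. now apply tau_limit_m. }
    split.
    + intros m Hm. destruct m as [| [| p]]; try lia. destruct (Hlim p) as [h [_ H]].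
      rewrite (is_lim_seq_unique _ _ H). exact H.
    (* [S K], because the asymptotics are indexed by the degree m - 1 of the polynomial whose zero
       is taken. *)
    + destruct (tau_star2_asymptotics i1 Hz Hnz) as [M [K H]]. exists M, (S K). intros m HK Hm.
      destruct m as [| [| p]]; try lia. destruct (Hlim p) as [h [Hh1 Hh2]].
      rewrite (is_lim_seq_unique _ _ Hh2). unfold C1, a1. rewrite ED. apply H; auto. lia.
Qed.
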